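(* Let $n,k,\omega$ be integers with $1\le k\le n-1$ and $\omega\ge1$. The map $\Psi$ identifies the quiver Grassmannian $X(k,n,\omega)$ with the union of the $\binom{n}{k}$ Schubert varieties $X_{w(I)}\subset\mathcal{AF}_n$, $I\subset[n]$, $|I|=k$; that is, $\Psi$ is an isomorphism of varieties $X(k,n,\omega)\to\bigcup_{I}X_{w(I)}$, where $w(I)\in W_n$ is determined by $$w(I)(i)=\begin{cases} i-k\omega, & i\notin I,\\ i-k\omega+n\omega,& i\in I,\end{cases}\qquad i=1,\dots,n.$$ Under $\Psi$ the action of $\mathrm{Aut}_{\Delta_n}(U_{n\omega})$ on $X(k,n,\omega)$ is identified with the action of the Iwahori subgroup $\widetilde{\mathfrak{B}}$ on the image: for every $A\in\mathrm{Aut}_{\Delta_n}(U_{n\omega})$ there is $g\in\widetilde{\mathfrak B}$ with $\Psi(A.U)=g.\Psi(U)$ for all $U\in X(k,n,\omega)$, and conversely for every $g\in\widetilde{\mathfrak B}$ there is $A\in\mathrm{Aut}_{\Delta_n}(U_{n\omega})$ with this property.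
   Context: $[m]=\{1,\dots,m\}$, $\mathbb{Z}_n=\mathbb{Z}/n\mathbb{Z}$. $\Delta_n$ is the quiver with vertex set $\mathbb{Z}_n$ and one arrow $i\to i+1$ for each $i$. $U_{n\omega}$ is the complex $\Delta_n$-representation with space $M^{(i)}=\mathbb{C}^{n\omega}$ with basis $v^{(i)}_1,\dots,v^{(i)}_{n\omega}$ at vertex $i$, whose map along $i\to i+1$ sends $v^{(i)}_j\mapsto v^{(i+1)}_{j+1}$ for $j<n\omega$ and $v^{(i)}_{n\omega}\mapsto 0$. $X(k,n,\omega)$ is the projective variety of subrepresentations $U=(U^{(i)})_{i}$ of $U_{n\omega}$ of dimension vector $(k\omega,\dots,k\omega)$; $\mathrm{Aut}_{\Delta_n}(U_{n\omega})$ acts by $A.(U^{(i)})_i=(A_i(U^{(i)}))_i$. For $i\in\mathbb{Z}$ the superscript $(i)$ is read modulo $n$, i.e. $M^{(i+n)}=M^{(i)}$, $U^{(i+n)}=U^{(i)}$. Sato Grassmannians: for $i\in\mathbb{Z}$, $\mathrm{SGr}^{(i)}$ is the ind-variety of subspaces $V\subset\mathbb{C}[t,t^{-1}]$ such that for some $N$ one has $t^N\mathbb{C}[t^{-1}]\supset V\supset t^{-N}\mathbb{C}[t^{-1}]$ and $\dim V/t^{-N}\mathbb{C}[t^{-1}]=i+N$. The affine flag variety $\mathcal{AF}_n$ of type $A_{n-1}^{(1)}$ is realized as the set of collections $(V_i)_{i\in\mathbb{Z}}\in\prod_{i\in\mathbb{Z}}\mathrm{SGr}^{(i)}$ with $V_i\subset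 V_{i+1}$ and $V_{i+n}=t^nV_i$. $W_n$ is the affine Weyl group, realized as the group of bijections $w:\mathbb{Z}\to\mathbb{Z}$ with $w(i+n)=w(i)+n$ and $\sum_{i=1}^n(w(i)-i)=0$; for $w\in W_n$ let $p_w=(\mathrm{span}\{t^{w(j)}:j\le i\})_{i\in\mathbb{Z}}\in\mathcal{AF}_n$. Put $z=t^{-n}$; then $\mathbb{C}[t,t^{-1}]$ is a free $\mathbb{C}[z,z^{-1}]$-module with ordered basis $e_s=t^{(n-k)\omega+1-s}$, $s=1,\dots,n$, and $GL_n(\mathbb{C}[z])$ acts on $\mathbb{C}[t,t^{-1}]$ in this basis. Let $\widetilde{\mathfrak B}\subset GL_n(\mathbb{C}[z])$ be the Iwahori subgroup of matrices $g(z)$ with $g(0)$ lower triangular, and $\mathfrak{B}=\widetilde{\mathfrak B}\cap SL_n(\mathbb{C}[z])$ (these groups preserve all the subspaces $\mathrm{span}\{t^j:j\le i\}$, and act on $\mathcal{AF}_n$). The Schubert variety $X_w$ is the closure $\overline{\mathfrak{B}.p_w}\subset\mathcal{AF}_n$. The map $\Psi:X(k,n,\omega)\to\mathcal{AF}_n$ is given by $\Psi(U)=(\Psi^{(i)}(U^{(i)}))_{i\in\mathbb{Z}}$, where $\Psi^{(i)}(U^{(i)})=\psi^{(i)}(U^{(i)})\oplus\mathrm{span}\{t^j:j\le i-k\omega\}$ and $\psi^{(i)}:M^{(i)}\to\mathbb{C}[t,t^{-1}]$ is the linear map $\psi^{(i)}(v^{(i)}_{n\omega+1-j})=t^{i-k\omega+j}$,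 $j\in[n\omega]$. *)

(* Defs.v *)
From HB Require Import structures.
From mathcomp Require Import all_boot all_order all_algebra.
From mathcomp Require Import finmap monalg complex.
From mathcomp Require Import boolp classical_sets reals.
(* mpoly is not imported: its names and notations clash with those of monalg *)
From mathcomp Require mpoly.

Set Implicit Arguments.
Unset Strict Implicit.
Unset Printing Implicit Defensive.

Import Order.TTheory GRing.Theory Num.Theory.
Local Open Scope classical_set_scope.
Local Open Scope ring_scope.

(* A set of points of T is given the structure of an (ind-)variety by pieces,
   each embedded in a product of projective spaces: [hcoord a x p] says that p
   lies in the piece a and that x is a system of multihomogeneous coordinates
   of p.  All the admissible x, i.e. all rescalings, are related to p, so that
   the x over a set of points form its multicone.  As for
   P^N = (F^(N+1) \ 0) / F^*, a set of points is closed when its multicone is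
   closed, and a function is regular when its pullback to the multicone is
   locally a quotient of polynomials; since multicones are stable under
   rescaling, it makes no difference whether the polynomials are required to be
   multihomogeneous (of equal multidegree).  An ind-variety carries the colimit
   topology and the limit of the sheaves of functions of its pieces. *)

Record atlas (F : fieldType) (T : Type) := Atlas {
  piece : Type;
  coord : piece -> finType;
  hcoord : forall a : piece, (coord a -> F) -> T -> Prop
}.

Section Varieties.
Context (F : fieldType).

Definition polyval (J : finType) (P : mpoly.mpoly #|J| F) (x : J -> F) : F :=
  mpoly.meval (x \o enum_val) P.

Definition zariski_closed_in (J : finType) (D A : set (J -> F)) : Prop :=
  exists S : set (mpoly.mpoly #|J| F),
    A = [set x | D x /\ forall P, S P -> polyval P x = 0].

Definition cone (T : Type) (S : atlas F T) (a : piece S) (Z : set T) :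
    set (coord a -> F) :=
  [set x | exists2 p, Z p & hcoord x p].

Definition closed_in (T : Type) (S : atlas F T) (X Z : set T) : Prop :=
  Z `<=` X /\
  forall a : piece S, zariski_closed_in (@cone T S a X) (@cone T S a Z).

Definition open_in (T : Type) (S : atlas F T) (X W : set T) : Prop :=
  W `<=` X /\ closed_in S X (X `\` W).

Definition regular_on (T : Type) (S : atlas F T) (W : set T) (f : T -> F) :
    Prop :=
  forall (a : piece S) (x : coord a -> F) (p : T), W p -> hcoord x p ->
  exists P Q : mpoly.mpoly #|coord a| F,
    polyval Q x != 0 /\
    forall (y : coord a -> F) (q : T), W q -> hcoord y q ->
      polyval Q y != 0 -> f q = polyval P y / polyval Q y.

Definition is_morphism (T1 T2 : Type) (S1 : atlas F T1) (X : set T1)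
    (S2 : atlas F T2) (Y : set T2) (phi : T1 -> T2) : Prop :=
  [/\ forall p, X p -> Y (phi p),
      forall Z, closed_in S2 Y Z -> closed_in S1 X (X `&` phi @^-1` Z)
    & forall W f, open_in S2 Y W -> regular_on S2 W f ->
        regular_on S1 (X `&` phi @^-1` W) (f \o phi)].

Definition is_isomorphism (T1 T2 : Type) (S1 : atlas F T1) (X : set T1)
    (S2 : atlas F T2) (Y : set T2) (phi : T1 -> T2) : Prop :=
  is_morphism S1 X S2 Y phi /\
  exists psi : T2 -> T1,
    [/\ is_morphism S2 Y S1 X psi,
        forall p, X p -> psi (phi p) = p
      & forall q, Y q -> phi (psi q) = q].

(* [x] is a vector of Pluecker coordinates of the d-dimensional W in F^m: the
   d-minors of a matrix whose rows form a basis of W.  All maps f are used as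
   column selections, not only increasing ones; this repeats coordinates up to
   sign and adds zeros. *)
Definition plucker_coords (d m : nat) (W : set 'rV[F]_m)
    (x : {ffun 'I_d -> 'I_m} -> F) : Prop :=
  exists B : 'M[F]_(d, m),
    [/\ row_free B,
        forall u, W u <-> (u <= B)%MS
      & forall f, x f = \det (colsub f B)].

End Varieties.

Section QuiverGrassmannian.
Context (F : fieldType) (n w : nat).

(* v_(a+1) is the standard row vector delta_mx 0 a, for a : 'I_(n * w). *)
Definition arrow : 'End('rV[F]_(n * w)) :=
  linfun (mulmxr (\matrix_(a < n * w, b < n * w) (b == a.+1 :> nat)%:R)).

Definition quiver_grassmannian (k : nat) :
    set ('Z_n -> {vspace 'rV[F]_(n * w)}) :=
  [set U : 'Z_n -> {vspace 'rV[F]_(n * w)} |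
           (forall i, (arrow @: U i <= U (i + 1)%R)%VS) /\
           forall i, \dim (U i) = (k * w)%N].

Definition quiver_grassmannian_atlas (k : nat) :
    atlas F ('Z_n -> {vspace 'rV[F]_(n * w)}) :=
  @Atlas F _ unit
    (fun _ => ('Z_n * {ffun 'I_(k * w) -> 'I_(n * w)})%type)
    (fun _ x (U : 'Z_n -> {vspace 'rV[F]_(n * w)}) => forall i : 'Z_n,
       plucker_coords [set u | u \in U i] (fun f => x (i, f))).

Definition is_aut (A : 'Z_n -> 'End('rV[F]_(n * w))) : Prop :=
  forall i, lker (A i) = 0%VS /\ (arrow \o A i = A (i + 1)%R \o arrow)%VF.

Definition aut_act (A : 'Z_n -> 'End('rV[F]_(n * w)))
    (U : 'Z_n -> {vspace 'rV[F]_(n * w)}) : 'Z_n -> {vspace 'rV[F]_(n * w)} :=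
  fun i => (A i @: U i)%VS.

End QuiverGrassmannian.

Arguments quiver_grassmannian : clear implicits.
Arguments quiver_grassmannian_atlas : clear implicits.

(* F[t, t^-1] as the F-vector space with basis (t^j)_(j : int); monalg's ring
   structure requires a monoid without nontrivial units, so multiplication by
   powers of t is defined by hand. *)
Definition laurent (F : fieldType) : lmodType F := {malg F[int]}.

Section AffineFlags.
Context (F : fieldType).
Local Notation L := (laurent F).

Definition tpow (j : int) : L := mkmalgU j 1.

Definition linext (f : int -> L) (x : L) : L :=
  \sum_(j <- msupp x) mcoeff j x *: f j.

Definition tmul (m : int) : L -> L := linext (fun j => tpow (j + m)).

Definition subspace (V : set L) : Prop :=
  V 0 /\ forall (a : F) (u v : L), V u -> V v -> V (a *: u + v).

Definition lspan (S : set L) : set L := smallest subspace S.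

(* span {t^j : j <= m} = t^m F[t^-1] *)
Definition tspan (m : int) : set L :=
  lspan [set tpow j | j in [set j : int | j <= m]].

Definition quot_dim (V E : set L) (d : nat) : Prop :=
  exists b : 'I_d -> L, (forall a, V (b a)) /\
    forall x, V x -> exists! c : 'I_d -> F, E (x - \sum_a c a *: b a).

Definition sato (i : int) : set (set L) :=
  [set V | subspace V /\ exists N : nat,
     [/\ tspan (- N%:Z) `<=` V, V `<=` tspan N%:Z
       & exists2 d : nat, d%:Z = i + N%:Z & quot_dim V (tspan (- N%:Z)) d]].

Definition affine_flag (n : nat) : set (int -> set L) :=
  [set V | [/\ forall i, sato i (V i),
               forall i, V i `<=` V (i + 1)
             & forall i, V (i + n%:Z) = tmul n%:Z @` V i]].

(* The N-th piece consists of the V with t^-N F[t^-1] <= V_i <= t^N F[t^-1] for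
   i = 1, ..., n (here i.+1 with i : 'I_n); these n components determine V.
   V_i / t^-N F[t^-1] is seen in F^(2N) through the basis t^(1-N), ..., t^N. *)
Definition affine_flag_atlas (n : nat) : atlas F (int -> set L) :=
  @Atlas F _ nat
    (fun N => {i : 'I_n & {ffun 'I_(i.+1 + N) -> 'I_(N + N)}})
    (fun N x V => forall i : 'I_n,
       [/\ tspan (- N%:Z) `<=` V i.+1%:Z, V i.+1%:Z `<=` tspan N%:Z
         & plucker_coords
             [set u : 'rV[F]_(N + N) |
                V i.+1%:Z (\sum_c u 0 c *: tpow (c.+1%:Z - N%:Z))]
             (fun f => x (existT _ i f))]).

Definition affine_weyl (n : nat) (v : int -> int) : Prop :=
  [/\ bijective v, forall i, v (i + n%:Z) = v i + n%:Z
    & \sum_(1 <= i < n.+1) (v i%:Z - i%:Z) = 0].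

Definition weyl_point (v : int -> int) : int -> set L :=
  fun i => lspan [set tpow (v j) | j in [set j : int | j <= i]].

(* Exponent of e_(s+1), for s : 'I_n. *)
Definition basis_exp (n k w : nat) (s : 'I_n) : int :=
  (n%:Z - k%:Z) * w%:Z - s%:Z.

(* p(z) x with z = t^-n *)
Definition zmul (n : nat) (p : {poly F}) (x : L) : L :=
  \sum_(d < size p) p`_d *: tmul (- (n * d)%:Z) x.

(* For each j there is exactly one s with t^j = z^m e_s, m in Z, and then
   z^m = t^(j - basis_exp s); g sends e_s to \sum_r g_rs(z) e_r. *)
Definition gl_act (n k w : nat) (g : 'M[{poly F}]_n) : L -> L :=
  linext (fun j =>
    \sum_(s < n | (n%:Z %| j - basis_exp k w s)%Z)
      tmul (j - basis_exp k w s)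
        (\sum_(r < n) zmul n (g r s) (tpow (basis_exp k w r)))).

Definition flag_act (n k w : nat) (g : 'M[{poly F}]_n) (V : int -> set L) :
    int -> set L :=
  fun i => gl_act k w g @` V i.

Definition iwahori (n : nat) : set 'M[{poly F}]_n :=
  [set g | g \in unitmx /\ is_trig_mx (map_mx (fun p => p.[0]) g)].

Definition iwahori_sl (n : nat) : set 'M[{poly F}]_n :=
  [set g | iwahori g /\ \det g = 1].

Definition schubert (n k w : nat) (v : int -> int) : set (int -> set L) :=
  smallest (closed_in (affine_flag_atlas n) (affine_flag n))
    [set flag_act k w g (weyl_point v) | g in @iwahori_sl n].

(* psi^(i); v_(a+1) = v_(n w + 1 - j) for j = n w - a. *)
Definition psi (n k w : nat) (i : int) (u : 'rV[F]_(n * w)) : L :=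
  \sum_a u 0 a *: tpow (i - (k * w)%:Z + ((n * w)%:Z - a%:Z)).

(* i%:~R : 'Z_n is the class of i modulo n. *)
Definition Psi (n k w : nat) (U : 'Z_n -> {vspace 'rV[F]_(n * w)}) :
    int -> set L :=
  fun i => [set x + y | x in psi k i @` [set u | u \in U i%:~R]
                      & y in tspan (i - (k * w)%:Z)].

End AffineFlags.

Arguments affine_flag : clear implicits.
Arguments affine_flag_atlas : clear implicits.
Arguments iwahori : clear implicits.
Arguments schubert : clear implicits.
Arguments Psi : clear implicits.

(* I : {set 'I_n} stands for the subset {a + 1 : a in I} of {1, ..., n}. *)
Definition weyl_of_set (n k w : nat) (I : {set 'I_n}) (i : int) : int :=
  i - (k * w)%:Z +
  (if [exists a in I, (i == a.+1%:Z %[mod n%:Z])%Z] then (n * w)%:Z else 0).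

(* Main.v *)
Require Import Defs.
From mathcomp Require Import all_boot all_order all_algebra.
From mathcomp Require Import complex boolp classical_sets reals.
From HB Require Import structures.
From mathcomp Require Import fingroup perm finmap monalg zify ring.
From mathcomp Require mpoly.
Import (canonicals, coercions) mpoly.

Set Implicit Arguments.
Unset Strict Implicit.
Unset Printing Implicit Defensive.

Import Order.TTheory GRing.Theory Num.Theory.
Local Open Scope classical_set_scope.
Local Open Scope ring_scope.

(** Write e_0, ..., e_(nw-1) for the standard basis of F^(nw): the arrow is the
    shift of e_a to e_(a+1), and psi^(i) sends e_a to t^(i - kw + nw - a).

    _The isomorphism._  The image of Psi consists of the flags V with
    t^(i-kw) F[t^-1] <= V_i <= t^(i-kw+nw) F[t^-1] for all i; these are called
    bounded below, and U is recovered from V as the preimage of V_i under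
    psi^(i) ([Psi_bounded], [Psi_inv_qg], [Psi_invK], [Psi_invKV]).  A basis of
    U^(i) becomes a basis of V_i modulo t^-N F[t^-1] when some powers of t are
    added to it.  The minors of such an enlarged matrix are fixed linear forms
    in the minors of the small one ([minors_of_extension]), and a suitable
    choice of columns gives the small minors back.  So Psi and its inverse are
    linear in Pluecker coordinates, and such maps are morphisms
    ([linear_in_coords_morphism], [Psi_linear], [Psi_inv_linear]).

    _The group actions._  An element of the Iwahori group preserves the spaces
    t^m F[t^-1] and commutes with t^n, so it induces an automorphism of the
    quiver representation ([gl_aut], [Psi_gl_aut]).  Conversely, an automorphism
    A is given by the images of e_0 at the n vertices, hence by a matrix G over
    F[z] for which G(0) is lower triangular and invertible.  In general det G is
    not constant, not even modulo powers of z, whereas det g is constant for g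
    in GL_n(F[z]).  But modulo any power of z one has G = s g with s a
    polynomial and g in GL_n(F[z]) ([lift_unit]).  Since s(z) acts on the
    representation through arrows, it preserves every subrepresentation, and A
    and g have the same effect on all of them ([aut_is_gl]).

    _The union of Schubert varieties._  The bounded flags form a closed set
    ([bounded_flags_closed]) which is stable under the Iwahori group and
    contains the points p_w(I), hence also the Schubert varieties of w(I).  For
    the other inclusion, every subrepresentation is the image under an
    automorphism of a coordinate subrepresentation ([subrep_normal_form]).  The
    latter is encoded by a function al on the vertices: it is generated by the
    e_(al j) at the vertices j + al j, with 0 <= al j <= nw.  If 0 < al j < nw
    for some j, then exchanging two values of j + al j gives another coordinate
    subrepresentation whose orbit has the orbit of al in its closure
    ([exchange_limit]).  The sum of the squares of al increases, so one ends with
    al taking only the values 0 and nw ([degenerate_to_extremal]), and Psi sends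
    these coordinate subrepresentations to the points p_w(I)
    ([weyl_point_Psi]).  In terms of the affine Weyl group: the elements that
    are permissible for the coweight w omega_k are admissible.

    _Different I give different Schubert varieties._  For a vertex i outside I,
    the closed condition V_i <= t^(i-kw+nw-1) F[t^-1] holds on X_w(I), and it
    fails at p_w(J) if i lies in J ([schubert_inj]). *)

(** * Minors of a matrix and its row space *)

Section Minors.
Context (F : fieldType).

Definition ffun_upd (d m : nat) (f : {ffun 'I_d -> 'I_m}) (k : 'I_d) (c : 'I_m) :
    {ffun 'I_d -> 'I_m} :=
  [ffun l => if l == k then c else f l].

(** Cramer's rule: both sides are the expansion along column k. *)
Lemma adj_mul_minor (d m : nat) (B : 'M[F]_(d, m)) (f : {ffun 'I_d -> 'I_m})
    (k : 'I_d) (c : 'I_m) :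
  (\adj (colsub f B) *m B) k c = \det (colsub (ffun_upd f k c) B).
Proof.
rewrite (expand_det_col _ k) !mxE; apply: eq_bigr => l _.
rewrite !mxE ffunE eqxx mulrC; congr (_ * _).
rewrite /cofactor; congr (_ * \det _); apply/matrixP => a b; rewrite !mxE.
by rewrite ffunE eq_sym (negPf (neq_lift _ _)).
Qed.

Lemma row_free_minor (d m : nat) (B : 'M[F]_(d, m)) : row_free B ->
  exists f : {ffun 'I_d -> 'I_m}, \det (colsub f B) != 0.
Proof.
move=> fB; have fBT : row_full B^T by rewrite /row_full mxrank_tr -/(row_free B).
exists (fullrankfun fBT).
rewrite -unitfE -unitmxE -row_full_unit -[colsub _ _]trmxK trmx_mxsub.
by have := fullrowsub_full fBT; rewrite /row_full mxrank_tr.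
Qed.

(** The conditions are linear in u and in the minors of B, so that containing a
    fixed vector is a closed condition in Pluecker coordinates.  Multiplying B by
    the adjugate of colsub f B makes them visible. *)
Lemma sub_minorP (d m : nat) (B : 'M[F]_(d, m)) (u : 'rV[F]_m) : row_free B ->
  (u <= B)%MS <->
  forall (f : {ffun 'I_d -> 'I_m}) (c : 'I_m),
    \det (colsub f B) * u 0 c =
    \sum_k u 0 (f k) * \det (colsub (ffun_upd f k c) B).
Proof.
move=> fB.
have key (f : {ffun 'I_d -> 'I_m}) c :
    \sum_k u 0 (f k) * \det (colsub (ffun_upd f k c) B) =
    (colsub f u *m (\adj (colsub f B) *m B)) 0 c.
  by rewrite [RHS]mxE; apply: eq_bigr => k _; rewrite adj_mul_minor !mxE.
split.
  case/submxP => a Eu f c; rewrite key Eu.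
  by rewrite -mulmx_colsub -mulmxA (mulmxA (colsub f B)) mul_mx_adj mul_scalar_mx
     -scalemxAr [RHS]mxE.
move=> H; have [f fn0] := row_free_minor fB.
suff -> : u = (\det (colsub f B))^-1 *: (colsub f u *m (\adj (colsub f B) *m B)).
  by rewrite scalemx_sub // mulmxA submxMl.
apply/rowP => c; rewrite mxE -key -H mulrA mulVf ?mul1r //.
Qed.

(** If the minors that involve column c vanish, then Cramer's rule writes u 0 c as a
    combination of them; conversely such a minor has a zero column. *)
Lemma row_sub_minorP (d m : nat) (B : 'M[F]_(d, m)) (c : 'I_m) : row_free B ->
  (forall u : 'rV[F]_m, (u <= B)%MS -> u 0 c = 0) <->
  (forall (f : {ffun 'I_d -> 'I_m}) k, f k = c -> \det (colsub f B) = 0).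
Proof.
move=> fB; split=> H.
  move=> f k fk; rewrite (expand_det_col _ k) big1 // => l _.
  rewrite !mxE fk; have := H (row l B) (row_sub _ _).
  by rewrite mxE => ->; rewrite mul0r.
have [f fn0] := row_free_minor fB.
move=> u /sub_minorP -/(_ fB f c) E.
apply: (mulfI fn0); rewrite E mulr0 big1 // => k _.
by rewrite (H _ k) ?mulr0 // ffunE eqxx.
Qed.

(** By [sub_minorP] the minors alone decide which vectors lie in the row space. *)
Lemma minors_sub (d m : nat) (B B' : 'M[F]_(d, m)) : row_free B -> row_free B' ->
  (forall f : {ffun 'I_d -> 'I_m}, \det (colsub f B) = \det (colsub f B')) ->
  (B <= B')%MS.
Proof.
move=> fB fB' E; apply/rV_subP => u uB; apply/(sub_minorP u fB') => f c.
rewrite -E (iffLR (sub_minorP u fB) uB); apply: eq_bigr => k _.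
by rewrite E.
Qed.

End Minors.

Section AlternatingExpansion.
Context (F : numFieldType).

Definition sel_mx (d m : nat) (g : {ffun 'I_d -> 'I_m}) : 'M[F]_(d, m) :=
  \matrix_(k, c) (c == g k)%:R.

Lemma det_rows_expand (a d m : nat) (T : 'M[F]_(a, a + d)) (J : 'M[F]_(m, a + d))
    (B : 'M[F]_(d, m)) :
  \det (col_mx T (B *m J)) =
  \sum_(g : {ffun 'I_d -> 'I_m}) (\prod_k B k (g k)) * \det (col_mx T (sel_mx g *m J)).
Proof.
pose phi (N : 'M[F]_(d, a + d)) := \det (col_mx T N).
rewrite -[LHS]/(phi _).
have expd (s : 'S_(a + d)) (N : 'M[F]_(d, a + d)) :
    \prod_i col_mx T N i (s i) =
    (\prod_i T i (s (lshift d i))) * \prod_i N i (s (rshift a i)).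
  rewrite big_split_ord /=; congr (_ * _); apply: eq_bigr => i _.
    by rewrite col_mxEu.
  by rewrite col_mxEd.
rewrite /phi /determinant.
under eq_bigr => s _.
  rewrite expd.
  under [X in _ * (_ * X)]eq_bigr => i _ do rewrite mxE.
  rewrite bigA_distr_bigA /= !mulr_sumr.
  over.
rewrite exchange_big /=; apply: eq_bigr => g _.
rewrite mulr_sumr; apply: eq_bigr => s _.
rewrite expd big_split /= [RHS]mulrCA; congr (_ * _).
rewrite mulrCA; congr (_ * (_ * _)).
apply: eq_bigr => k _; rewrite mxE (bigD1 (g k)) //= mxE eqxx mul1r.
by rewrite big1 ?addr0 // => c /negPf cn; rewrite mxE cn mul0r.
Qed.

Lemma det_rows_perm (a d m : nat) (T : 'M[F]_(a, a + d)) (J : 'M[F]_(m, a + d))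
    (g : {ffun 'I_d -> 'I_m}) (s : 'S_d) :
  \det (col_mx T (sel_mx [ffun k => g (s k)] *m J)) =
  (-1) ^+ s * \det (col_mx T (sel_mx g *m J)).
Proof.
have -> : sel_mx [ffun k => g (s k)] = perm_mx s *m sel_mx g.
  rewrite -row_permE; apply/matrixP => k c; by rewrite !mxE ffunE.
have -> : col_mx T (perm_mx s *m sel_mx g *m J) =
    block_mx 1%:M 0 0 (perm_mx s) *m col_mx T (sel_mx g *m J).
  by rewrite mul_block_col !mul0mx mul1mx addr0 add0r mulmxA.
by rewrite det_mulmx det_ublock det1 mul1r det_perm.
Qed.

(** The determinant on the left is a multilinear and alternating function of the rows
    of B, so it is a combination of the maximal minors of B.  Summing over all
    functions g, and not only over the increasing ones, counts each minor d! times;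
    this is why the characteristic is assumed to be 0. *)
Lemma det_rows_minors (a d m : nat) (T : 'M[F]_(a, a + d)) (J : 'M[F]_(m, a + d))
    (B : 'M[F]_(d, m)) :
  \det (col_mx T (B *m J)) =
  \sum_(g : {ffun 'I_d -> 'I_m})
     (d`!%:R^-1 * \det (col_mx T (sel_mx g *m J))) * \det (colsub g B).
Proof.
have d0 : d`!%:R != 0 :> F by rewrite pnatr_eq0 -lt0n fact_gt0.
apply: (mulfI d0); rewrite [RHS]mulr_sumr.
under [RHS]eq_bigr => g _.
  rewrite !mulrA (mulfV d0) mul1r /determinant mulr_sumr.
  over.
rewrite exchange_big /= mulr_natl.
have -> : d`! = #|{: 'S_d}| by rewrite card_Sn.
rewrite -sumr_const; apply: eq_bigr => s _.
rewrite det_rows_expand.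
pose h (t : 'S_d) (g : {ffun 'I_d -> 'I_m}) := [ffun k => g (t k)].
have hK t : cancel (h t) (h t^-1%g).
  by move=> g; apply/ffunP => k; rewrite !ffunE permKV.
have hK' : cancel (h s^-1%g) (h s) by move=> g; rewrite -{1}[s]invgK hK.
rewrite (reindex (h s)) /=; last by exists (h s^-1%g) => g _; [apply: hK | apply: hK'].
apply: eq_bigr => g _; rewrite det_rows_perm mulrC -!mulrA mulrCA.
congr (_ * (_ * _)); apply: eq_bigr => k _; by rewrite !mxE ffunE.
Qed.

(** The enlarged matrix is stated up to a cast, because in the coordinates of flags its
    number of rows is not written as a sum a + d. *)
Lemma minors_of_extension (a d d' m M : nat) (e : (a + d)%N = d')
    (T : 'M[F]_(a, M)) (J : 'M[F]_(m, M)) (f : {ffun 'I_d' -> 'I_M}) :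
  exists l : {ffun 'I_d -> 'I_m} -> F, forall B : 'M[F]_(d, m),
    \det (colsub f (castmx (e, erefl) (col_mx T (B *m J)))) =
    \sum_g l g * \det (colsub g B).
Proof.
subst d'.
exists (fun g => d`!%:R^-1 * \det (col_mx (colsub f T) (sel_mx g *m colsub f J))) => B.
rewrite -det_rows_minors castmx_id; congr (\det _).
apply/matrixP => i j; rewrite !mxE; case: splitP => k _; rewrite !mxE //.
by apply: eq_bigr => l _; rewrite !mxE.
Qed.

End AlternatingExpansion.

(** * Closed sets and regular maps in multihomogeneous coordinates *)

Section LinearForms.
Context (F : fieldType).

Definition linform (J : finType) (l : J -> F) : mpoly.mpoly #|J| F :=
  \sum_(j : J) l j *: mpoly.mpolyX F (mpoly.mnm1 (enum_rank j)).

Lemma polyval_linform (J : finType) (l : J -> F) (x : J -> F) :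
  polyval (linform l) x = \sum_j l j * x j.
Proof.
rewrite /polyval /linform raddf_sum /=; apply: eq_bigr => j _.
by rewrite mpoly.mevalZ mpoly.mevalXU /= enum_rankK.
Qed.

Lemma polyval_subst_linforms (J K : finType) (A : K -> J -> F)
    (P : mpoly.mpoly #|K| F) :
  exists P' : mpoly.mpoly #|J| F, forall x,
    polyval P' x = polyval P (fun k => \sum_j A k j * x j).
Proof.
exists (mpoly.comp_mpoly [tuple linform (A (enum_val i)) | i < #|K|] P) => x.
rewrite /polyval mpoly.comp_mpoly_meval; apply: mpoly.meval_eq => i.
by rewrite tnth_mktuple [LHS]polyval_linform.
Qed.

Definition linear_in_coords (T1 T2 : Type) (S1 : atlas F T1) (X : set T1)
    (S2 : atlas F T2) (phi : T1 -> T2) : Prop :=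
  forall a : piece S1, exists b : piece S2, exists A : Defs.coord b -> Defs.coord a -> F,
    forall (x : Defs.coord a -> F) (p : T1), X p -> hcoord x p ->
      hcoord (fun k => \sum_j A k j * x j) (phi p).

Definition separated_by_coords (T : Type) (S : atlas F T) (Y : set T) : Prop :=
  forall (b : piece S) (y : Defs.coord b -> F) (q q' : T),
    Y q -> Y q' -> hcoord y q -> hcoord y q' -> q = q'.

(** A linear substitution of the coordinates pulls polynomials back to polynomials, so
    that equations of closed sets and local fractions can be pulled back.  That the
    coordinates separate the points is needed because a cone is an image: a point of
    the cone of Z must come from phi p itself. *)
Lemma linear_in_coords_morphism (T1 T2 : Type) (S1 : atlas F T1) (X : set T1)
    (S2 : atlas F T2) (Y : set T2) (phi : T1 -> T2) :
  (forall p, X p -> Y (phi p)) -> linear_in_coords S1 X S2 phi ->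
  separated_by_coords S2 Y -> is_morphism S1 X S2 Y phi.
Proof.
move=> XY lin sep; split => //.
  move=> Z [ZY Zc]; split; first by move=> p [].
  move=> a; have [b [A HA]] := lin a.
  have [SS ES] := Zc b.
  exists [set P' | exists2 P, SS P & forall x,
    polyval P' x = polyval P (fun k => \sum_j A k j * x j)].
  apply/seteqP; split => x /=.
    move=> [p [Xp Zp] xp]; split; first by exists p.
    move=> P' [P SP ->].
    have : cone Z (fun k => \sum_j A k j * x j) by exists (phi p) => //; apply: HA.
    by rewrite ES => -[_ /(_ _ SP)].
  move=> [[p Xp xp] H].
  have : cone Z (fun k => \sum_j A k j * x j).
    rewrite ES; split.
      by exists (phi p); [apply: XY | apply: HA].
    move=> P SP; have [P' EP] := polyval_subst_linforms A P.
    by rewrite -EP; apply: H; exists P.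
  case=> q Zq yq; exists p => //; split=> //=.
  have -> // : phi p = q.
  by apply: (sep _ _ _ _ _ _ _ yq); [apply: XY | apply: ZY | apply: HA].
move=> W f oW reg a x p [Xp Wp] xp.
have [b [A HA]] := lin a.
have [P [Q [Qn0 HPQ]]] := reg b _ _ Wp (HA _ _ Xp xp).
have [P' EP] := polyval_subst_linforms A P.
have [Q' EQ] := polyval_subst_linforms A Q.
exists P', Q'; rewrite EQ; split=> // y q [Xq Wq] yq.
rewrite EQ EP; apply: HPQ => //; exact: HA.
Qed.

(** Membership in C is tested by polynomials on the coordinates of the points of X,
    separately on each piece; unlike closedness this is visibly stable under
    intersections. *)
Definition coord_closed_cond (T : Type) (S : atlas F T) (X C : set T) : Prop :=
  forall a : piece S, exists SS : set (mpoly.mpoly #|Defs.coord a| F),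
    forall (x : Defs.coord a -> F) p, X p -> hcoord x p ->
      (C p <-> forall P, SS P -> polyval P x = 0).

Lemma coord_closed_condI (T I : Type) (S : atlas F T) (X : set T) (D : set I)
    (C : I -> set T) :
  (forall i, D i -> coord_closed_cond S X (C i)) ->
  coord_closed_cond S X (\bigcap_(i in D) C i).
Proof.
move=> H a.
have /choice [SS HSS] : forall i, exists SS : set (mpoly.mpoly #|Defs.coord a| F), D i ->
    forall (x : Defs.coord a -> F) p, X p -> hcoord x p ->
      (C i p <-> forall P, SS P -> polyval P x = 0).
  move=> i; have [Di|nDi] := pselect (D i); last by exists set0 => /nDi.
  by have [SS HS] := H i Di a; exists SS.
exists (\bigcup_(i in D) SS i) => x p Xp xp; split.
  move=> Cp P [i Di SP]; exact: (iffLR (HSS i Di x p Xp xp) (Cp i Di) P SP).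
by move=> HP i Di; apply/(HSS i Di x p Xp xp) => P SP; apply: HP; exists i.
Qed.

Lemma coord_closed (T : Type) (S : atlas F T) (X C : set T) :
  coord_closed_cond S X C -> closed_in S X (X `&` C).
Proof.
move=> H; split; first by move=> p [].
move=> a; have [SS HS] := H a; exists SS.
apply/seteqP; split => x /=.
  move=> [p [Xp Cp] xp]; split; first by exists p.
  exact/(HS x p Xp xp).
by move=> [[p Xp xp] HP]; exists p => //; split => //; apply/(HS x p Xp xp).
Qed.

Lemma morphism_closed (T1 T2 : Type) (S1 : atlas F T1) (X : set T1)
    (S2 : atlas F T2) (Y : set T2) (phi : T1 -> T2) (Z : set T2) :
  is_morphism S1 X S2 Y phi -> closed_in S2 Y Z -> closed_in S1 X (X `&` phi @^-1` Z).
Proof. by case=> _ H _; apply: H. Qed.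

End LinearForms.

Section PluckerCoords.
Context (F : fieldType).

Lemma plucker_coords_inj (d m : nat) (W W' : set 'rV[F]_m)
    (x : {ffun 'I_d -> 'I_m} -> F) :
  plucker_coords W x -> plucker_coords W' x -> W = W'.
Proof.
move=> [B [fB WB xB]] [B' [fB' WB' xB']].
have E (f : {ffun 'I_d -> 'I_m}) : \det (colsub f B) = \det (colsub f B') by rewrite -xB -xB'.
have s1 := minors_sub fB fB' E.
have s2 := minors_sub fB' fB (fun f => esym (E f)).
apply/seteqP; split => u.
  by move=> /WB uB; apply/WB'; apply: submx_trans s1.
by move=> /WB' uB; apply/WB; apply: submx_trans s2.
Qed.

Lemma basis_change (d m : nat) (B B' : 'M[F]_(d, m)) : row_free B -> row_free B' ->
  (forall u : 'rV[F]_m, (u <= B)%MS <-> (u <= B')%MS) ->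
  exists2 D : 'M[F]_d, D \in unitmx & B' = D *m B.
Proof.
move=> fB fB' E; have /submxP [D ED] : (B' <= B)%MS.
  by apply/rV_subP => u /E.
exists D => //; rewrite -row_free_unit /row_free eqn_leq rank_leq_row /=.
by rewrite -{1}(eqP fB') ED mxrankM_maxl.
Qed.

Lemma plucker_coords_scale (d m : nat) (W : set 'rV[F]_m)
    (x : {ffun 'I_d -> 'I_m} -> F) (D : 'M[F]_d) : D \in unitmx ->
  plucker_coords W x -> plucker_coords W (fun f => \det D * x f).
Proof.
move=> uD [B [fB WB xB]]; exists (D *m B); split.
- by rewrite /row_free mxrankMfree // -/(row_free D) row_free_unit.
- move=> u; rewrite WB; suff E : (D *m B :=: B)%MS by rewrite E.
  by apply: eqmxMfull; rewrite row_full_unit.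
- by move=> f; rewrite xB -det_mulmx mulmx_colsub.
Qed.

End PluckerCoords.

Section PencilLimit.
Context (F : numFieldType).

Lemma poly_root_except0 (p : {poly F}) : (forall b, b != 0 -> p.[b] = 0) -> p = 0.
Proof.
move=> H; apply/eqP/negPn/negP => pn0.
suff : (size [seq (i.+1)%:R : F | i <- iota 0 (size p)] < size p)%N.
  by rewrite size_map size_iota ltnn.
apply: max_poly_roots => //.
  by apply/allP => _ /mapP[i _ ->]; apply/rootP/H; rewrite pnatr_eq0.
by rewrite map_inj_uniq ?iota_uniq // => i j /eqP; rewrite eqr_nat => /eqP[].
Qed.

Lemma polyval_pencil (J : finType) (P : mpoly.mpoly #|J| F) (x : J -> {poly F}) :
  exists q : {poly F}, forall b, q.[b] = polyval P (fun j => (x j).[b]).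
Proof.
exists (\sum_(m <- mpoly.msupp P) mpoly.mcoeff m P *:
          \prod_i x (enum_val i) ^+ (m i)) => b.
rewrite /polyval mpoly.mevalE horner_sum; apply: eq_bigr => m _.
rewrite hornerZ horner_prod; congr (_ * _); apply: eq_bigr => i _.
by rewrite horner_exp.
Qed.

(** A polynomial that vanishes for all nonzero values of a parameter vanishes also at
    zero, because the field is infinite.  Hence a closed set that contains the points
    U b of a curve with polynomial coordinates, for b nonzero, contains U 0. *)
Lemma pencil_limit (T : Type) (S : atlas F T) (X Z : set T) (a : piece S)
    (x : Defs.coord a -> {poly F}) (U : F -> T) :
  closed_in S X Z -> separated_by_coords S X ->
  (forall b, X (U b)) -> (forall b, hcoord (fun j => (x j).[b]) (U b)) ->
  (forall b, b != 0 -> Z (U b)) -> Z (U 0).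
Proof.
move=> [ZX cZ] sep XU xU ZU.
have [SS ES] := cZ a.
suff : cone Z (fun j => (x j).[0]).
  by case=> q Zq xq; rewrite (sep _ _ _ _ (XU 0) (ZX _ Zq) (xU 0) xq).
rewrite ES; split; first by exists (U 0).
move=> P SP; have [q Hq] := polyval_pencil P x.
rewrite -Hq (poly_root_except0 (p := q)) ?horner0 // => b bn0.
have : cone Z (fun j => (x j).[b]) by exists (U b); [apply: ZU|].
by rewrite Hq ES => -[_]; apply.
Qed.

End PencilLimit.

(** * Laurent polynomials as a vector space *)

Section Laurent.
Context (F : fieldType).
Local Notation L := (laurent F).
Implicit Types (x y : L) (j l m : int).

Lemma laurentP x y : (forall l, mcoeff l x = mcoeff l y) -> x = y.
Proof. by move=> H; apply/malgP. Qed.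

Lemma mcoeff_tpow j l : mcoeff l (tpow F j) = (j == l)%:R.
Proof. by rewrite /tpow mcoeffU. Qed.

Lemma mcoeff_sum l (I : Type) (r : seq I) (P : pred I) (f : I -> L) :
  mcoeff l (\sum_(i <- r | P i) f i) = \sum_(i <- r | P i) mcoeff l (f i).
Proof. exact: (raddf_sum (@mcoeff int F l)). Qed.

Lemma laurent_sum x : x = \sum_(j <- msupp x) mcoeff j x *: tpow F j.
Proof.
apply: laurentP => l; rewrite mcoeff_sum.
have [lx|lx] := boolP (l \in msupp x).
  rewrite (big_fsetD1 l) //= mcoeffZ mcoeff_tpow eqxx mulr1 big1_fset ?addr0 //.
  by move=> j; rewrite in_fsetD1 => /andP[/negPf jl _] _; rewrite mcoeffZ mcoeff_tpow jl mulr0.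
rewrite (mcoeff_outdom lx) big1_fset // => j jx _; rewrite mcoeffZ mcoeff_tpow.
by case: eqP jx lx => [->-> //|_ _ _]; rewrite mulr0.
Qed.

Lemma linextEw (f : int -> L) x (D : {fset int}) : (msupp x `<=` D)%fset ->
  linext f x = \sum_(j <- D) mcoeff j x *: f j.
Proof.
move=> sD; rewrite /linext; apply: big_fset_incl => // j _ /mcoeff_outdom ->.
by rewrite scale0r.
Qed.

Lemma linext_is_linear (f : int -> L) : linear (linext f).
Proof.
move=> a x y; pose D := (msupp x `|` msupp y)%fset.
have sx : (msupp x `<=` D)%fset by apply: fsubsetUl.
have sy : (msupp y `<=` D)%fset by apply: fsubsetUr.
have sa : (msupp (a *: x + y) `<=` D)%fset.
  apply: fsubset_trans (msuppD_le _ _) _; rewrite fsubUset sy andbT.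
  exact: fsubset_trans (msuppZ_le _ _) sx.
rewrite (linextEw f sx) (linextEw f sy) (linextEw f sa) scaler_sumr -big_split /=.
by apply: eq_bigr => j _; rewrite mcoeffD mcoeffZ scalerDl scalerA.
Qed.

HB.instance Definition _ (f : int -> L) :=
  GRing.isLinear.Build F L L *:%R (linext f) (linext_is_linear f).

Lemma linext_tpow (f : int -> L) j : linext f (tpow F j) = f j.
Proof.
rewrite (linextEw _ msuppU_le) big_seq_fset1 mcoeff_tpow eqxx scale1r //.
Qed.

Lemma linear_eq_tpow (g h : {linear L -> L}) :
  (forall j, g (tpow F j) = h (tpow F j)) -> g =1 h.
Proof.
move=> H x; rewrite (laurent_sum x) !linear_sum; apply: eq_bigr => j _.
by rewrite !linearZ /= H.
Qed.

Lemma eq_linear_tpow (f1 f2 : L -> L) : linear f1 -> linear f2 ->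
  (forall j, f1 (tpow F j) = f2 (tpow F j)) -> f1 =1 f2.
Proof.
move=> l1 l2 H; pose h1 := GRing.isLinear.Build _ _ _ _ f1 l1.
pose h2 := GRing.isLinear.Build _ _ _ _ f2 l2.
pose g1 : {linear L -> L} := HB.pack f1 h1; pose g2 : {linear L -> L} := HB.pack f2 h2.
exact: (@linear_eq_tpow g1 g2).
Qed.

HB.instance Definition _ m := GRing.Linear.copy (@tmul F m) (linext (fun j => tpow F (j + m))).

Lemma tmul_tpow m j : tmul m (tpow F j) = tpow F (j + m).
Proof. exact: linext_tpow. Qed.

Lemma mcoeff_tmul m l x : mcoeff l (tmul m x) = mcoeff (l - m) x.
Proof.
have -> : mcoeff (l - m) x = \sum_(j <- msupp x) mcoeff (l - m) (mcoeff j x *: tpow F j).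
  by rewrite {1}(laurent_sum x) [LHS]mcoeff_sum.
rewrite {1}(laurent_sum x) linear_sum [LHS]mcoeff_sum.
apply: eq_bigr => j _; rewrite linearZ /= !mcoeffZ tmul_tpow !mcoeff_tpow.
by rewrite eq_sym -subr_eq eq_sym.
Qed.

Lemma tmul_tmul a b x : tmul a (tmul b x) = tmul (a + b) x.
Proof.
by apply: laurentP => l; rewrite !mcoeff_tmul; congr mcoeff; rewrite opprD addrA.
Qed.

Lemma tmul0 x : tmul 0 x = x.
Proof. by apply: laurentP => l; rewrite mcoeff_tmul subr0. Qed.

Lemma subspace_sum (V : set L) (I : Type) (r : seq I) (P : pred I) (f : I -> L) :
  subspace V -> (forall i, P i -> V (f i)) -> V (\sum_(i <- r | P i) f i).
Proof.
move=> [V0 VD] H; apply: (big_ind V) => // x y Vx Vy.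
by rewrite -[x]scale1r; apply: VD.
Qed.

Lemma subspaceZ (V : set L) a x : subspace V -> V x -> V (a *: x).
Proof. by move=> [V0 VD] Vx; rewrite -[_ *: _]addr0; apply: VD. Qed.

Lemma subspaceD (V : set L) x y : subspace V -> V x -> V y -> V (x + y).
Proof. by move=> [V0 VD] Vx Vy; rewrite -[x]scale1r; apply: VD. Qed.

Lemma subspaceB (V : set L) x y : subspace V -> V x -> V y -> V (x - y).
Proof.
by move=> sV Vx Vy; rewrite -scaleN1r addrC; apply: sV.2.
Qed.

Lemma lspan_tpowP (S : set int) x :
  lspan [set tpow F j | j in S] x <-> forall l, mcoeff l x != 0 -> S l.
Proof.
split.
  move=> /(_ [set y | forall l, mcoeff l y != 0 -> S l]); apply; split; last by move=> _ [j Sj <-] l; rewrite mcoeff_tpow; case: (eqVneq j l) => [<-|_] //; rewrite eqxx.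
  split=> [l|a u v Su Sv l]; first by rewrite mcoeff0 eqxx.
  rewrite mcoeffD mcoeffZ; have [->|/Su//] := eqVneq (mcoeff l u) 0.
  by rewrite mulr0 add0r; apply: Sv.
move=> H A [sA SA]; rewrite (laurent_sum x) big_seq.
apply: subspace_sum => // j; rewrite -mcoeff_neq0 => /H Sj.
by apply: subspaceZ => //; apply: SA; exists j.
Qed.

Lemma lspan_subspace (S : set L) : subspace (lspan S).
Proof.
split=> [A [[]]//|a u v Su Sv A [sA SA]].
by apply: sA.2; [apply: Su | apply: Sv].
Qed.

Lemma tspan_subspace m : subspace (@tspan F m).
Proof. exact: lspan_subspace. Qed.

Lemma tspanP m x : @tspan F m x <-> forall l, m < l -> mcoeff l x = 0.
Proof.
rewrite /tspan lspan_tpowP; split=> H l.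
  move=> ml; apply/eqP; apply: contraTT ml => /H /=.
  by rewrite leNgt.
by move=> xl /=; rewrite leNgt; apply: contraNN xl => /H ->.
Qed.

Lemma tspan_tpow m j : @tspan F m (tpow F j) <-> j <= m.
Proof.
split=> [/tspanP H|jm]; last first.
  apply/tspanP => l ml; rewrite mcoeff_tpow; case: eqP => // jl; lia.
rewrite leNgt; apply/negP => /H; rewrite mcoeff_tpow eqxx => /eqP.
by rewrite oner_eq0.
Qed.

Lemma tspan_le m m' x : m <= m' -> @tspan F m x -> @tspan F m' x.
Proof. by move=> mm /tspanP H; apply/tspanP => l ml; apply: H; lia. Qed.

Lemma tspanZ m a x : @tspan F m x -> @tspan F m (a *: x).
Proof. exact: subspaceZ (tspan_subspace m). Qed.

Lemma tspanD m x y : @tspan F m x -> @tspan F m y -> @tspan F m (x + y).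
Proof. exact: subspaceD (tspan_subspace m). Qed.

Lemma tspanB m x y : @tspan F m x -> @tspan F m y -> @tspan F m (x - y).
Proof. exact: subspaceB (tspan_subspace m). Qed.

Lemma tspan_sum m (I : Type) (r : seq I) (P : pred I) (f : I -> L) :
  (forall i, P i -> @tspan F m (f i)) -> @tspan F m (\sum_(i <- r | P i) f i).
Proof. exact: subspace_sum (tspan_subspace m). Qed.

Lemma tspan_tmul a m x : @tspan F m x -> @tspan F (m + a) (tmul a x).
Proof. by move=> /tspanP H; apply/tspanP => l ml; rewrite mcoeff_tmul H //; lia. Qed.

Lemma linear_tspan (g : {linear L -> L}) m m' x :
  (forall j, j <= m -> @tspan F m' (g (tpow F j))) -> @tspan F m x -> @tspan F m' (g x).
Proof.
move=> H /tspanP xm; rewrite (laurent_sum x) linear_sum big_seq.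
apply: tspan_sum.
move=> j; rewrite -mcoeff_neq0 => xj; rewrite linearZ /=.
apply: (@tspanZ m' _ _ (H j _)); rewrite leNgt; apply: contraNN xj => /xm ->; exact: eqxx.
Qed.

Section ZMul.
Context (n : nat).

Lemma zmulEw (p : {poly F}) x (N : nat) : (size p <= N)%N ->
  zmul n p x = \sum_(d < N) p`_d *: tmul (- (n * d)%:Z) x.
Proof.
move=> sN; rewrite /zmul (big_ord_widen N (fun d => p`_d *: tmul (- (n * d)%:Z) x)) //.
rewrite big_mkcond /=; apply: eq_bigr => d _; case: ltnP => // pd.
by rewrite nth_default // scale0r.
Qed.

Lemma zmul_is_linear (p : {poly F}) : linear (zmul n p : L -> L).
Proof.
move=> a x y; rewrite /zmul scaler_sumr -big_split /=; apply: eq_bigr => d _.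
by rewrite linearP scalerDr !scalerA mulrC.
Qed.

HB.instance Definition _ (p : {poly F}) :=
  GRing.isLinear.Build F L L *:%R (zmul n p) (zmul_is_linear p).

Lemma zmulD (p q : {poly F}) x : zmul n (p + q) x = zmul n p x + zmul n q x.
Proof.
pose N := maxn (size p) (size q).
rewrite (@zmulEw p _ N) ?leq_maxl // (@zmulEw q _ N) ?leq_maxr //.
rewrite (@zmulEw (p + q) _ N) ?size_polyD // -big_split /=.
by apply: eq_bigr => d _; rewrite coefD scalerDl.
Qed.

Lemma zmul0 x : zmul n 0 x = 0.
Proof. by rewrite /zmul size_poly0 big_ord0. Qed.

Lemma zmul_sum (I : Type) (r : seq I) (P : pred I) (f : I -> {poly F}) x :
  zmul n (\sum_(i <- r | P i) f i) x = \sum_(i <- r | P i) zmul n (f i) x.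
Proof.
exact: (big_morph (fun p => zmul n p x) (fun p q => zmulD p q x) (zmul0 x)).
Qed.

Lemma zmulC c x : zmul n c%:P x = c *: x.
Proof.
rewrite (@zmulEw _ _ 1) ?size_polyC ?leq_b1 // big_ord1 coefC eqxx muln0.
by rewrite oppr0 tmul0.
Qed.

Lemma zmulMX (p : {poly F}) x : zmul n (p * 'X) x = tmul (- n%:Z) (zmul n p x).
Proof.
rewrite (@zmulEw _ _ (size p).+1); last first.
  by apply: leq_trans (size_polyMleq _ _) _; rewrite size_polyX addn2.
rewrite big_ord_recl coefMX /= scale0r add0r linear_sum; apply: eq_bigr => d _.
rewrite linearZ /= coefMX /= tmul_tmul; congr (_ *: tmul _ _).
by rewrite mulnS; lia.
Qed.

Lemma zmulCM c (p : {poly F}) x : zmul n (c%:P * p) x = c *: zmul n p x.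
Proof.
rewrite (@zmulEw _ _ (size p)) ?mul_polyC ?size_scale_leq //.
by rewrite scaler_sumr; apply: eq_bigr => d _; rewrite coefZ scalerA.
Qed.

(** The substitution of t^-n for the variable is a morphism; by induction on p,
    it is enough to compare the action of the variable with [zmulMX]. *)
Lemma zmulM (p q : {poly F}) x : zmul n (p * q) x = zmul n p (zmul n q x).
Proof.
elim/poly_ind: p => [|p c IH] in x *; first by rewrite mul0r !zmul0.
by rewrite mulrDl mulrAC zmulD !zmulMX IH zmulD zmulMX zmulCM zmulC.
Qed.

End ZMul.
End Laurent.

(** * The action of matrices over F[z] *)

Section GlAct.
Context (F : fieldType) (n k w : nat).
Local Notation L := (laurent F).
Local Notation be := (@basis_exp n k w).
Implicit Types (x y : L) (g h : 'M[{poly F}]_n) (p q : {poly F}).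

(** The image of the s-th basis vector under g. *)
Definition gl_col g (s : 'I_n) : L := \sum_(r < n) zmul n (g r s) (tpow F (be r)).

HB.instance Definition _ g := GRing.Linear.copy (gl_act k w g : L -> L)
  (linext (fun j =>
    \sum_(s < n | (n%:Z %| j - basis_exp k w s)%Z)
      tmul (j - basis_exp k w s)
        (\sum_(r < n) zmul n (g r s) (tpow F (basis_exp k w r))))).

Lemma gl_act_tpow g s (m : int) :
  gl_act k w g (tpow F (be s + n%:Z * m)) = tmul (n%:Z * m) (gl_col g s).
Proof.
rewrite /gl_act linext_tpow (bigD1 s) /=; last by rewrite addrAC subrr add0r dvdz_mulr.
rewrite addrAC subrr add0r [X in _ + X]big1 ?addr0 // => s' /andP[dv /eqP ss].
exfalso; apply: ss; apply: val_inj; move: dv; rewrite /basis_exp.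
have -> : (n%:Z - k%:Z) * w%:Z - s%:Z + n%:Z * m - ((n%:Z - k%:Z) * w%:Z - s'%:Z) =
  (s'%:Z - s%:Z) + n%:Z * m by ring.
move=> /dvdzP [q E] /=.
have Ee : s'%:Z - s%:Z = (q - m) * n%:Z by rewrite mulrBl -E; ring.
have := ltn_ord s; have := ltn_ord s'; move: (q - m) Ee => e Ee ls' ls.
have : e = 0 \/ (1 <= e) \/ (e <= -1) by lia.
by case=> [e0|[e0|e0]]; nia.
Qed.

Lemma gl_act_basis g s : gl_act k w g (tpow F (be s)) = gl_col g s.
Proof. by have := gl_act_tpow g s 0; rewrite mulr0 addr0 tmul0. Qed.

Lemma tmul_zmul p (m : int) x : tmul m (zmul n p x) = zmul n p (tmul m x).
Proof.
rewrite /zmul linear_sum; apply: eq_bigr => d _; rewrite linearZ /=.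
by rewrite !tmul_tmul addrC.
Qed.

Lemma zmulXn (N : nat) x : zmul n 'X^N x = tmul (- (n * N)%:Z) x.
Proof.
elim: N => [|N IH]; first by rewrite expr0 -polyC1 zmulC scale1r muln0 oppr0 tmul0.
by rewrite exprSr zmulMX IH tmul_tmul mulnS; congr tmul; lia.
Qed.

Context (n_gt0 : (0 < n)%N).

Lemma exp_decomp (j : int) : exists s : 'I_n, exists m : int, j = be s + n%:Z * m.
Proof.
pose c : int := (n%:Z - k%:Z) * w%:Z - j.
have n0 : n%:Z != 0 :> int by lia.
have := divz_eq c n%:Z; have := modz_ge0 c n0; have := ltz_pmod c (_ : 0 < n%:Z).
case: (c %% n%:Z)%Z => [s|//] ltn _ E.
have sn : (s < n)%N by have := ltn n_gt0; lia.
exists (Ordinal sn), (- (c %/ n%:Z)%Z); rewrite /basis_exp /=.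
rewrite /c in E *; lia.
Qed.

Lemma gl_act_tmul g (m : int) x :
  gl_act k w g (tmul (n%:Z * m) x) = tmul (n%:Z * m) (gl_act k w g x).
Proof.
move: x; apply: eq_linear_tpow; [by move=> a u v; rewrite !linearP | by move=> a u v; rewrite !linearP |] => j /=.
have [s [m' ->]] := exp_decomp j.
rewrite tmul_tpow -addrA -mulrDr !gl_act_tpow tmul_tmul; congr tmul; ring.
Qed.

Lemma gl_act_zmul g p x : gl_act k w g (zmul n p x) = zmul n p (gl_act k w g x).
Proof.
rewrite /zmul linear_sum; apply: eq_bigr => d _; rewrite linearZ /=.
have -> : - (n * d)%N%:Z = n%:Z * - d%:Z by lia.
by rewrite gl_act_tmul.
Qed.

Lemma gl_actM g h x : gl_act k w (g *m h) x = gl_act k w g (gl_act k w h x).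
Proof.
move: x; apply: eq_linear_tpow; [by move=> a u v; rewrite !linearP | by move=> a u v; rewrite !linearP |] => j /=.
have [s [m ->]] := exp_decomp j.
rewrite !gl_act_tpow gl_act_tmul; congr tmul.
rewrite [in RHS]/gl_col linear_sum /=.
under [RHS]eq_bigr => r _.
  rewrite gl_act_zmul gl_act_basis /gl_col linear_sum /=.
  over.
rewrite exchange_big /=; apply: eq_bigr => r _.
rewrite mxE zmul_sum; apply: eq_bigr => i _.
by rewrite mulrC zmulM.
Qed.

Lemma gl_act1 x : gl_act k w (1%:M : 'M[{poly F}]_n) x = x.
Proof.
move: x; apply: eq_linear_tpow; [by move=> a u v; rewrite !linearP | by [] |] => j /=.
have [s [m ->]] := exp_decomp j.
rewrite gl_act_tpow /gl_col (bigD1 s) //= big1 ?addr0 => [|r rs].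
  by rewrite mxE eqxx -polyC1 zmulC scale1r tmul_tpow.
by rewrite mxE (negPf rs) zmul0.
Qed.

Lemma gl_actD g h x : gl_act k w (g + h) x = gl_act k w g x + gl_act k w h x.
Proof.
move: x; apply: eq_linear_tpow; [by move=> a u v; rewrite !linearP | by move=> a u v; rewrite !linearP scalerDr addrACA |] => j /=.
have [s [m ->]] := exp_decomp j.
rewrite !gl_act_tpow.
transitivity (tmul (n%:Z * m) (gl_col g s + gl_col h s)); last by rewrite linearD.
congr (tmul _ _); rewrite /gl_col -big_split /=.
by apply: eq_bigr => r _; rewrite mxE zmulD.
Qed.

Lemma gl_actZ p g x : gl_act k w (p *: g) x = gl_act k w g (zmul n p x).
Proof.
rewrite gl_act_zmul.
move: x; apply: eq_linear_tpow; [by move=> a u v; rewrite !linearP | by move=> a u v; rewrite !linearP |] => j /=.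
have [s [m ->]] := exp_decomp j.
rewrite !gl_act_tpow -tmul_zmul; congr tmul; rewrite /gl_col [RHS]linear_sum /=.
by apply: eq_bigr => r _; rewrite mxE zmulM.
Qed.

(** For an arbitrary matrix over F[z] the exponents of a basis vector can rise by less
    than n, the range of the exponents of the basis. *)
Lemma gl_act_tspan_weak g (m : int) x :
  tspan m x -> tspan (m + n%:Z) (gl_act k w g x).
Proof.
apply: (linear_tspan (g := gl_act k w g)) => j jm /=.
have [s [m' jE]] := exp_decomp j.
rewrite jE gl_act_tpow; apply: (@tspan_le _ (be s + n%:Z + n%:Z * m')); first by lia.
apply: tspan_tmul; apply: tspan_sum => r _.
rewrite /zmul; apply: tspan_sum => d _; apply: tspanZ.
rewrite tmul_tpow; apply/tspan_tpow; rewrite /basis_exp.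
by have := ltn_ord s; lia.
Qed.

Definition trig_at0 g := is_trig_mx (map_mx (fun p : {poly F} => p.[0]) g).

(** Raising the exponent of a basis vector needs an entry above the diagonal with a
    nonzero constant term. *)
Lemma gl_act_tspan g (m : int) x : trig_at0 g ->
  tspan m x -> tspan m (gl_act k w g x).
Proof.
move=> tg; apply: (linear_tspan (g := gl_act k w g)) => j jm /=.
have [s [m' jE]] := exp_decomp j.
rewrite jE gl_act_tpow; apply: (@tspan_le _ (be s + n%:Z * m')); first by lia.
apply: tspan_tmul; apply: tspan_sum => r _.
rewrite /zmul; apply: tspan_sum => -[d /= _] _.
rewrite tmul_tpow; have [rs|] := boolP ((r < s)%N && (d == 0%N)).
  case/andP: rs => rs /eqP ->.
  have /is_trig_mxP/(_ r s rs) := tg; rewrite mxE horner_coef0 => ->.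
  by rewrite scale0r; apply: (tspan_subspace _ _).1.
move=> rs; apply: tspanZ; apply/tspan_tpow; rewrite /basis_exp.
have := ltn_ord s; have := ltn_ord r.
move: ((n%:Z - k%:Z) * w%:Z) => c ln rn.
case: d rs => [|d]; last by rewrite mulnS; lia.
by rewrite eqxx andbT -leqNgt; lia.
Qed.

Lemma trig_at0M g h : trig_at0 g -> trig_at0 h -> trig_at0 (g *m h).
Proof.
rewrite /trig_at0 => /is_trig_mxP tg /is_trig_mxP th; apply/is_trig_mxP => i j ij.
rewrite !mxE horner_sum big1 // => l _; rewrite hornerM.
have [il|li] := ltnP i l.
  by have := tg i l il; rewrite mxE => ->; rewrite mul0r.
by have := th l j (leq_ltn_trans li ij); rewrite mxE => ->; rewrite mulr0.
Qed.

End GlAct.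

(** * From the Iwahori group to automorphisms of the quiver representation *)

Lemma Zn_int_repr (n : nat) (i : int) : (1 < n)%N ->
  exists q : int, i = (val (i%:~R : 'Z_n))%:Z + n%:Z * q.
Proof.
move=> n1; exists (i %/ n%:Z)%Z.
have -> : (i%:~R : 'Z_n) = (i %% n%:Z)%Z%:~R.
  rewrite {1}(divz_eq i n%:Z) intrD intrM.
  have -> : ((n%:Z)%:~R : 'Z_n) = 0 by exact: (pchar_Zp n1).
  by rewrite mulr0 add0r.
rewrite {1}(divz_eq i n%:Z) addrC mulrC; congr (_ + _).
have n0 : n%:Z != 0 :> int by lia.
have := modz_ge0 i n0; have := ltz_pmod i (_ : 0 < n%:Z).
case: (i %% n%:Z)%Z => [r|//] ltn _.
have rn : (r < n)%N by have := ltn (ltnW n1); lia.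
by rewrite -[Posz r]/(r%:Z) -pmulrn /= (val_Zp_nat n1) modn_small.
Qed.

Lemma Zn_intrDn (n : nat) (i : int) : (1 < n)%N -> ((i + n%:Z)%:~R : 'Z_n) = i%:~R.
Proof. by move=> n1; rewrite intrD -pmulrn (pchar_Zp n1) addr0. Qed.

(** In a row of T' look at the last nonzero entry right of the diagonal: multiplying
    by T keeps it nonzero, up to a diagonal entry of T. *)
Lemma trig_inv (K : fieldType) (m : nat) (T T' : 'M[K]_m) :
  is_trig_mx T -> T' *m T = 1%:M -> is_trig_mx T'.
Proof.
move=> /is_trig_mxP tT TT.
have dT j : T j j != 0.
  have : \det T != 0.
    apply/eqP => d0; have := congr1 determinant TT.
    by rewrite det_mulmx d0 mulr0 det1 => /esym/eqP; rewrite oner_eq0.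
  rewrite det_trig; last exact/is_trig_mxP.
  by move/prodf_neq0; apply.
apply/is_trig_mxP => i j; have [r] := ubnP (m - j).
elim: r j => // r IH j rj ij.
have := congr1 (fun M : 'M_m => M i j) TT; rewrite !mxE.
have -> : (i == j) = false by apply/negbTE; rewrite neq_ltn ij.
rewrite (bigD1 j) //= big1 ?addr0.
  by move/eqP; rewrite mulf_eq0 (negPf (dT j)) orbF => /eqP.
move=> l lj; have [ll|ll] := ltnP l j; first by rewrite tT ?mulr0.
have jl : (j < l)%N by rewrite ltn_neqAle eq_sym lj.
by rewrite IH ?mul0r //; [have := ltn_ord l; lia | exact: ltn_trans jl].
Qed.

Section Truncation.
Context (F : fieldType) (n k w : nat).
Local Notation L := (laurent F).
Local Notation V := 'rV[F]_(n * w).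
Local Notation top i := (i - (k * w)%:Z + (n * w)%:Z).
Local Notation bot i := (i - (k * w)%:Z).
Implicit Types (x y : L) (u v : V) (i : int).

(** The left inverse of psi^(i), defined on all Laurent polynomials. *)
Definition trunc i x : V :=
  \row_a mcoeff (i - (k * w)%:Z + ((n * w)%:Z - a%:Z)) x.

Lemma trunc_is_linear i : linear (trunc i).
Proof. by move=> a x y; apply/rowP => c; rewrite !mxE mcoeffD mcoeffZ. Qed.

HB.instance Definition _ i := GRing.isLinear.Build F L V *:%R (trunc i) (trunc_is_linear i).

Lemma psi_is_linear i : linear (@psi F n k w i).
Proof.
move=> a u v; rewrite /psi scaler_sumr -big_split; apply: eq_bigr => c _ /=.
by rewrite !mxE scalerDl scalerA.
Qed.

HB.instance Definition _ i :=
  GRing.isLinear.Build F V L *:%R (@psi F n k w i) (psi_is_linear i).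

Lemma psiK i : cancel (@psi F n k w i) (trunc i).
Proof.
move=> u; apply/rowP => a; rewrite mxE /psi [LHS]mcoeff_sum (bigD1 a) //=.
rewrite mcoeffZ mcoeff_tpow eqxx mulr1 big1 ?addr0 // => c ca.
rewrite mcoeffZ mcoeff_tpow; case: eqP => [E|]; last by rewrite mulr0.
by case/eqP: ca; apply: val_inj => /=; lia.
Qed.

Lemma psi_top i u : tspan (top i) (psi k i u).
Proof.
rewrite /psi; apply: tspan_sum => a _; apply: tspanZ; apply/tspan_tpow.
by lia.
Qed.

Lemma trunc_eq0 i x : tspan (bot i) x -> trunc i x = 0.
Proof. by move=> /tspanP H; apply/rowP => a; rewrite !mxE H //; have := ltn_ord a; lia. Qed.

Lemma trunc_eq0_bot i x : tspan (top i) x -> trunc i x = 0 -> tspan (bot i) x.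
Proof.
move=> /tspanP xt x0; apply/tspanP => l bl.
have [tl|lt] := ltP (top i) l; first exact: xt.
have lo : (`|(top i - l)%R| < n * w)%N by lia.
have := congr1 (fun r : V => r 0 (Ordinal lo)) x0; rewrite !mxE /= => <-.
by congr mcoeff; lia.
Qed.

Lemma trunc_decomp i x : tspan (top i) x -> tspan (bot i) (x - psi k i (trunc i x)).
Proof.
move=> xt; apply: trunc_eq0_bot; first by apply: tspanB => //; apply: psi_top.
by rewrite linearB /= psiK subrr.
Qed.

(** All later work with Psi uses this description, in which the sum of two spaces has
    disappeared. *)
Lemma PsiP (U : 'Z_n -> {vspace V}) i x :
  Psi F n k w U i x <-> tspan (top i) x /\ trunc i x \in U i%:~R.
Proof.
split.
  case=> _ [u uU <-] [y yb <-]; split.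
    apply: tspanD; first exact: psi_top.
    by apply: tspan_le yb; lia.
  by rewrite linearD /= psiK (trunc_eq0 yb) addr0.
case=> xt xU; exists (psi k i (trunc i x)); first by exists (trunc i x).
exists (x - psi k i (trunc i x)); last by rewrite addrC subrK.
exact: trunc_decomp.
Qed.

Lemma arrow_succ u (a b : 'I_(n * w)) : b = a.+1 :> nat -> arrow F n w u 0 b = u 0 a.
Proof.
move=> E; rewrite /arrow lfunE /= mxE (bigD1 a) //= mxE E eqxx mulr1.
rewrite big1 ?addr0 // => c ca; rewrite mxE E; case: eqP => [[/val_inj cE]|].
  by rewrite cE eqxx in ca.
by rewrite mulr0.
Qed.

Lemma arrow_0 u (b : 'I_(n * w)) : b = 0%N :> nat -> arrow F n w u 0 b = 0.
Proof.
move=> E; rewrite /arrow lfunE /= mxE big1 // => c _.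
by rewrite mxE E mulr0.
Qed.

Lemma arrow_trunc i x : tspan (top i) x -> arrow F n w (trunc i x) = trunc (i + 1) x.
Proof.
move=> /tspanP xt; apply/rowP => b; rewrite [RHS]mxE.
case: (posnP b) => [b0|b0]; first by rewrite arrow_0 // xt //; lia.
have ltb : (b.-1 < n * w)%N by rewrite prednK // ltnW.
rewrite (@arrow_succ _ (Ordinal ltb)) ?prednK // mxE; congr mcoeff => /=; lia.
Qed.

Lemma psi_arrow i u : tspan (bot (i + 1)) (psi k i u - psi k (i + 1) (arrow F n w u)).
Proof.
have xt : tspan (top i) (psi k i u) by exact: psi_top.
rewrite -{2}[u](psiK i) arrow_trunc //; apply: trunc_decomp.
by apply: tspan_le xt; lia.
Qed.

Lemma psi_shift i (q : int) u : psi k (i + n%:Z * q) u = tmul (n%:Z * q) (psi k i u).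
Proof.
rewrite /psi linear_sum; apply: eq_bigr => a _.
rewrite linearZ /= tmul_tpow; congr (_ *: tpow _ _); lia.
Qed.

Lemma trunc_shift i x : trunc (i + n%:Z) (tmul n%:Z x) = trunc i x.
Proof. by apply/rowP => a; rewrite !mxE mcoeff_tmul; congr mcoeff; lia. Qed.

Context (n_gt1 : (1 < n)%N).

Let n_gt0 : (0 < n)%N := ltnW n_gt1.

(** The endomorphism induced by G on t^(i-kw+nw) F[t^-1] / t^(i-kw) F[t^-1]. *)
Definition gl_aut_int (G : 'M[{poly F}]_n) i : 'End(V) :=
  locked (linfun (trunc i \o gl_act k w G \o @psi F n k w i)).

Definition gl_aut (G : 'M[{poly F}]_n) (i : 'Z_n) : 'End(V) := gl_aut_int G (i : nat)%:Z.

Lemma gl_aut_int_app G i u :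
  gl_aut_int G i u = trunc i (gl_act k w G (psi k i u)).
Proof. by rewrite /gl_aut_int -lock lfunE. Qed.

Lemma gl_aut_app G (i : 'Z_n) u :
  gl_aut G i u = trunc (i : nat)%:Z (gl_act k w G (psi k (i : nat)%:Z u)).
Proof. exact: gl_aut_int_app. Qed.

(** G commutes with multiplication by t^n, so the induced endomorphism depends only on
    the class of i. *)
Lemma gl_aut_intE G i : gl_aut_int G i = gl_aut G i%:~R.
Proof.
have S j : gl_aut_int G (j + n%:Z) = gl_aut_int G j.
  apply/lfunP => u.
  rewrite [LHS]gl_aut_int_app.
  rewrite [RHS]gl_aut_int_app.
  have Ep := psi_shift j 1 u; rewrite mulr1 in Ep; rewrite Ep.
  have Eg := gl_act_tmul k w n_gt0 G 1 (psi k j u); rewrite mulr1 in Eg; rewrite Eg.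
  exact: trunc_shift.
have P (m : nat) j : gl_aut_int G (j + n%:Z * m%:Z) = gl_aut_int G j.
  elim: m => [|m IH]; first by rewrite mulr0 addr0.
  have E : j + n%:Z * m.+1%:Z = j + n%:Z * m%:Z + n%:Z by lia.
  rewrite E.
  rewrite [LHS]S.
  exact: IH.
have [q E] := Zn_int_repr i n_gt1; rewrite [in LHS]E /gl_aut.
case: q E => q E; first exact: P.
rewrite -[LHS](P q.+1); congr gl_aut_int.
by rewrite NegzE mulrN subrK.
Qed.

Lemma trunc_gl_act G i x : trig_at0 G -> tspan (top i) x ->
  trunc i (gl_act k w G x) = gl_aut G i%:~R (trunc i x).
Proof.
move=> tG xt; rewrite -gl_aut_intE gl_aut_int_app.
apply/eqP; rewrite -subr_eq0 -linearB -linearB /=; apply/eqP/trunc_eq0.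
apply: gl_act_tspan => //; exact: trunc_decomp.
Qed.

Lemma gl_aut_arrow G (i : 'Z_n) : trig_at0 G ->
  (arrow F n w \o gl_aut G i = gl_aut G (i + 1)%R \o arrow F n w)%VF.
Proof.
move=> tG; apply/lfunP => u; rewrite !comp_lfunE.
have -> : gl_aut G (i + 1) = gl_aut_int G ((i : nat)%:Z + 1).
  by rewrite [RHS]gl_aut_intE intrD -pmulrn natr_Zp.
rewrite [RHS]gl_aut_int_app.
rewrite [X in fun_of_lfun _ X = _]gl_aut_app.
rewrite arrow_trunc; last first.
  apply: gl_act_tspan => //; exact: psi_top.
apply/eqP; rewrite -subr_eq0 -linearB -linearB /=; apply/eqP/trunc_eq0.
apply: gl_act_tspan => //; exact: psi_arrow.
Qed.

Lemma gl_autM G H (i : 'Z_n) u : trig_at0 G -> trig_at0 H ->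
  gl_aut (G *m H) i u = gl_aut G i (gl_aut H i u).
Proof.
move=> tG tH; have E : ((i : nat)%:Z)%:~R = i by rewrite -pmulrn natr_Zp.
rewrite [LHS]gl_aut_app (gl_actM k w n_gt0) trunc_gl_act //; last first.
  by apply: gl_act_tspan => //; exact: psi_top.
by rewrite E; congr (fun_of_lfun _ _); rewrite [RHS]gl_aut_app.
Qed.

Lemma gl_aut1 (i : 'Z_n) u : gl_aut 1%:M i u = u.
Proof. by rewrite [LHS]gl_aut_app gl_act1 // psiK. Qed.

Lemma iwahori_inv (g : 'M[{poly F}]_n) : iwahori F n g -> trig_at0 (invmx g).
Proof.
case=> ug tg; apply: trig_inv tg _.
rewrite -(map_mxM (horner_eval 0)) mulVmx //.
exact: (map_mx1 (horner_eval (0 : F))).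
Qed.

Lemma gl_aut_is_aut g : iwahori F n g -> is_aut (gl_aut g).
Proof.
move=> ig i; have [ug tg] := ig; split; last exact: gl_aut_arrow.
apply/eqP/lker0P => u v E.
have K (z : V) : gl_aut (invmx g) i (gl_aut g i z) = z.
  by rewrite -[LHS]gl_autM ?mulVmx ?gl_aut1 //; exact: iwahori_inv.
exact: etrans (esym (K u)) (etrans (congr1 (gl_aut (invmx g) i) E) (K v)).
Qed.

(** The inverse of g gives the inverse automorphism, which is what shows that every
    element of the left-hand side comes from Psi U. *)
Lemma Psi_gl_aut g (U : 'Z_n -> {vspace V}) : iwahori F n g ->
  Psi F n k w (aut_act (gl_aut g) U) = flag_act k w g (Psi F n k w U).
Proof.
move=> ig; have [ug tg] := ig; have tg' := iwahori_inv ig.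
apply: boolp.funext => i; apply/seteqP; split => x.
  case/PsiP => xt /memv_imgP[u uU xu].
  exists (gl_act k w (invmx g) x); last by rewrite -gl_actM // mulmxV // gl_act1.
  apply/PsiP; split; first exact: gl_act_tspan.
  rewrite trunc_gl_act // xu -[X in X \in _]gl_autM // mulVmx //.
  by rewrite [X in X \in _]gl_aut1.
case=> y /PsiP [yt yU] <-; apply/PsiP; split; first exact: gl_act_tspan.
by rewrite trunc_gl_act //; apply: memv_img.
Qed.

End Truncation.

(** * Lifting matrices over truncated polynomials to invertible ones *)

Section Lifting.
Context (F : numFieldType) (n : nat) (n_gt0 : (0 < n)%N).
Implicit Types (C N : 'M[F]_n).

(** For these C the matrix 1 + z^m C can be approximated modulo z^(m+1) by a scalar
    polynomial times an element of GL_n(F[z]); see [lift_unit]. *)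
Definition nilsum C := exists c : F, exists s : seq 'M[F]_n,
  (forall N, N \in s -> N *m N = 0) /\ C = c%:M + \sum_(N <- s) N.

Lemma nilsumD C C' : nilsum C -> nilsum C' -> nilsum (C + C').
Proof.
move=> [c [s [Hs ->]]] [c' [s' [Hs' ->]]]; exists (c + c'), (s ++ s'); split.
  by move=> N; rewrite mem_cat => /orP[/Hs|/Hs'].
by rewrite big_cat raddfD /= addrACA.
Qed.

Lemma nilsum_scalar c : nilsum c%:M.
Proof. by exists c, [::]; split=> //; rewrite big_nil addr0. Qed.

Lemma nilsum_rank1 (u : 'cV[F]_n) (v : 'rV[F]_n) : v *m u = 0 -> nilsum (u *m v).
Proof.
move=> vu; exists 0, [:: u *m v]; split; last by rewrite big_seq1 raddf0 add0r.
by move=> N; rewrite inE => /eqP ->; rewrite -mulmxA (mulmxA v) vu mul0mx mulmx0.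
Qed.

Lemma nilsum_delta a (i j : 'I_n) : i != j -> nilsum (a *: delta_mx i j).
Proof.
move=> ij; rewrite -(mul_delta_mx (0 : 'I_1)) scalemxAl.
by apply: nilsum_rank1; rewrite -scalemxAr mul_delta_mx_0 ?scaler0 // eq_sym.
Qed.

(** The column e_i - e_j times the row e_i + e_j has square zero, and its entries off
    the diagonal are removed by [nilsum_delta]. *)
Lemma nilsum_diag a (i j : 'I_n) : nilsum (a *: (delta_mx i i - delta_mx j j)).
Proof.
have [->|ij] := eqVneq i j.
  by rewrite subrr scaler0 -(raddf0 (@scalar_mx F n)); apply: nilsum_scalar.
pose u : 'cV[F]_n := a *: (delta_mx i 0 - delta_mx j 0).
pose v : 'rV[F]_n := delta_mx 0 i + delta_mx 0 j.
have -> : a *: (delta_mx i i - delta_mx j j) =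
    u *m v + (- a *: delta_mx i j + a *: delta_mx j i).
  rewrite /u /v -scalemxAl mulmxDr !mulmxBl !mul_delta_mx.
  by apply/matrixP => x y; rewrite !mxE; ring.
apply: nilsumD; last by apply: nilsumD; apply: nilsum_delta => //; rewrite eq_sym.
apply: nilsum_rank1; rewrite /u /v -scalemxAr mulmxDl !mulmxBr !mul_delta_mx.
by rewrite !mul_delta_mx_0 // 1?eq_sym // subr0 sub0r subrr scaler0.
Qed.

(** Subtracting the mean of the diagonal, for which n must be invertible in F, leaves a
    matrix of trace zero; this is spanned by the matrices treated above. *)
Lemma nilsum_all C : nilsum C.
Proof.
have ns0 : nilsum 0 by rewrite -(raddf0 (@scalar_mx F n)); apply: nilsum_scalar.
rewrite [C]matrix_sum_delta.
apply: (big_ind nilsum) => [||i _] //; first exact: nilsumD.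
apply: (big_ind nilsum) => [||j _] //; first exact: nilsumD.
have [->|ij] := eqVneq i j; last exact: nilsum_delta.
move: (C j j) => a.
have n0 : n%:R != 0 :> F by rewrite pnatr_eq0 -lt0n.
have -> : a *: delta_mx j j =
    (a / n%:R)%:M + \sum_(l < n) (a / n%:R) *: (delta_mx j j - delta_mx l l) :> 'M[F]_n.
  rewrite -scaler_sumr sumrB sumr_const card_ord -scalemx1 -scalerDr.
  rewrite -mx1_sum_delta addrC subrK -scaler_nat scalerA mulfVK //.
apply: nilsumD; first exact: nilsum_scalar.
apply: (big_ind nilsum) => [||l _] //; [exact: nilsumD | exact: nilsum_diag].
Qed.

Local Notation pc M := (map_mx (@polyC F) M).
Local Notation ev0 G := (map_mx (fun p : {poly F} => p.[0]) G).

Lemma ev0M (G H : 'M[{poly F}]_n) : ev0 (G *m H) = ev0 G *m ev0 H.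
Proof. exact: (map_mxM (horner_eval (0 : F))). Qed.

Lemma ev0_pc C : ev0 (pc C) = C.
Proof. by apply/matrixP => i j; rewrite !mxE hornerC. Qed.

Lemma ev0_eq0 (G : 'M[{poly F}]_n) : ev0 G = 0 -> exists H, G = 'X *: H.
Proof.
move=> G0; have /choice [q Hq] : forall p : {poly F}, exists q, p.[0] = 0 -> p = q * 'X.
  move=> p; have [p0|p0] := eqVneq p.[0] 0; last by exists 0 => /eqP; rewrite (negPf p0).
  have /factor_theorem [q ->] : root p 0 by apply/rootP.
  by exists q; rewrite subr0.
exists (map_mx q G); apply/matrixP => i j; rewrite !mxE mulrC -Hq //.
by have := congr1 (fun M : 'M[F]_n => M i j) G0; rewrite !mxE.
Qed.

(** To first order in e the product of the matrices 1 + e N is 1 + e times the sum of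
    the N, and each factor has the inverse 1 - e N. *)
Lemma nilprod (e : {poly F}) (s : seq 'M[F]_n) :
  (forall N, N \in s -> N *m N = 0) ->
  exists g K : 'M[{poly F}]_n, g \in unitmx /\
    g = 1%:M + e *: pc (\sum_(N <- s) N) + (e * e) *: K.
Proof.
elim: s => [|N s IH] Hs.
  exists 1%:M, 0; rewrite unitmx1 big_nil; split=> //.
  by rewrite (map_mx0 (@polyC F)) !scaler0 !addr0.
have [|g [K [ug Eg]]] := IH; first by move=> M Ms; apply: Hs; rewrite inE Ms orbT.
have NN : N *m N = 0 by apply: Hs; rewrite inE eqxx.
pose P : 'M[{poly F}]_n := 1%:M + e *: pc N.
have uP : P \in unitmx.
  have : P *m (1%:M - e *: pc N) = 1%:M.
    rewrite /P mulmxDl mul1mx mulmxBr mulmx1 -scalemxAl -scalemxAr -map_mxM NN.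
    by rewrite (map_mx0 (@polyC F)) !scaler0 subr0 subrK.
  by case/mulmx1_unit.
exists (P *m g), (pc N *m pc (\sum_(M <- s) M) + K + e *: (pc N *m K)).
rewrite unitmx_mul uP ug; split=> //.
rewrite Eg /P big_cons map_mxD mulmxDl mul1mx mulmxDr mulmxDr mulmx1.
rewrite -!scalemxAl -!scalemxAr !scalerDr !scalerA -!addrA; congr (_ + _).
rewrite [RHS]addrCA; congr (_ + _).
rewrite addrCA; congr (_ + _).
rewrite [RHS]addrCA; congr (_ + _); congr (_ + _).
by rewrite mulrA.
Qed.

(** Induction on m.  The error term at z^(m+1), divided by the invertible matrix g(0),
    is a scalar plus a sum of square-zero matrices by [nilsum_all]; the scalar is put
    into s, and the square-zero matrices into g by [nilprod].  The scalar factor s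
    cannot be avoided, since the determinant of g is constant. *)
Lemma lift_unit (G : 'M[{poly F}]_n) (m : nat) : ev0 G \in unitmx ->
  exists g H : 'M[{poly F}]_n, exists s : {poly F},
    [/\ g \in unitmx, s.[0] = 1 & G = s *: g + 'X^(m.+1) *: H].
Proof.
move=> uG; elim: m => [|m [g [H [s [ug s0 EG]]]]].
  have [H EH] : exists H, G - pc (ev0 G) = 'X *: H.
    by apply: ev0_eq0; apply/matrixP => i j; rewrite !mxE hornerD hornerN hornerC subrr.
  exists (pc (ev0 G)), H, 1; rewrite map_unitmx hornerC scale1r expr1 -EH; split=> //.
  by rewrite addrC subrK.
have ug0 : ev0 g \in unitmx.
  have : ev0 g *m ev0 (invmx g) = 1%:M.
    by rewrite -ev0M mulmxV // (map_mx1 (horner_eval (0 : F))).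
  by case/mulmx1_unit.
(* g (1 + z^(m+1) C) agrees with g + z^(m+1) H to first order *)
pose C := invmx (ev0 g) *m ev0 H.
have [c [ns [Hns EC]]] := nilsum_all C.
pose e : {poly F} := 'X^(m.+1).
have [P [K [uP EP]]] := nilprod e Hns.
have [H' EH'] : exists H', H - s *: (g *m pc C) = 'X *: H'.
  have E : ev0 (g *m pc C) = ev0 H by rewrite ev0M ev0_pc mulKVmx.
  apply: ev0_eq0; move: (g *m pc C) E => M /matrixP E.
  apply/matrixP => i j; have := E i j; rewrite !mxE => EM.
  by rewrite hornerD hornerN hornerM s0 mul1r EM subrr.
pose Q := pc (\sum_(N <- ns) N).
have EC' : pc C = c%:P%:M + Q by rewrite EC map_mxD map_scalar_mx.
exists (g *m P), (H' - ('X^m * s) *: (c%:P *: (g *m Q) + g *m K + (c%:P * e) *: (g *m K))).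
exists (s * (1 + c%:P * e)); split.
- by rewrite unitmx_mul ug.
- by rewrite /e !hornerE s0 expr0n /= mulr0 addr0 mulr1.
rewrite EG -/e; have -> : H = s *: (g *m pc C) + 'X *: H' by rewrite -EH' addrC subrK.
rewrite EP -/Q EC' !mulmxDr mulmx1 mul_mx_scalar -!scalemxAr.
rewrite /e !exprSr; move: (g *m Q) (g *m K) ('X^m) => A B a.
apply/matrixP => i j; rewrite !mxE; ring.
Qed.

End Lifting.

(** * From automorphisms of the quiver representation to the Iwahori group *)

Section ArrowBasis.
Context (F : fieldType) (n w : nat).
Local Notation V := 'rV[F]_(n * w).
Local Notation arr := (arrow F n w).
Implicit Types (u v : V) (A : 'Z_n -> 'End(V)).

(** Zero when a is out of range, so that the arrow always increases the index. *)
Definition evec (a : nat) : V := \row_b (b == a :> nat)%:R.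

Lemma arrow_evec a : arr (evec a) = evec a.+1.
Proof.
apply/rowP => b; rewrite mxE; case: (posnP b) => [b0|b0].
  by rewrite (arrow_0 _ b0) b0.
have ltb : (b.-1 < n * w)%N by rewrite prednK // ltnW.
rewrite (@arrow_succ _ _ _ _ (Ordinal ltb)) ?prednK // mxE /=.
by rewrite -(eqn_add2r 1) !addn1 prednK.
Qed.

Lemma evec_out a : (n * w <= a)%N -> evec a = 0.
Proof.
move=> ha; apply/rowP => b; rewrite !mxE; case: eqP => // E.
by have := ltn_ord b; rewrite E ltnNge ha.
Qed.

Lemma evec_sum u : u = \sum_a u 0 a *: evec a.
Proof.
apply/rowP => b; rewrite summxE (bigD1 b) //= !mxE eqxx mulr1 big1 ?addr0 // => c cb.
by rewrite !mxE eq_sym -(inj_eq val_inj) in cb *; rewrite (negPf cb) mulr0.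
Qed.

Definition arrow_comm A := forall i, (arr \o A i = A (i + 1)%R \o arr)%VF.

Lemma aut_arrow_comm A : is_aut A -> arrow_comm A.
Proof. by move=> H i; case: (H i). Qed.

Lemma arrow_commE A i u : arrow_comm A -> arr (A i u) = A (i + 1) (arr u).
Proof. by move=> H; have := congr1 (fun f : 'End(V) => f u) (H i); rewrite !comp_lfunE. Qed.

(** The representation is generated by the e_0 at all vertices. *)
Lemma aut_determined A A' : arrow_comm A -> arrow_comm A' ->
  (forall i, A i (evec 0) = A' i (evec 0)) -> forall i u, A i u = A' i u.
Proof.
move=> cA cA' H0.
have H a i : A i (evec a) = A' i (evec a).
  elim: a i => [|a IH] i; first exact: H0.
  by rewrite -arrow_evec -(subrK 1 i) -!arrow_commE // IH.
move=> i u; rewrite (evec_sum u) !linear_sum; apply: eq_bigr => a _.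
by rewrite !linearZ /= H.
Qed.

(** Otherwise A would raise the leading index of every e_a in the chain of e_0, and thus
    kill the last one. *)
Lemma aut_lead A i (hnw : (0 < n * w)%N) : is_aut A ->
  A i (evec 0) 0 (Ordinal hnw) != 0.
Proof.
move=> aA; apply/eqP => A0; have cA := aut_arrow_comm aA.
have H a (b : 'I_(n * w)) : (b <= a)%N -> A (i + a%:R) (evec a) 0 b = 0.
  elim: a b => [|a IH] b.
    rewrite leqn0 addr0 => /eqP b0; rewrite -A0; congr (_ _ _); exact: val_inj.
  move=> ba; rewrite -arrow_evec -natr1 addrA -arrow_commE //.
  case: (posnP b) => [/arrow_0 //|b0].
  have ltb : (b.-1 < n * w)%N by rewrite prednK // ltnW.
  by rewrite (@arrow_succ _ _ _ _ (Ordinal ltb)) ?prednK // IH //= -ltnS prednK.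
have e0 : evec (n * w).-1 = 0.
  have /eqP/lker0P inj := (aA (i + (n * w).-1%:R)).1.
  apply: inj; rewrite linear0; apply/rowP => b.
  by rewrite [RHS]mxE H // -ltnS prednK.
have lt1 : ((n * w).-1 < n * w)%N by rewrite prednK.
have := congr1 (fun u : V => u 0 (Ordinal lt1)) e0; rewrite !mxE /= eqxx.
by move/eqP; rewrite oner_eq0.
Qed.

End ArrowBasis.

Section AutLift.
Context (F : numFieldType) (n k w : nat) (n_gt1 : (1 < n)%N).
Local Notation L := (laurent F).
Local Notation V := 'rV[F]_(n * w).
Local Notation top i := (i - (k * w)%:Z + (n * w)%:Z).
Local Notation bot i := (i - (k * w)%:Z).
Local Notation be := (@basis_exp n k w).
Local Notation arr := (arrow F n w).

Let n_gt0 : (0 < n)%N := ltnW n_gt1.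
Lemma basis_exp_top (s : 'I_n) : be s = top (- s%:Z).
Proof. rewrite /basis_exp !PoszM; ring. Qed.

(** The exponent of e_s is at least that of y, so a basis vector of higher exponent
    must be multiplied by a positive power of z. *)
Lemma column_of_tspan (s : 'I_n) (y : L) : tspan (be s) y ->
  exists p : 'I_n -> {poly F}, y = \sum_r zmul n (p r) (tpow F (be r)) /\
    forall r : 'I_n, (r < s)%N -> (p r).[0] = 0.
Proof.
move=> /tspanP ys; rewrite (laurent_sum y) big_seq.
pose K (y : L) := exists p : 'I_n -> {poly F},
  y = \sum_r zmul n (p r) (tpow F (be r)) /\ forall r : 'I_n, (r < s)%N -> (p r).[0] = 0.
apply: (big_ind K).
- exists (fun _ => 0); split; last by move=> r _; rewrite horner0.
  by rewrite big1 // => r _; rewrite zmul0.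
- move=> _ _ [p [-> Hp]] [q [-> Hq]]; exists (fun r => p r + q r); split.
    by rewrite -big_split; apply: eq_bigr => r _; rewrite zmulD.
  by move=> r rs; rewrite hornerD Hp // Hq // addr0.
move=> j; rewrite -mcoeff_neq0; move: (mcoeff j y) (ys j) => c ysj c0.
have js : j <= be s by rewrite leNgt; apply: contraNN c0 => /ysj ->; rewrite eqxx.
have [r [m Ej]] := exp_decomp k w n_gt0 j.
have lr := ltn_ord r; have ls := ltn_ord s.
have nm : n%:Z * m <= r%:Z - s%:Z by move: js; rewrite Ej /basis_exp; lia.
have m0 : m <= 0 by nia.
exists (fun r' => if r' == r then c%:P * 'X^`|m| else 0); split.
  rewrite (bigD1 r) //= big1 ?addr0 => [|r' /negPf ->]; last by rewrite zmul0.
  rewrite eqxx zmulCM zmulXn // tmul_tpow Ej; congr (_ *: tpow _ (_ + _)).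
  by rewrite PoszM lez0_abs // mulrN opprK.
move=> r' r's; case: eqP r's => [->|_ _]; last by rewrite horner0.
move=> rs; rewrite hornerM hornerXn; case: (`|m|%N) (absz_eq0 m) => [|d _].
  by rewrite eqxx => /esym/eqP mE; rewrite mE mulr0 in nm; lia.
by rewrite expr0n /= mulr0.
Qed.

(** Multiplication by z acts on the representation as the n-fold arrow. *)
Lemma zmul_stable (U : 'Z_n -> {vspace V}) (i : int) (x : L) (p : {poly F}) :
  (forall j, (arr @: U j <= U (j + 1)%R)%VS) ->
  tspan (top i) x -> trunc n k w i x \in U i%:~R ->
  tspan (top i) (zmul n p x) /\ trunc n k w i (zmul n p x) \in U i%:~R.
Proof.
move=> stU xt xU.
have H (m : nat) : trunc n k w (i + m%:Z) x \in U (i + m%:Z)%:~R.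
  elim: m => [|m IH]; first by rewrite addr0.
  have -> : i + m.+1%:Z = (i + m%:Z) + 1 by lia.
  rewrite -arrow_trunc //; last by apply: tspan_le xt; lia.
  rewrite intrD; apply: (subvP (stU _)); exact: memv_img.
have E (d : nat) : trunc n k w i (tmul (- (n * d)%:Z) x) = trunc n k w (i + (n * d)%:Z) x.
  by apply/rowP => a; rewrite !mxE mcoeff_tmul; congr mcoeff; lia.
have T (d : nat) : tspan (top i) (tmul (- (n * d)%:Z) x).
  have := tspan_tmul (a := - (n * d)%:Z) xt; apply: tspan_le; lia.
split; rewrite /zmul.
  by apply: tspan_sum => d _; exact: tspanZ (T d).
rewrite linear_sum; apply: memv_suml => d _; rewrite linearZ /=; apply: memvZ.
rewrite E; have := H (n * d)%N; congr (_ \in U _).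
by rewrite intrD -pmulrn natrM (pchar_Zp n_gt1) mul0r addr0.
Qed.

Context (w_gt0 : (0 < w)%N).

Let nw_gt0 : (0 < n * w)%N. Proof. by rewrite muln_gt0 n_gt0. Qed.

(** The images of the e_0 under A are the columns of a matrix G over F[z] that induces
    A.  By [lift_unit], G = s g up to an error that is divisible by z^(w+1) and thus
    is invisible in the representation, and s preserves U by [zmul_stable]. *)
Lemma aut_mod_scalar (A : 'Z_n -> 'End(V)) : is_aut A ->
  exists2 g : 'M[{poly F}]_n, iwahori F n g &
    forall U : 'Z_n -> {vspace V}, (forall j, (arr @: U j <= U (j + 1)%R)%VS) ->
      forall i, (A i @: U i <= gl_aut k w g i @: U i)%VS.
Proof.
move=> aA; have cA := aut_arrow_comm aA.
pose y (s : 'I_n) : L := psi k (- s%:Z) (A (- s%:Z)%:~R (evec F n w 0)).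
have yt s : tspan (be s) (y s) by rewrite basis_exp_top; exact: psi_top.
have /choice [p Hp] := fun s => column_of_tspan (yt s).
pose G : 'M[{poly F}]_n := \matrix_(r, s) p s r.
have colG s : gl_col k w G s = y s.
  by rewrite (Hp s).1; apply: eq_bigr => r _; rewrite mxE.
have tG : trig_at0 G.
  by apply/is_trig_mxP => r s rs; rewrite !mxE; exact: (Hp s).2.
have e0E i : psi k i (evec F n w 0) = tpow F (top i).
  rewrite /psi (bigD1 (Ordinal nw_gt0)) //= big1 => [|a a0].
    by rewrite mxE eqxx scale1r addr0 subr0.
  rewrite mxE; have [E|_] := eqVneq (a : nat) 0%N; last by rewrite scale0r.
  by case/eqP: a0; apply: val_inj.
have reprZ (i : 'Z_n) : exists s : 'I_n, (- s%:Z)%:~R = i.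
  have lt : (val (- i)%R < n)%N.
    by have := ltn_ord (- i); rewrite [in X in (_ < X)%N](Zp_cast n_gt1).
  by exists (Ordinal lt); rewrite mulrNz -pmulrn -[RHS]opprK -[in RHS](natr_Zp (- i)).
have AG i u : A i u = gl_aut k w G i u.
  apply: aut_determined => // [j|j]; first exact: gl_aut_arrow.
  have [s <-] := reprZ j.
  rewrite -(psiK k (- s%:Z) (evec F n w 0)) -[RHS]trunc_gl_act //; last exact: psi_top.
  by rewrite psiK e0E -basis_exp_top gl_act_basis // colG /y psiK.
have uG : map_mx (fun p : {poly F} => p.[0]) G \in unitmx.
  rewrite unitmxE unitfE det_trig //; apply/prodf_neq0 => s _; rewrite !mxE.
  apply/eqP => ps0.
  have ys : tspan (be s - 1) (y s).
    rewrite (Hp s).1; apply: tspan_sum => r _; apply: tspan_sum => -[d /= _] _.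
    rewrite tmul_tpow.
    have [/andP[rs /eqP ->]|rs] := boolP ((r <= s)%N && (d == 0%N)).
      have -> : (p s r)`_0 = 0.
        move: rs; rewrite -horner_coef0 leq_eqVlt => /orP[/eqP/val_inj -> //|rs].
        exact: (Hp s).2.
      by rewrite scale0r; apply: (tspan_subspace _ _).1.
    apply: tspanZ; apply/tspan_tpow; rewrite /basis_exp.
    have := ltn_ord s; have := ltn_ord r.
    move: ((n%:Z - k%:Z) * w%:Z) => c lr ls.
    case: d rs => [|d] rs; last by rewrite mulnS; lia.
    by move: rs; rewrite eqxx andbT -ltnNge; lia.
  have /eqP := aut_lead (- s%:Z)%:~R nw_gt0 aA; apply.
  have := psiK k (- s%:Z) (A (- s%:Z)%:~R (evec F n w 0)); rewrite -/(y s) => <-.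
  rewrite mxE /= subr0 -basis_exp_top; apply: (iffLR (tspanP _ _) ys); lia.
have [g [H [s [ug s0 EG]]]] := lift_unit n_gt0 w uG.
have eg : map_mx (fun p : {poly F} => p.[0]) g = map_mx (fun p : {poly F} => p.[0]) G.
  apply/matrixP => i j; rewrite EG !mxE !hornerE s0 mul1r.
  by rewrite expr0n /= mul0r addr0.
have ig : iwahori F n g by split=> //; rewrite eg.
exists g => // U stU i; apply/subvP => _ /memv_imgP [u uU ->].
pose i0 := (i : nat)%:Z; have Ei : (i0%:~R : 'Z_n) = i by rewrite -pmulrn natr_Zp.
pose x := psi k i0 u.
have xt : tspan (top i0) x by exact: psi_top.
have xU : trunc n k w i0 x \in U i0%:~R by rewrite psiK Ei.
have [st sU] := zmul_stable s stU xt xU.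
rewrite AG -[u](psiK k i0) -/x -{1}Ei -trunc_gl_act //.
rewrite EG gl_actD // !gl_actZ // linearD /=.
rewrite [X in _ + X]trunc_eq0 ?addr0.
  rewrite trunc_gl_act // ?Ei; last by case: ig.
  by move: sU; rewrite Ei; apply: memv_img.
have := gl_act_tspan_weak k w n_gt0 H (tspan_tmul (a := - (n * w.+1)%:Z) xt).
by rewrite zmulXn //; apply: tspan_le; rewrite mulnS; lia.
Qed.

(** The inclusion in [aut_mod_scalar] is an equality by dimension. *)
Lemma aut_is_gl (A : 'Z_n -> 'End(V)) : is_aut A ->
  exists2 g : 'M[{poly F}]_n, iwahori F n g &
    forall U : 'Z_n -> {vspace V}, (forall j, (arr @: U j <= U (j + 1)%R)%VS) ->
      Psi F n k w (aut_act A U) = flag_act k w g (Psi F n k w U).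
Proof.
move=> aA; have [g ig Hg] := aut_mod_scalar aA; exists g => // U stU.
rewrite -Psi_gl_aut //; congr Psi; apply: boolp.funext => i; rewrite /aut_act.
apply/eqP; rewrite eqEdim Hg //=.
have dimA (B : 'Z_n -> 'End(V)) : is_aut B -> \dim (B i @: U i) = \dim (U i).
  by move=> /(_ i)[kB _]; apply: limg_dim_eq; rewrite kB capv0.
by rewrite !dimA //; apply: gl_aut_is_aut.
Qed.

End AutLift.

(** * Positions of a coordinate subrepresentation *)

Section Counting.
Context (n w : nat) (n_gt1 : (1 < n)%N).
Local Notation nw := (n * w)%N.
Implicit Types (al : 'Z_n -> nat) (i j l : 'Z_n).

(** The dimension at vertex i of the coordinate subrepresentation encoded by al: the
    basis vector e_a at i belongs to the chain of arrows that starts with e_0 at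
    i - a, and al tells from which index on this chain is included. *)
Definition nb_pos al i : nat := (\sum_(a < nw) (al (i - a%:R)%R <= a))%N.

Lemma card_Zn : #|{: 'Z_n}| = n.
Proof. by rewrite card_ord (Zp_cast n_gt1). Qed.

Lemma natr_nw : (nw%:R : 'Z_n) = 0.
Proof. by rewrite natrM (pchar_Zp n_gt1) mul0r. Qed.

(** Passing from vertex i - 1 to i, the included positions move up by one, the last
    position is lost and the chains with j + al j = i are new. *)
Lemma nb_pos_step al i : (forall j, (al j <= nw)%N) ->
  (nb_pos al i + 1 = nb_pos al (i - 1)%R + \sum_(a < nw.+1) (al (i - a%:R)%R == a))%N.
Proof.
move=> bal.
have -> : (nb_pos al i + 1 = \sum_(a < nw.+1) (al (i - a%:R)%R <= a))%N.
  by rewrite big_ord_recr /= bal.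
have E (a : nat) j : ((al j <= a) = (al j < a) + (al j == a) :> nat)%N.
  by case: ltngtP.
under eq_bigr => a _ do rewrite E.
rewrite big_split /= big_ord_recl ltn0 add0n; congr (_ + _)%N.
by apply: eq_bigr => a _; rewrite -natr1 opprD addrA addrAC ltnS.
Qed.

Lemma nb_pos_sum al : (forall j, (al j <= nw)%N) ->
  (\sum_i nb_pos al i = \sum_j (nw - al j))%N.
Proof.
move=> bal; rewrite /nb_pos exchange_big /=.
under eq_bigr => a _.
  rewrite (reindex_inj (addIr (a%:R : 'Z_n))) /=.
  under eq_bigr => j _ do rewrite addrK.
  over.
rewrite exchange_big /=; apply: eq_bigr => j _.
rewrite -(big_mkord xpredT (fun a => (al j <= a) : nat)).
rewrite (@big_cat_nat _ _ _ (al j)) //= big_nat big1 ?add0n => [|a /andP[_ aj]].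
  rewrite big_nat (eq_bigr (fun=> 1%N)) => [|a /andP[-> _]//].
  by rewrite -big_nat sum_nat_const_nat muln1.
by rewrite leqNgt aj.
Qed.

(** When the dimensions are constant, [nb_pos_step] says that exactly one chain becomes
    new at each vertex, if a chain that is never included is counted as new at index
    nw. *)
Lemma nb_pos_inj al (K : nat) : (forall j, (al j <= nw)%N) ->
  (forall i, nb_pos al i = K) ->
  forall j l, j + (al j)%:R = l + (al l)%:R -> j = l.
Proof.
move=> bal cst j l E; pose i := j + (al j)%:R.
have := nb_pos_step i bal; rewrite !cst => /addnI S1.
suff ajl : al j = al l by move: E; rewrite ajl => /addIr.
have lj : (al j < nw.+1)%N by rewrite ltnS.
have ll : (al l < nw.+1)%N by rewrite ltnS.
apply/eqP/negPn/negP => njl; move: S1.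
rewrite (bigD1 (Ordinal lj)) //= (bigD1 (Ordinal ll)) /=; last first.
  by rewrite -(inj_eq val_inj) /= eq_sym.
by rewrite {1}/i addrK eqxx {1}/i E addrK eqxx.
Qed.

Lemma Zn_natr_eq0 (e : nat) : (e < n)%N -> (e%:R : 'Z_n) = 0 -> e = 0%N.
Proof.
move=> en /(congr1 val); rewrite /= (val_Zp_nat n_gt1) modn_small //.
Qed.

Lemma Zn_natr_inj (e e' : nat) : (e < n)%N -> (e' < n)%N ->
  (e%:R : 'Z_n) = e'%:R -> e = e'.
Proof.
move=> en en' /(congr1 val); rewrite /= !(val_Zp_nat n_gt1) !modn_small //.
Qed.

Definition strict al j := (0 < al j < nw)%N.

(** Call j strict if 0 < al j < nw.  Take j strict with minimal al j, and let j + d be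
    the next strict vertex.  The vertices m between them satisfy m + al m = m, so by
    [nb_pos_inj] neither j + al j nor j + d + al (j + d) is such an m; this gives the
    two bounds.  The sum formula [nb_pos_sum] modulo nw shows that j is not the only
    strict vertex, so that d < n. *)
Lemma exchangeable al (k : nat) : (forall j, (al j <= nw)%N) ->
  (forall i, nb_pos al i = (k * w)%N) -> (exists j, strict al j) ->
  exists j, exists d : nat,
    [/\ (0 < d < n)%N, (d <= al j)%N, (d + al (j + d%:R)%R <= nw)%N
      & (al j < d + al (j + d%:R)%R)%N].
Proof.
move=> bal cst [j0 sj0].
have [j sj minj] := @arg_minnP _ j0 (strict al) al sj0.
have exd : exists d, (0 < d)%N && strict al (j + d%:R).
  by exists n; rewrite (ltnW n_gt1) (pchar_Zp n_gt1) addr0.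
case: (ex_minnP exd) => d /andP[d0 sd] mind.
have inj := nb_pos_inj bal cst.
have ns e : (0 < e < d)%N -> al (j + e%:R) = 0%N \/ al (j + e%:R) = nw.
  move=> /andP[e0 ed]; have : ~~ strict al (j + e%:R).
    by apply/negP => se; have := mind e; rewrite e0 se leqNgt ed => /(_ isT).
  by have := bal (j + e%:R); rewrite /strict; lia.
have ns0 e : (0 < e < d)%N -> (al (j + e%:R))%:R = 0 :> 'Z_n.
  by case/ns=> ->; rewrite ?natr_nw.
(* for d = n all other values of al would be 0 or nw, and nw would divide al j *)
have dn : (d < n)%N.
  rewrite ltn_neqAle; apply/andP; split; last first.
    by apply: mind; rewrite (ltnW n_gt1) (pchar_Zp n_gt1) addr0.
  apply/eqP => dn.
  have nsl l : l != j -> (nw %| al l)%N.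
    move=> lj; pose e : nat := (l - j)%R.
    have el : l = j + e%:R by rewrite /e natr_Zp addrC subrK.
    have en : (e < n)%N by rewrite -[X in (_ < X)%N](Zp_cast n_gt1) ltn_ord.
    have e0 : (0 < e)%N.
      by rewrite lt0n; apply: contraNneq lj => e0; rewrite el e0 addr0.
    have he : (0 < e < d)%N by rewrite e0 dn en.
    by case: (ns e he); rewrite -el => ->.
  have S := nb_pos_sum bal.
  have : (\sum_i nb_pos al i + \sum_i al i = n * nw)%N.
    rewrite S -big_split /=.
    under eq_bigr => i _ do rewrite subnK //.
    by rewrite sum_nat_const card_Zn.
  under eq_bigr => i _ do rewrite cst.
  rewrite sum_nat_const card_Zn (bigD1 j) //= => E.
  have : (nw %| al j)%N.
    have d1 : (nw %| \sum_(i | i != j) al i)%N by apply: dvdn_sum => i; exact: nsl.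
    have d2 : (nw %| n * nw)%N by exact: dvdn_mull.
    move: d2; rewrite -E dvdn_addr; last by rewrite mulnCA dvdn_mull.
    by rewrite dvdn_addl.
  case/andP: sj => aj0 ajn /dvdn_leq -/(_ aj0); rewrite leqNgt ajn //.
exists j, d; split; first by rewrite d0.
- rewrite leqNgt; apply/negP => jd; have aj0 : (0 < al j)%N by case/andP: sj.
  have e0 : (0 < al j < d)%N by rewrite aj0.
  have /inj E : (j + (al j)%:R) + (al (j + (al j)%:R))%:R = j + (al j)%:R.
    by rewrite ns0 // addr0.
  have : (al j)%:R = 0 :> 'Z_n by apply: (addrI j); rewrite addr0.
  by move/(Zn_natr_eq0 (ltn_trans jd dn)) => z; rewrite z in aj0.
- rewrite leqNgt; apply/negP => ld; set l := j + d%:R in ld *.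
  have ln : (al l < nw)%N by case/andP: sd.
  pose e := (d + al l - nw)%N.
  have ed : (0 < e < d)%N by rewrite /e; lia.
  have /inj E : (j + e%:R) + (al (j + e%:R))%:R = l + (al l)%:R.
    rewrite ns0 // addr0 /l -addrA -natrD.
    have -> : (d + al l = e + nw)%N by rewrite /e; lia.
    by rewrite natrD natr_nw addr0.
  have [e0 eld] := andP ed.
  have : e = d by apply: Zn_natr_inj => //; [exact: ltn_trans dn | exact: addrI E].
  by move=> eE; rewrite eE ltnn in eld.
- have := minj _ sd; lia.
Qed.

Lemma nb_nonstrict al (k : nat) : (0 < w)%N ->
  (forall j, al j = 0%N \/ al j = nw) ->
  (forall i, nb_pos al i = (k * w)%N) -> #|[pred j | al j == 0%N]| = k.
Proof.
move=> w0 ns cst; have bal j : (al j <= nw)%N by case: (ns j) => ->.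
have := nb_pos_sum bal.
rewrite (eq_bigr (fun=> (k * w)%N)) // sum_nat_const card_Zn.
rewrite (eq_bigr (fun j => if al j == 0%N then nw else 0%N)); last first.
  by move=> j _; case: (ns j) => ->; rewrite ?subn0 ?subnn //; case: eqP => // ->.
rewrite -big_mkcond /= sum_nat_const => E.
have nw0 : (0 < nw)%N by rewrite muln_gt0 (ltnW n_gt1).
apply/eqP; rewrite -(eqn_pmul2r nw0) -E; apply/eqP; lia.
Qed.

Lemma nonstrict_nb al (k : nat) : (0 < w)%N ->
  (forall j, al j = 0%N \/ al j = nw) -> #|[pred j | al j == 0%N]| = k ->
  forall i, nb_pos al i = (k * w)%N.
Proof.
move=> w0 ns ck; have bal j : (al j <= nw)%N by case: (ns j) => ->.
have nw0 : (0 < nw)%N by rewrite muln_gt0 (ltnW n_gt1).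
have st i : nb_pos al i = nb_pos al (i - 1).
  have := nb_pos_step i bal.
  rewrite big_ord_recr /= natr_nw subr0.
  rewrite -(big_mkord xpredT (fun a => (al (i - a%:R)%R == a) : nat)).
  rewrite big_ltn // subr0 big_nat big1.
    by case: (ns i) => ->; rewrite ?eqxx; case: eqP; lia.
  move=> a /andP[a0 an].
  by case: (ns (i - a%:R)) => ->; case: eqP => //; lia.
have cst (m : nat) : nb_pos al m%:R = nb_pos al 0.
  by elim: m => [//|m IH]; rewrite st -natr1 addrK.
have cst' i : nb_pos al i = nb_pos al 0 by rewrite -(natr_Zp i) cst.
move=> i; rewrite cst'; have := nb_pos_sum bal.
rewrite (eq_bigr (fun=> nb_pos al 0)) // sum_nat_const card_Zn.
rewrite (eq_bigr (fun j => if al j == 0%N then nw else 0%N)); last first.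
  by move=> j _; case: (ns j) => ->; rewrite ?subn0 ?subnn //; case: eqP => // ->.
rewrite -big_mkcond /= sum_nat_const ck => E.
apply/eqP; rewrite -(eqn_pmul2l (ltnW n_gt1)) E; apply/eqP; lia.
Qed.

End Counting.

(** * Coordinate subrepresentations and the normal form of a subrepresentation *)

Section BasisMatrices.
Context (F : fieldType).

Definition basis_mx (d m : nat) (B : 'M[F]_(d, m)) (W : {vspace 'rV[F]_m}) : Prop :=
  row_free B /\ forall u, u \in W <-> (u <= B)%MS.

Lemma basis_mx_exists (m d : nat) (W : {vspace 'rV[F]_m}) : \dim W = d ->
  exists B : 'M[F]_(d, m), basis_mx B W.
Proof.
move=> <-; pose B := \matrix_(i < \dim W) (vbasis W)`_i.
have mulB (a : 'rV_(\dim W)) : a *m B = \sum_i a 0 i *: (vbasis W)`_i.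
  by rewrite mulmx_sum_row; apply: eq_bigr => i _; rewrite rowK.
exists B; split.
  apply: inj_row_free => a; rewrite mulB => a0.
  have /freeP H := basis_free (vbasisP W).
  by apply/rowP => i; rewrite (H (fun i => a 0 i) a0) mxE.
move=> u; split=> [uW|/submxP [a ->]].
  apply/submxP; exists (\row_i coord (vbasis W) i u); rewrite mulB.
  by rewrite {1}(coord_vbasis uW); apply: eq_bigr => i _; rewrite mxE.
rewrite mulB; apply: memv_suml => i _; apply: memvZ.
by apply: vbasis_mem; rewrite mem_nth // size_tuple.
Qed.

Lemma basis_mx_dim (m d : nat) (W : {vspace 'rV[F]_m}) (B : 'M[F]_(d, m)) :
  basis_mx B W -> \dim W = d.
Proof.
move=> [fB WB]; have [B' [fB' WB']] := basis_mx_exists (erefl (\dim W)).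
rewrite -(eqP fB') -(eqP fB); apply/eqP; rewrite eqn_leq !mxrankS //.
  by apply/rV_subP => u /WB /WB'.
by apply/rV_subP => u /WB' /WB.
Qed.

Lemma basis_mx_img (m d : nat) (W : {vspace 'rV[F]_m}) (B : 'M[F]_(d, m))
    (f : 'End('rV[F]_m)) :
  (forall u, u \in W -> f u = 0 -> u = 0) ->
  basis_mx B W -> basis_mx (B *m lin1_mx f) (f @: W)%VS.
Proof.
move=> injf [fB WB]; have aB a : a *m (B *m lin1_mx f) = f (a *m B).
  by rewrite mulmxA mul_rV_lin1.
split.
  apply: inj_row_free => a; rewrite aB => /injf z.
  by apply: (row_free_inj fB); rewrite mul0mx z //; apply/WB; apply: submxMl.
move=> u; split.
  case/memv_imgP => v /WB /submxP [a ->] ->; rewrite -aB; exact: submxMl.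
by case/submxP => a ->; rewrite aB; apply/memv_img/WB; apply: submxMl.
Qed.

End BasisMatrices.

Section CoordinateSubreps.
Context (F : fieldType) (n w : nat).
Local Notation nw := (n * w)%N.
Local Notation V := 'rV[F]_(n * w).
Local Notation arr := (arrow F n w).
Local Notation evec := (evec F n w).
Implicit Types (u v : V) (A : 'Z_n -> 'End(V)) (al : 'Z_n -> nat) (i j l : 'Z_n).

Definition coord_sub (S : pred 'I_nw) : {vspace V} :=
  <<[tuple evec (enum_val a) | a < #|S|]>>%VS.

Lemma evecE (a b : 'I_nw) : evec a 0 b = (b == a)%:R.
Proof. by rewrite mxE. Qed.

Lemma coord_sub_free (S : pred 'I_nw) : free [tuple evec (enum_val a) | a < #|S|].
Proof.
apply/freeP => c c0 i; have := congr1 (fun u : V => u 0 (enum_val i)) c0.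
rewrite summxE (bigD1 i) //= mxE (nth_map i) ?size_enum_ord // nth_ord_enum.
rewrite evecE eqxx mulr1 big1 ?addr0 ?[RHS]mxE // => j ji.
rewrite mxE (nth_map i) ?size_enum_ord // nth_ord_enum evecE.
by rewrite (inj_eq enum_val_inj) eq_sym (negPf ji) mulr0.
Qed.

Lemma coord_sub_dim (S : pred 'I_nw) : \dim (coord_sub S) = #|S|.
Proof. by have := coord_sub_free S; rewrite /free size_tuple => /eqP. Qed.

Lemma coord_subP (S : pred 'I_nw) u :
  u \in coord_sub S <-> forall a, u 0 a != 0 -> S a.
Proof.
split.
  move=> /coord_span -> a; rewrite summxE; apply: contraNT => Sa.
  apply/eqP; rewrite big1 // => i _.
  rewrite mxE (nth_map i) ?size_enum_ord // nth_ord_enum evecE.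
  case: eqP => [E|]; last by rewrite mulr0.
  by case/negP: Sa; have := enum_valP i; rewrite -E.
move=> H; rewrite (evec_sum u); apply: memv_suml => a _.
have [->|/H Sa] := eqVneq (u 0 a) 0; first by rewrite scale0r mem0v.
apply: memvZ; apply: memv_span; apply/mapP.
have aS : a \in S by [].
by exists (enum_rank_in aS a); rewrite ?mem_enum // enum_rankK_in.
Qed.

Lemma coord_sub_evec (S : pred 'I_nw) (a : 'I_nw) : S a -> evec a \in coord_sub S.
Proof.
move=> Sa; apply/coord_subP => b; rewrite evecE.
by have [->|_] := eqVneq b a => //; rewrite eqxx.
Qed.

Lemma coord_sub_img (S : pred 'I_nw) (f : 'End(V)) (W : {vspace V}) :
  (forall a, S a -> f (evec a) \in W) -> (f @: coord_sub S <= W)%VS.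
Proof.
move=> H; apply/subvP => _ /memv_imgP [u /coord_subP uS ->].
rewrite (evec_sum u) linear_sum; apply: memv_suml => a _; rewrite linearZ /=.
have [->|/uS Sa] := eqVneq (u 0 a) 0; first by rewrite scale0r mem0v.
by apply: memvZ; apply: H.
Qed.

(** The coordinate subrepresentation in which the chain of e_0 at vertex j is included
    from index al j on; see [nb_pos]. *)
Definition subrep al i : {vspace V} :=
  coord_sub (fun a : 'I_nw => (al (i - (a : nat)%:R)%R <= a)%N).

Lemma subrep_dim al i : \dim (subrep al i) = nb_pos w al i.
Proof. by rewrite coord_sub_dim -sum1_card big_mkcond. Qed.

Lemma subrep_evec al i (a : nat) : (al (i - a%:R)%R <= a)%N -> evec a \in subrep al i.
Proof.
move=> ha; have [na|na] := leqP nw a; first by rewrite evec_out // mem0v.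
exact: (@coord_sub_evec _ (Ordinal na)).
Qed.

Definition arrow_stable (U : 'Z_n -> {vspace V}) :=
  forall i, (arr @: U i <= U (i + 1)%R)%VS.

Lemma subrep_stable al : arrow_stable (subrep al).
Proof.
move=> i; apply: coord_sub_img => a ha; rewrite arrow_evec; apply: subrep_evec.
by rewrite -natr1 opprD addrACA subrr addr0 leqW.
Qed.

Lemma aut_act_stable A (U : 'Z_n -> {vspace V}) :
  is_aut A -> arrow_stable U -> arrow_stable (aut_act A U).
Proof.
move=> /aut_arrow_comm cA sU i; apply/subvP => _ /memv_imgP [_ /memv_imgP [u uU ->] ->].
by rewrite arrow_commE //; apply/memv_img/(subvP (sU i))/memv_img.
Qed.

Lemma aut_act_dim A (U : 'Z_n -> {vspace V}) i :
  is_aut A -> \dim (aut_act A U i) = \dim (U i).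
Proof. by move=> /(_ i) [kA _]; apply: limg_dim_eq; rewrite kA capv0. Qed.

Lemma aut_inj A i u : is_aut A -> A i u = 0 -> u = 0.
Proof. by move=> /(_ i) [/eqP/lker0P inj _] Au; apply: inj; rewrite Au linear0. Qed.

(** The endomorphism of the representation that sends e_0 at vertex j to the sum of the
    c j b e_b. *)
Definition aut_of (c : 'Z_n -> nat -> F) i : 'End(V) :=
  linfun (mulmxr (\matrix_(a < nw, b < nw)
    if (a <= b)%N then c (i - (a : nat)%:R) (b - a)%N else 0)).

Lemma aut_of_app c i u (b : 'I_nw) : aut_of c i u 0 b =
  \sum_(a < nw) u 0 a * (if (a <= b)%N then c (i - (a : nat)%:R) (b - a)%N else 0).
Proof. by rewrite lfunE /= mxE; apply: eq_bigr => a _; rewrite mxE. Qed.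

Lemma aut_of_evec_app c i (a : nat) (b : 'I_nw) : (a < nw)%N -> aut_of c i (evec a) 0 b =
  if (a <= b)%N then c (i - a%:R) (b - a)%N else 0.
Proof.
move=> an; rewrite aut_of_app (bigD1 (Ordinal an)) //= big1 => [|a' a'a].
  by rewrite mxE eqxx mul1r addr0.
rewrite mxE; case: eqP => [E|]; last by rewrite mul0r.
by case/eqP: a'a; apply: val_inj.
Qed.

Lemma aut_of_comm c : arrow_comm (aut_of c).
Proof.
move=> i; apply/lfunP => u; rewrite !comp_lfunE (evec_sum u) !linear_sum.
apply: eq_bigr => a _; rewrite !linearZ /=; congr (_ *: _).
rewrite arrow_evec; apply/rowP => b.
have Ei : i + 1 - a.+1%:R = i - (a : nat)%:R.
  by rewrite -natr1 opprD addrACA subrr addr0.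
case: (posnP b) => [b0|b0].
  rewrite arrow_0 //; have [na|na] := leqP nw a.+1.
    by rewrite evec_out // linear0 mxE.
  by rewrite aut_of_evec_app // b0.
have ltb : (b.-1 < nw)%N by rewrite prednK // ltnW.
rewrite (@arrow_succ _ _ _ _ (Ordinal ltb)) ?prednK // aut_of_evec_app //=.
have [na|na] := leqP nw a.+1.
  rewrite evec_out // linear0 mxE ifN // -ltnNge.
  by have := ltn_ord b; lia.
rewrite aut_of_evec_app // Ei; case: leqP => ab; case: leqP => ab' //; try lia.
by congr (c _ _); lia.
Qed.

(** The matrices are triangular, and the diagonal entries are the c j 0. *)
Lemma aut_of_is_aut c : (forall j, c j 0%N != 0) -> is_aut (aut_of c).
Proof.
move=> c0 i; split; last exact: aut_of_comm.
apply/eqP; rewrite -subv0; apply/subvP => u; rewrite memv_ker memv0 => /eqP Au.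
apply/eqP/rowP => b; rewrite mxE.
have [m] := ubnP b; elim: m b => // m IH b bm.
have := congr1 (fun u : V => u 0 b) Au; rewrite aut_of_app mxE.
rewrite (bigD1 b) //= leqnn subnn big1 ?addr0 => [/eqP|a ab].
  by rewrite mulf_eq0 (negPf (c0 _)) orbF => /eqP.
case: leqP => [le|]; last by rewrite mulr0.
rewrite IH ?mul0r //; apply: leq_trans (_ : b <= m)%N; last by rewrite -ltnS.
by rewrite ltn_neqAle le andbT -(inj_eq val_inj) in ab *.
Qed.

(** A Bruhat decomposition: al j is the least index a for which U contains, at vertex
    j + a, a vector f j with leading term e_a.  The automorphism sends the chain of
    e_0 at j to the shifts of f j, forwards and backwards.  The image of the
    coordinate subrepresentation lies in U because U is stable under arrows, and it
    contains U because it contains a vector for each leading term that occurs in U. *)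
Lemma subrep_normal_form (U : 'Z_n -> {vspace V}) : arrow_stable U ->
  exists A, exists al, [/\ is_aut A, forall j, (al j <= nw)%N & U = aut_act A (subrep al)].
Proof.
move=> sU.
(* the zero vector qualifies for a >= nw, so the least a exists and is at most nw *)
pose Q j a := `[< exists2 u, u \in U (j + a%:R) &
   forall b : 'I_nw, (b <= a)%N -> u 0 b = (b == a :> nat)%:R >].
have exQ j : exists a, Q j a.
  exists nw; apply/asboolP; exists 0; first exact: mem0v.
  by move=> b _; rewrite mxE; have := ltn_ord b; case: ltngtP.
pose al j := ex_minn (exQ j).
have Qal j : Q j (al j) by rewrite /al; case: ex_minnP.
have al_min j a : Q j a -> (al j <= a)%N.
  by rewrite /al; case: ex_minnP => m _; apply.
have bal j : (al j <= nw)%N.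
  apply: al_min; apply/asboolP; exists 0; first exact: mem0v.
  by move=> b _; rewrite mxE; have := ltn_ord b; case: ltngtP.
have /choice [f Hf] : forall j, exists u : V, u \in U (j + (al j)%:R) /\
    forall b : 'I_nw, (b <= al j)%N -> u 0 b = (b == al j :> nat)%:R.
  by move=> j; have /asboolP [u uU Hu] := Qal j; exists u.
(* f j moved back to vertex j; the first coefficient is 1 also when f j = 0 *)
pose c j b : F := if b == 0%N then 1 else
  if insub (b + al j)%N is Some b' then f j 0 b' else 0.
exists (aut_of c), al; split=> //.
  by apply: aut_of_is_aut => j; rewrite /c eqxx oner_neq0.
have base j : aut_of c (j + (al j)%:R) (evec (al j)) = f j.
  apply/rowP => b; have [na|na] := leqP nw (al j).
    have -> : al j = nw by apply/eqP; rewrite eqn_leq bal na.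
    rewrite evec_out // linear0 mxE (Hf j).2 ?(leq_trans (ltnW (ltn_ord b))) //.
    by have := ltn_ord b; case: ltngtP (leq_trans (ltn_ord b) na).
  rewrite aut_of_evec_app // addrK /c subn_eq0.
  case: (ltngtP b (al j)) => ab.
  - by rewrite (Hf j).2 ?(ltnW ab) // (ltn_eqF ab).
  - by rewrite subnK ?(ltnW ab) // insubT //= => lb; congr (f j 0 _); apply: val_inj.
  - have hb : (b <= al j)%N by rewrite ab.
    by rewrite (Hf j).2 // ab eqxx.
have sub1 i : (aut_of c i @: subrep al i <= U i)%VS.
  apply: coord_sub_img => a; set j := i - _ => ja.
  have [m Em] : exists m, (a : nat) = (al j + m)%N by exists (a - al j)%N; rewrite subnKC.
  have Ei : i = j + (al j)%:R + m%:R by rewrite -addrA -natrD -Em subrK.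
  rewrite Ei Em; elim: m {Em Ei} => [|m IH].
    by rewrite addr0 addn0 base; have [] := Hf j.
  rewrite addnS -arrow_evec -natr1 addrA -arrow_commE; last exact: aut_of_comm.
  exact/(subvP (sU _))/memv_img.
apply: boolp.funext => i; apply/eqP; rewrite eqEsubv sub1 andbT; apply/subvP => u uU.
(* descending induction on the leading index of v *)
have H (d : nat) : (d <= nw)%N -> forall v, v \in U i ->
    (forall b : 'I_nw, (b < nw - d)%N -> v 0 b = 0) -> v \in aut_act (aut_of c) (subrep al) i.
  elim: d => [|d IH] dn v vU v0.
    have -> : v = 0 by apply/rowP => b; rewrite v0 ?mxE // subn0.
    exact: mem0v.
  have la : (nw - d.+1 < nw)%N by lia.
  pose a := Ordinal la.
  have [va|va] := eqVneq (v 0 a) 0.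
    apply: IH => //; first exact: ltnW.
    move=> b bd; have [ba|ba] := ltnP b (nw - d.+1); first exact: v0.
    by rewrite -va; congr (v 0 _); apply: val_inj; rewrite /a /=; lia.
  have al_a : (al (i - (a : nat)%:R)%R <= a)%N.
    apply: al_min; apply/asboolP; exists ((v 0 a)^-1 *: v).
      by rewrite subrK memvZ.
    move=> b ba; rewrite mxE; case: eqP => [/val_inj ->|nba]; first by rewrite mulVf.
    have bl : (b < nw - d.+1)%N by move: ba nba; rewrite /a /=; lia.
    by rewrite (v0 b bl) mulr0.
  have ea : evec a \in subrep al i by apply: subrep_evec.
  have Aea : aut_of c i (evec a) \in aut_act (aut_of c) (subrep al) i by apply: memv_img.
  rewrite -(subrK (v 0 a *: aut_of c i (evec a)) v) memvD ?memvZ //.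
  apply: IH; first exact: ltnW.
    by rewrite rpredB // memvZ // (subvP (sub1 i)).
  move=> b bd; rewrite !mxE aut_of_evec_app //=.
  case: (ltngtP b (nw - d.+1)%N) => ba; [|lia|].
    by rewrite v0 // mulr0 subr0.
  have -> : b = a by apply: val_inj.
  by rewrite /= subnn /c eqxx mulr1 subrr.
by apply: (H nw) => // b; rewrite subnn.
Qed.

End CoordinateSubreps.

(** * Degenerations of subrepresentations *)

Section QGAtlas.
Context (F : fieldType) (n k w : nat).
Local Notation V := 'rV[F]_(n * w).
Local Notation X := (quiver_grassmannian F n w k).
Local Notation SX := (quiver_grassmannian_atlas F n w k).

Lemma basis_plucker (d m : nat) (B : 'M[F]_(d, m)) (W : {vspace 'rV[F]_m}) :
  basis_mx B W -> plucker_coords [set u | u \in W] (fun f => \det (colsub f B)).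
Proof. by move=> [fB WB]; exists B; split. Qed.

Lemma qg_separated (Y : set ('Z_n -> {vspace V})) : separated_by_coords SX Y.
Proof.
move=> [] x U U' _ _ xU xU'; apply: boolp.funext => i; apply/vspaceP => u.
have /seteqP [s1 s2] := plucker_coords_inj (xU i) (xU' i).
by apply/idP/idP => [/s1|/s2].
Qed.

End QGAtlas.

Section Degeneration.
Context (F : numFieldType) (n k w : nat) (n_gt1 : (1 < n)%N).
Local Notation nw := (n * w)%N.
Local Notation V := 'rV[F]_(n * w).
Local Notation arr := (arrow F n w).
Local Notation evec := (evec F n w).
Local Notation X := (quiver_grassmannian F n w k).
Local Notation SX := (quiver_grassmannian_atlas F n w k).
Implicit Types (u v : V) (A : 'Z_n -> 'End(V)) (al : 'Z_n -> nat) (i j l : 'Z_n).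

Lemma qg_subrep al : X (subrep F w al) <-> forall i, nb_pos w al i = (k * w)%N.
Proof.
split=> [[_ H] i|H]; first by rewrite -(H i) subrep_dim.
by split; [exact: subrep_stable | move=> i; rewrite subrep_dim].
Qed.

Lemma qg_aut_act A (U : 'Z_n -> {vspace V}) : is_aut A -> X U -> X (aut_act A U).
Proof.
move=> aA [sU dU]; split; first exact: aut_act_stable.
by move=> i; rewrite aut_act_dim.
Qed.

(** The members of the family are the row spaces of C + b D for fixed matrices C and D,
    so their Pluecker coordinates are polynomials in b. *)
Lemma qg_pencil_limit (Z : set ('Z_n -> {vspace V})) (U : 'Z_n -> {vspace V})
    (A N : 'Z_n -> 'End(V)) :
  closed_in SX X Z -> (forall i, \dim (U i) = (k * w)%N) -> is_aut A ->
  (forall b i u, u + b *: N i u = 0 -> u = 0) ->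
  (forall b, arrow_stable (fun i => (A i @: ((\1 + b *: N i)%VF @: U i))%VS)) ->
  (forall b, b != 0 -> Z (fun i => (A i @: ((\1 + b *: N i)%VF @: U i))%VS)) ->
  Z (fun i => (A i @: U i)%VS).
Proof.
move=> cZ dU aA injN stU ZU.
have /choice [M HM] := fun i => basis_mx_exists (dU i).
pose T b i : 'End(V) := (\1 + b *: N i)%VF.
have appT b i u : T b i u = u + b *: N i u by rewrite add_lfunE id_lfunE scale_lfunE.
have bT b i : basis_mx (M i *m lin1_mx (T b i) *m lin1_mx (A i)) (A i @: (T b i @: U i))%VS.
  apply: basis_mx_img; first by move=> u _; apply: aut_inj.
  by apply: basis_mx_img (HM i) => u _; rewrite appT => /injN.
pose pc (B : 'M[F]_(k * w, nw)) := map_mx polyC B.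
pose C i := M i *m lin1_mx (A i).
pose D i := M i *m lin1_mx (N i) *m lin1_mx (A i).
have EB b i : M i *m lin1_mx (T b i) *m lin1_mx (A i) = C i + b *: D i.
  apply/row_matrixP => r; rewrite linearD linearZ /= /C /D !row_mul !mul_rV_lin1.
  by rewrite /= appT linearD linearZ.
pose x (z : ('Z_n * {ffun 'I_(k * w) -> 'I_nw})%type) : {poly F} :=
  \det (colsub z.2 (pc (C z.1) + 'X *: pc (D z.1))).
have xE b z : (x z).[b] = \det (colsub z.2 (C z.1 + b *: D z.1)).
  rewrite -[LHS]/(horner_eval b _) /x -det_map_mx; congr (\det _).
  by apply/matrixP => r s; rewrite !mxE /= /horner_eval hornerD hornerM hornerX !hornerC.
have U0 i : (A i @: U i = A i @: (T 0 i @: U i))%VS.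
  suff -> : T 0 i = \1%VF by rewrite lim1g.
  by apply/lfunP => u; rewrite appT scale0r addr0 id_lfunE.
have -> : (fun i => A i @: U i)%VS = (fun i => A i @: (T 0 i @: U i))%VS.
  by apply: boolp.funext => i; exact: U0.
apply: (@pencil_limit F _ SX X Z tt x (fun b i => (A i @: (T b i @: U i))%VS)) => //.
- exact: qg_separated.
- by move=> b; split=> [|i]; [exact: stU | exact: (basis_mx_dim (bT b i))].
- move=> b i; have := basis_plucker (bT b i).
  by congr plucker_coords; apply: boolp.funext => f; rewrite xE -EB.
Qed.

(** Let N send e_a in the chain of j to e_(a-d) in the chain of l = j + d.  The family
    (1 + b N) U gives U = subrep al for b = 0.  For b nonzero the vectors
    e_a + b e_(a-d) and e_(a-d) + b^-1 e_a are proportional; the second form shows that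
    (1 + b N) U is the image of subrep al' under the automorphism that adds b^-1 times
    the chain of j to the chain of l.  The bounds on d ensure that the ends of the
    chains fit. *)
Lemma exchange_limit (Z : set ('Z_n -> {vspace V})) al j (d : nat) :
  let l := j + d%:R in
  let al' := fun x => if x == j then (d + al l)%N else if x == l then (al j - d)%N else al x in
  (0 < d < n)%N -> (d <= al j)%N -> (d + al l <= nw)%N -> (al j < d + al l)%N ->
  closed_in SX X Z -> X (subrep F w al) ->
  X (subrep F w al') /\
  ((forall A, is_aut A -> Z (aut_act A (subrep F w al'))) ->
   forall A, is_aut A -> Z (aut_act A (subrep F w al))).
Proof.
move=> l al' /andP[d0 dn] daj dal ajl cZ Xal.
have jl : (j == l) = false.
  apply/negP => /eqP jl; have /(Zn_natr_eq0 n_gt1 dn) : (d%:R : 'Z_n) = 0.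
    by apply: (addrI j); rewrite addr0 [RHS]jl.
  by move=> d00; rewrite d00 in d0.
have lj : (l == j) = false by rewrite eq_sym.
have al'j : al' j = (d + al l)%N by rewrite /al' eqxx.
have al'l : al' l = (al j - d)%N by rewrite /al' lj eqxx.
have al'x x : x != j -> x != l -> al' x = al x by rewrite /al' => /negPf -> /negPf ->.
pose N i : 'End(V) := linfun (mulmxr (\matrix_(a < nw, c < nw)
  ((i - (a : nat)%:R == j) && (a == c + d :> nat)%N)%:R)).
have Nev i (a : nat) : (a < nw)%N ->
    N i (evec a) = if (i - a%:R == j) && (d <= a)%N then evec (a - d) else 0.
  move=> an; apply/rowP => b; rewrite lfunE /= mxE (bigD1 (Ordinal an)) //= big1.
    rewrite !mxE eqxx mul1r addr0; case: (i - a%:R == j); rewrite /= ?mxE //.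
    case: leqP => da; rewrite ?mxE; [|by case: eqP => //; lia].
    by congr (nat_of_bool _)%:R; apply/eqP/eqP; lia.
  move=> a' a'a; have -> : evec a 0 a' = 0; last by rewrite mul0r.
  rewrite mxE; case: eqP => // E.
  by case/eqP: a'a; apply: val_inj.
pose T b i : 'End(V) := (\1 + b *: N i)%VF.
have appT b i u : T b i u = u + b *: N i u by rewrite add_lfunE id_lfunE scale_lfunE.
have chain i (a : nat) : (d <= a)%N -> i - (a - d)%:R = i - a%:R + d%:R.
  by move=> da; rewrite natrB // opprB addrCA addrC.
have chain' i (a : nat) : i - (a + d)%:R + d%:R = i - a%:R.
  by rewrite natrD opprD addrA subrK.
have NN i u : N i (N i u) = 0.
  rewrite (evec_sum u) !linear_sum big1 // => a _; rewrite !linearZ /= Nev //.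
  case: ifP => [/andP[/eqP ia da]|_]; last by rewrite linear0 scaler0.
  rewrite Nev; last by apply: leq_ltn_trans (leq_subr _ _) (ltn_ord a).
  by rewrite chain // ia -/l lj /= scaler0.
(* generators of the automorphism e_a |-> e_a + b^-1 e_(a+d) on the chain of l *)
pose c b x (m : nat) : F := (m == 0%N)%:R + ((x == l) && (m == d))%:R * b^-1.
have aX b : is_aut (aut_of w (c b)).
  apply: aut_of_is_aut => x; rewrite /c eqxx (_ : 0%N == d = false); last by lia.
  by rewrite andbF mul0r addr0 oner_neq0.
have Xev b i (a : nat) : (a < nw)%N ->
    aut_of w (c b) i (evec a) =
    evec a + (if i - a%:R == l then b^-1 else 0) *: evec (a + d).
  move=> an; apply/rowP => e; rewrite aut_of_evec_app // !mxE /c.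
  case: leqP => ae.
    rewrite subn_eq0; have -> : (e <= a)%N = (e == a :> nat)%N by rewrite eqn_leq ae andbT.
    congr (_ + _); have -> : (e - a == d)%N = (e == a + d :> nat)%N by apply/eqP/eqP; lia.
    case: (i - a%:R == l); last by rewrite !mul0r.
    by rewrite mulrC.
  have -> : (e == a :> nat)%N = false by apply/eqP; lia.
  have -> : (e == a + d :> nat)%N = false by apply/eqP; lia.
  by rewrite mulr0 addr0.
have main b i : b != 0 ->
    (T b i @: subrep F w al i)%VS = aut_act (aut_of w (c b)) (subrep F w al') i.
  move=> b0; apply/eqP; rewrite eqEsubv; apply/andP; split; apply: coord_sub_img => a ha.
    rewrite appT Nev //; have [ij|nij] := eqVneq (i - (a : nat)%:R) j.
      rewrite ij in ha; have da : (d <= a)%N by lia.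
      have la : (a - d < nw)%N by apply: leq_ltn_trans (leq_subr _ _) (ltn_ord a).
      rewrite da /=.
      have -> : evec a + b *: evec (a - d) = aut_of w (c b) i (b *: evec (a - d)).
        rewrite linearZ /= Xev // chain // ij eqxx subnK // scalerDr scalerA mulfV //.
        by rewrite scale1r addrC.
      apply: memv_img; apply: memvZ; apply: subrep_evec.
      by rewrite chain // ij -/l al'l; lia.
    rewrite /= scaler0 addr0.
    have [il|nil] := eqVneq (i - (a : nat)%:R) l.
      rewrite il in ha.
      have e1 : evec a \in subrep F w al' i by apply: subrep_evec; rewrite il al'l; lia.
      have iad : i - (a + d)%:R = j by apply: (addIr d%:R); rewrite chain' il.
      have e2 : evec (a + d) \in subrep F w al' i.
        by apply: subrep_evec; rewrite iad al'j; lia.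
      have -> : evec a = aut_of w (c b) i (evec a - b^-1 *: evec (a + d)).
        rewrite linearB linearZ /= Xev // il eqxx.
        have [na|na] := leqP nw (a + d)%N.
          by rewrite (evec_out _ na) !linear0 !addr0.
        by rewrite Xev // iad jl scale0r addr0 addrK.
      by apply: memv_img; rewrite rpredB // memvZ.
    have -> : evec a = aut_of w (c b) i (evec a).
      by rewrite Xev // (negPf nil) scale0r addr0.
    by apply/memv_img/subrep_evec; rewrite al'x.
  rewrite Xev //; have [il|nil] := eqVneq (i - (a : nat)%:R) l.
    rewrite il al'l in ha.
    have iad : i - (a + d)%:R = j by apply: (addIr d%:R); rewrite chain' il.
    have [na|na] := leqP nw (a + d)%N.
      have -> : evec a + b^-1 *: evec (a + d) = T b i (evec a).
        by rewrite (evec_out _ na) scaler0 addr0 appT Nev // il lj scaler0 addr0.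
      by apply/memv_img/subrep_evec; rewrite il; lia.
    have -> : evec a + b^-1 *: evec (a + d) = T b i (b^-1 *: evec (a + d)).
      rewrite appT linearZ /= Nev // iad eqxx leq_addl addnK scalerA mulfV // scale1r.
      by rewrite addrC.
    by apply/memv_img/memvZ/subrep_evec; rewrite iad; lia.
  rewrite scale0r addr0; have [ij|nij] := eqVneq (i - (a : nat)%:R) j.
    rewrite ij al'j in ha; have da : (d <= a)%N by lia.
    have la : (a - d < nw)%N by apply: leq_ltn_trans (leq_subr _ _) (ltn_ord a).
    have -> : evec a = T b i (evec a - b *: evec (a - d)).
      have N2 : N i (evec (a - d)) = 0 by rewrite Nev // chain // ij -/l lj.
      have N1 : N i (evec a) = evec (a - d) by rewrite Nev // ij eqxx da.
      have N3 : N i (evec a - b *: evec (a - d)) = evec (a - d).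
        by rewrite linearB linearZ /= N1 N2 scaler0 subr0.
      by rewrite appT N3 subrK.
    apply: memv_img; apply: rpredB; last apply: memvZ.
      by apply: subrep_evec; rewrite ij; lia.
    by apply: subrep_evec; rewrite chain // ij -/l; lia.
  have -> : evec a = T b i (evec a) by rewrite appT Nev // (negPf nij) scaler0 addr0.
  by apply/memv_img/subrep_evec; rewrite -al'x.
have injT b i u : u + b *: N i u = 0 -> u = 0.
  move=> E; have : T (- b) i (u + b *: N i u) = u.
    by rewrite appT linearD linearZ /= NN scaler0 addr0 scaleNr addrK.
  by rewrite E linear0.
split.
  split=> [|i]; first exact: subrep_stable.
  rewrite -(aut_act_dim _ i (aX 1)) -main ?oner_neq0 // limg_dim_eq; first by case: Xal.
  apply/eqP; rewrite -subv0; apply/subvP => u; rewrite memv_cap memv_ker memv0.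
  by case/andP=> _; rewrite appT => /eqP/injT ->.
move=> ZA A aA.
apply: (@qg_pencil_limit Z (subrep F w al) A N) => //.
- by case: Xal.
- move=> b; apply: (aut_act_stable aA) => //.
  have [->|b0] := eqVneq b 0.
    move=> i; have E x : (\1 + 0 *: N x)%VF = \1%VF :> 'End(V) by rewrite scale0r addr0.
    by rewrite !E !lim1g; apply: subrep_stable.
  have -> : (fun i => (\1 + b *: N i)%VF @: subrep F w al i)%VS =
      aut_act (aut_of w (c b)) (subrep F w al').
    by apply: boolp.funext => i; exact: main.
  by apply: aut_act_stable => //; apply: subrep_stable.
move=> b b0.
have -> : (fun i => A i @: ((\1 + b *: N i)%VF @: subrep F w al i))%VS =
    aut_act (fun i => A i \o aut_of w (c b) i)%VF (subrep F w al').
  by apply: boolp.funext => i; rewrite /aut_act limg_comp; congr (_ @: _)%VS; exact: main.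
apply: ZA => i; split.
  apply/eqP; rewrite -subv0; apply/subvP => u; rewrite memv_ker memv0 comp_lfunE.
  by move=> /eqP /(aut_inj aA) /(aut_inj (aX b)) ->.
by rewrite comp_lfunA (aA i).2 -comp_lfunA (aX b i).2 comp_lfunA.
Qed.

(** Induction on the sum of the squares of al, which is bounded and which every exchange
    increases: if x = al j and y = al l then (y + d)^2 + (x - d)^2 > x^2 + y^2, as
    x < y + d. *)
Lemma degenerate_to_extremal al : (forall j, (al j <= nw)%N) -> X (subrep F w al) ->
  exists be : 'Z_n -> nat, [/\ forall j, be j = 0%N \/ be j = nw,
    X (subrep F w be) &
    forall Z, closed_in SX X Z ->
      (forall A, is_aut A -> Z (aut_act A (subrep F w be))) ->
      forall A, is_aut A -> Z (aut_act A (subrep F w al))].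
Proof.
pose mu (bt : 'Z_n -> nat) := (\sum_j bt j ^ 2)%N.
have mub bt : (forall j, (bt j <= nw)%N) -> (mu bt <= n * nw ^ 2)%N.
  move=> bbt; rewrite -[X in (_ <= X * _)%N](card_Zn n_gt1) -sum_nat_const.
  by apply: leq_sum => j _; rewrite leq_sqr.
have [m] := ubnP (n * nw ^ 2 - mu al)%N; elim: m al => // m IH al ltm bal Xal.
have [ex|nex] := pselect (exists j, strict w al j); last first.
  exists al; split=> // j; have := bal j; rewrite leq_eqVlt => /orP[/eqP|lt]; first by right.
  by left; apply/eqP; rewrite -leqn0 leqNgt; apply/negP => gt; apply: nex; exists j; rewrite /strict gt.
have [j [d [dn daj dal ajl]]] := exchangeable n_gt1 bal (iffLR (qg_subrep al) Xal) ex.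
set l := j + d%:R in dal ajl.
pose al' := fun x => if x == j then (d + al l)%N else if x == l then (al j - d)%N else al x.
have lim Z (cZ : closed_in SX X Z) := exchange_limit dn daj dal ajl cZ Xal.
have [d0 dln] := andP dn.
have lj : l != j.
  apply/eqP => jl; have /(Zn_natr_eq0 n_gt1 dln) : (d%:R : 'Z_n) = 0.
    by apply: (addrI j); rewrite addr0 -/l jl.
  by move=> d00; rewrite d00 in d0.
have Xal' : X (subrep F w al').
  suff cX : closed_in SX X X by exact: (lim X cX).1.
  by split=> // a; exists set0; apply/seteqP; split=> x //= [].
have bal' x : (al' x <= nw)%N.
  by rewrite /al'; case: eqP => // _; case: eqP => // _; apply: leq_trans (leq_subr _ _) (bal j).
have ltmu : (mu al < mu al')%N.
  rewrite /mu (bigD1 j) //= (bigD1 l) //= [X in (_ < X)%N](bigD1 j) //=.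
  rewrite [X in (_ < _ + X)%N](bigD1 l) //= {1}/al' eqxx {1}/al' (negPf lj) eqxx.
  rewrite [X in (_ < _ + (_ + X))%N](eq_bigr (fun x => al x ^ 2)%N); last first.
    by move=> x /andP[xj xl]; rewrite /al' (negPf xj) (negPf xl).
  rewrite !addnA ltn_add2r; have [e Ee] : exists e, al j = (d + e)%N.
    by exists (al j - d)%N; rewrite subnKC.
  by rewrite Ee in ajl *; rewrite addKn !sqrnD; nia.
have [|be [nsb Xb limb]] := IH al' _ bal' Xal'.
  by have := mub al' bal'; lia.
exists be; split=> // Z cZ ZB; apply: (lim Z cZ).2; exact: limb.
Qed.

End Degeneration.

(** * Windows of exponents *)

Section Windows.
Context (F : fieldType).
Local Notation L := (laurent F).
Implicit Types (x y : L) (V : set L).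

(** The coefficients of t^(lo+1), ..., t^(lo+m). *)
Definition wcof (lo : int) (m : nat) x : 'rV[F]_m := \row_c mcoeff (c.+1%:Z + lo) x.

Definition winj (lo : int) (m : nat) (u : 'rV[F]_m) : L :=
  \sum_c u 0 c *: tpow F (c.+1%:Z + lo).

Lemma winj_is_linear lo m : linear (@winj lo m).
Proof.
move=> a u v; rewrite /winj scaler_sumr -big_split; apply: eq_bigr => c _ /=.
by rewrite !mxE scalerDl scalerA.
Qed.

HB.instance Definition _ lo m :=
  GRing.isLinear.Build F 'rV[F]_m L *:%R (@winj lo m) (@winj_is_linear lo m).

Lemma wcof_is_linear lo m : linear (@wcof lo m).
Proof. by move=> a x y; apply/rowP => c; rewrite !mxE mcoeffD mcoeffZ. Qed.

HB.instance Definition _ lo m :=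
  GRing.isLinear.Build F L 'rV[F]_m *:%R (@wcof lo m) (@wcof_is_linear lo m).

Lemma winjK lo m : cancel (@winj lo m) (@wcof lo m).
Proof.
move=> u; apply/rowP => a; rewrite mxE /winj [LHS]mcoeff_sum (bigD1 a) //=.
rewrite mcoeffZ mcoeff_tpow eqxx mulr1 big1 ?addr0 // => c ca.
rewrite mcoeffZ mcoeff_tpow; case: eqP => [E|]; last by rewrite mulr0.
by case/eqP: ca; apply: val_inj => /=; lia.
Qed.

Lemma winj_top lo m (u : 'rV[F]_m) : tspan (lo + m%:Z) (winj lo u).
Proof.
apply: tspan_sum => c _; apply: tspanZ; apply/tspan_tpow.
by have := ltn_ord c; lia.
Qed.

Lemma wcof_eq0 lo m x : tspan lo x -> wcof lo m x = 0.
Proof. by move=> /tspanP H; apply/rowP => c; rewrite !mxE H //; lia. Qed.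

Lemma wcof_eq0_bot lo m x : tspan (lo + m%:Z) x -> wcof lo m x = 0 -> tspan lo x.
Proof.
move=> /tspanP xt x0; apply/tspanP => l bl.
have [tl|lt] := ltP (lo + m%:Z) l; first exact: xt.
have hc : (`|(l - lo - 1)%R| < m)%N by lia.
have := congr1 (fun r : 'rV[F]_m => r 0 (Ordinal hc)) x0; rewrite !mxE /= => <-.
by congr mcoeff; lia.
Qed.

Lemma wcof_decomp lo m x : tspan (lo + m%:Z) x -> tspan lo (x - winj lo (wcof lo m x)).
Proof.
move=> xt; apply: (@wcof_eq0_bot _ m).
  by apply: tspanB => //; apply: winj_top.
by rewrite linearB /= winjK subrr.
Qed.

Lemma subspace_modP V lo x y : subspace V -> tspan lo `<=` V -> tspan lo (x - y) ->
  V x <-> V y.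
Proof.
move=> sV bV xy; split=> H.
  by rewrite -(subKr x y); apply: subspaceB => //; apply: bV.
by rewrite -(subrK y x); apply: subspaceD => //; apply: bV.
Qed.

Definition set_basis (d m : nat) (B : 'M[F]_(d, m)) (W : set 'rV[F]_m) : Prop :=
  row_free B /\ forall u, W u <-> (u <= B)%MS.

Lemma set_basis_plucker (d m : nat) (B : 'M[F]_(d, m)) (W : set 'rV[F]_m) :
  set_basis B W -> plucker_coords W (fun f => \det (colsub f B)).
Proof. by move=> [fB WB]; exists B; split. Qed.

Lemma set_basis_size (d d' m : nat) (B : 'M[F]_(d, m)) (B' : 'M[F]_(d', m))
    (W : set 'rV[F]_m) : set_basis B W -> set_basis B' W -> d = d'.
Proof.
move=> [fB WB] [fB' WB']; rewrite -(eqP fB') -(eqP fB); apply/eqP.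
rewrite eqn_leq !mxrankS //; apply/rV_subP => u.
  by move=> h; apply/WB/WB'.
by move=> h; apply/WB'/WB.
Qed.

Lemma set_basis_cast (d d' m : nat) (e : d = d') (B : 'M[F]_(d, m)) (W : set 'rV[F]_m) :
  set_basis B W -> set_basis (castmx (e, erefl) B) W.
Proof. by subst d'; rewrite castmx_id. Qed.

Section Extension.
Context (a m M : nat) (e : 'I_m -> 'I_M).
Context (e_inj : injective e).
Context (e_ge : forall r, (a <= e r)%N).
Context (e_lt : forall r, (e r < a + m)%N).
Context (e_img : forall c : 'I_M, (a <= c < a + m)%N -> exists r, e r = c).

Definition ext_top : 'M[F]_(a, M) := \matrix_(r, c) (c == r :> nat)%:R.
Definition ext_place : 'M[F]_(m, M) := \matrix_(r, c) (c == e r)%:R.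
(** A basis of a space between t^(lo+a) F[t^-1] and t^(lo+a+m) F[t^-1], modulo
    t^lo F[t^-1]: the first a monomials and a basis modulo t^(lo+a) F[t^-1]. *)
Definition ext_mx (d : nat) (B : 'M[F]_(d, m)) : 'M[F]_(a + d, M) :=
  col_mx ext_top (B *m ext_place).

Lemma mul_ext_placeE (u : 'rV[F]_m) r : (u *m ext_place) 0 (e r) = u 0 r.
Proof.
rewrite mxE (bigD1 r) //= mxE eqxx mulr1 big1 ?addr0 // => r' r'r.
by rewrite mxE (inj_eq e_inj) eq_sym (negPf r'r) mulr0.
Qed.

Lemma mul_ext_place_out (u : 'rV[F]_m) (c : 'I_M) : ~ (exists r, e r = c) ->
  (u *m ext_place) 0 c = 0.
Proof.
move=> nc; rewrite mxE big1 // => r _; rewrite mxE.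
by case: eqP => [E|]; [case: nc; exists r | rewrite mulr0].
Qed.

Lemma mul_ext_topE (u : 'rV[F]_a) (c : 'I_M) (r : 'I_a) : c = r :> nat ->
  (u *m ext_top) 0 c = u 0 r.
Proof.
move=> cr; rewrite mxE (bigD1 r) //= mxE cr eqxx mulr1 big1 ?addr0 // => r' r'r.
by rewrite mxE cr eq_sym (inj_eq val_inj) (negPf r'r) mulr0.
Qed.

Lemma mul_ext_top_out (u : 'rV[F]_a) (c : 'I_M) : (a <= c)%N -> (u *m ext_top) 0 c = 0.
Proof.
move=> ac; rewrite mxE big1 // => r _; rewrite mxE.
by case: eqP => [E|]; [have := ltn_ord r; lia | rewrite mulr0].
Qed.

Context (a_le : (a <= M)%N).

Lemma ext_mx_basis (V : set L) (lo : int) (d : nat) (B : 'M[F]_(d, m)) :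
  subspace V -> tspan (lo + a%:Z) `<=` V -> V `<=` tspan (lo + (a + m)%N%:Z) ->
  set_basis B [set u | V (winj lo (u *m ext_place))] ->
  set_basis (ext_mx B) [set u | V (winj lo u)].
Proof.
move=> sV bV Vt [fB WB].
have mulE (al : 'rV_(a + d)) : al *m ext_mx B =
    lsubmx al *m ext_top + rsubmx al *m B *m ext_place.
  by rewrite -{1}[al]hsubmxK mul_row_col mulmxA.
split.
  apply: inj_row_free => al; rewrite mulE => E.
  have l0 : lsubmx al = 0.
    apply/rowP => r; have rM : (r < M)%N by apply: leq_trans (ltn_ord r) a_le.
    have := congr1 (fun u : 'rV[F]_M => u 0 (Ordinal rM)) E.
    rewrite mxE (@mul_ext_topE _ _ r) // mul_ext_place_out ?addr0 ?mxE //.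
    by case=> r' E'; have := e_ge r'; rewrite E' /= leqNgt ltn_ord.
  have r0 : rsubmx al = 0.
    apply: (row_free_inj fB); rewrite mul0mx; apply/rowP => r.
    rewrite -mul_ext_placeE; have := congr1 (fun u : 'rV[F]_M => u 0 (e r)) E.
    by rewrite mxE l0 mul0mx mxE add0r !mxE => ->.
  by rewrite -[al]hsubmxK l0 r0 row_mx0.
move=> u; split=> [Vu|/submxP [al ->]]; last first.
  rewrite mulE /= linearD /=; apply: subspaceD => //; last by apply/WB; apply: submxMl.
  apply: bV; apply: tspan_sum => c _; have [ca|ac] := ltnP c a.
    by apply: tspanZ; apply/tspan_tpow; lia.
  by rewrite mul_ext_top_out // scale0r; apply: (tspan_subspace _ _).1.
pose v : 'rV[F]_m := \row_r u 0 (e r).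
pose s : 'rV[F]_a := \row_r u 0 (widen_ord a_le r).
have Eu : u = s *m ext_top + v *m ext_place.
  apply/rowP => c; rewrite mxE; have [ca|ac] := ltnP c a.
    rewrite (@mul_ext_topE _ _ (Ordinal ca)) // mul_ext_place_out ?addr0.
      by rewrite mxE; congr (u 0 _); apply: val_inj.
    by case=> r E; have := e_ge r; rewrite E leqNgt ca.
  rewrite mul_ext_top_out // add0r; have [cm|mc] := ltnP c (a + m).
    have [|r <-] := @e_img c; first by rewrite ac cm.
    by rewrite mul_ext_placeE mxE.
  rewrite mul_ext_place_out; last by case=> r E; have := e_lt r; rewrite E ltnNge mc.
  have Wc : wcof lo M (winj lo u) 0 c = u 0 c by rewrite winjK.
  by rewrite -Wc mxE; apply: (iffLR (tspanP _ _) (Vt _ Vu)); lia.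
have Vs : V (winj lo (s *m ext_top)).
  apply: bV; apply: tspan_sum => c _; have [ca|ac] := ltnP c a.
    by apply: tspanZ; apply/tspan_tpow; lia.
  by rewrite mul_ext_top_out // scale0r; apply: (tspan_subspace _ _).1.
have /WB/submxP [al Ev] : V (winj lo (v *m ext_place)).
  have -> : winj lo (v *m ext_place) = winj lo u - winj lo (s *m ext_top).
    by rewrite {1}Eu linearD /= addrAC subrr add0r.
  exact: subspaceB.
apply/submxP; exists (row_mx s al); rewrite mul_row_col mulmxA -Ev; exact: Eu.
Qed.

(** Choosing the first a columns, and then the columns in which f is placed, gives a
    block matrix with an identity block. *)
Lemma ext_mx_select (d : nat) (f : {ffun 'I_d -> 'I_m}) :
  exists f' : {ffun 'I_(a + d) -> 'I_M}, forall B : 'M[F]_(d, m),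
    \det (colsub f' (ext_mx B)) = \det (colsub f B).
Proof.
exists [ffun r => match split r with inl c => widen_ord a_le c | inr c => e (f c) end] => B.
rewrite -[RHS]mul1r -(det1 F a) -(det_ublock _ 0); congr (\det _).
apply/matrixP => r c; rewrite !mxE ffunE; case: (splitP r) => r' Er; rewrite !mxE; case: (splitP c) => c' Ec; rewrite !mxE.
- by congr (nat_of_bool _)%:R; apply/eqP/eqP => [E|->//]; apply: val_inj.
- by case: eqP => // E; have := e_ge (f c'); have := ltn_ord r'; rewrite E; lia.
- apply: big1 => l _; rewrite mxE; case: eqP => [E|]; last by rewrite mulr0.
  by have := e_ge l; rewrite -E /= leqNgt ltn_ord.
- rewrite (bigD1 (f c')) //= mxE eqxx mulr1 big1 ?addr0 // => l lf.
  by rewrite mxE (inj_eq e_inj) eq_sym (negPf lf) mulr0.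
Qed.

End Extension.

Lemma set_basis_of_quot_dim V (N d : nat) : subspace V ->
  tspan (- N%:Z) `<=` V -> V `<=` tspan N%:Z -> quot_dim V (tspan (- N%:Z)) d ->
  exists B : 'M[F]_(d, N + N), set_basis B [set u | V (winj (- N%:Z) u)].
Proof.
move=> sV bV Vt [b [Vb Hb]].
have NN : - N%:Z + (N + N)%N%:Z = N%:Z by lia.
pose B := \matrix_(r < d) wcof (- N%:Z) (N + N) (b r).
have mulB (c : 'rV_d) : c *m B = wcof (- N%:Z) (N + N) (\sum_r c 0 r *: b r).
  rewrite mulmx_sum_row linear_sum; apply: eq_bigr => r _.
  by rewrite rowK linearZ.
have Vsum (c : 'I_d -> F) : V (\sum_r c r *: b r).
  by apply: subspace_sum => // r _; apply: subspaceZ.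
have tN x : V x -> tspan (- N%:Z + (N + N)%N%:Z) x by rewrite NN; apply: Vt.
exists B; split.
  apply: inj_row_free => c; rewrite mulB => /(wcof_eq0_bot (tN _ (Vsum _))) E.
  have [c0 [_ uc]] := Hb 0 sV.1.
  have E1 : c0 = (fun r => - c 0 r).
    apply: uc; rewrite sub0r -sumrN; under eq_bigr do rewrite scaleNr opprK.
    exact: E.
  have E2 : c0 = (fun=> 0).
    by apply: uc; rewrite big1 ?subr0 => [|r _]; [apply: (tspan_subspace _ _).1 | rewrite scale0r].
  apply/rowP => r; rewrite mxE; apply: oppr_inj; rewrite oppr0.
  by have := congr1 (fun f => f r) (etrans (esym E1) E2).
move=> u; split=> [Vu|/submxP [c ->]].
  have [c [Ec _]] := Hb _ Vu; apply/submxP; exists (\row_r c r).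
  rewrite mulB; under eq_bigr do rewrite mxE.
  by have := wcof_eq0 (N + N) Ec; rewrite linearB /= winjK => /eqP; rewrite subr_eq0 => /eqP.
rewrite mulB /=; exact: (iffLR (subspace_modP sV bV (wcof_decomp (tN _ (Vsum _)))) (Vsum _)).
Qed.

Lemma quot_dim_of_set_basis V (N d : nat) (B : 'M[F]_(d, N + N)) : subspace V ->
  tspan (- N%:Z) `<=` V -> V `<=` tspan N%:Z ->
  set_basis B [set u | V (winj (- N%:Z) u)] -> quot_dim V (tspan (- N%:Z)) d.
Proof.
move=> sV bV Vt [fB WB].
have NN : - N%:Z + (N + N)%N%:Z = N%:Z by lia.
exists (fun r => winj (- N%:Z) (row r B)); split.
  by move=> r; apply/WB; apply: row_sub.
have sumE (c : 'I_d -> F) : \sum_r c r *: winj (- N%:Z) (row r B) =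
    winj (- N%:Z) ((\row_r c r) *m B).
  rewrite mulmx_sum_row linear_sum; apply: eq_bigr => r _.
  by rewrite linearZ /= mxE.
move=> x Vx; have xt : tspan (- N%:Z + (N + N)%N%:Z) x by rewrite NN; apply: Vt.
have /WB/submxP [c Ec] : V (winj (- N%:Z) (wcof (- N%:Z) (N + N) x)).
  exact: (iffLR (subspace_modP sV bV (wcof_decomp xt)) Vx).
exists (fun r => c 0 r); split.
  rewrite sumE (_ : \row_r c 0 r = c); last by apply/rowP => r; rewrite mxE.
  by rewrite -Ec; apply: wcof_decomp.
move=> c'; rewrite sumE => E; apply: boolp.funext => r.
have : (\row_r c' r) *m B = c *m B.
  have := wcof_eq0 (N + N) E; rewrite linearB /= winjK Ec => /eqP.
  by rewrite subr_eq0 => /eqP.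
by move/(row_free_inj fB) => <-; rewrite mxE.
Qed.

(** A subspace of maximal dimension contained in W is all of W. *)
Lemma vspace_of_set (m : nat) (W : set 'rV[F]_m) : W 0 ->
  (forall a u v, W u -> W v -> W (a *: u + v)) ->
  exists U : {vspace 'rV[F]_m}, forall u, u \in U <-> W u.
Proof.
move=> W0 WD.
pose P d := `[< exists U : {vspace 'rV[F]_m}, (forall u, u \in U -> W u) /\ \dim U = d >].
have exP : exists d, P d.
  exists 0%N; apply/asboolP; exists 0%VS; rewrite dimv0; split=> // u.
  by rewrite memv0 => /eqP ->.
have ubP d : P d -> (d <= \dim {:'rV[F]_m})%N.
  by move/asboolP => [U [_ <-]]; apply: dimvS; apply: subvf.
case: (ex_maxnP exP ubP) => d /asboolP [U [UW dU]] maxd.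
exists U => u; split; first exact: UW.
move=> Wu; apply/negPn/negP => uU.
have : P (\dim (U + <[u]>)%VS).
  apply/asboolP; exists (U + <[u]>)%VS; split=> // v /memv_addP [x xU [y]].
  by case/vlineP => c -> ->; rewrite addrC; apply: WD => //; apply: UW.
move/maxd; rewrite leqNgt -dU => /negP; apply.
by rewrite (ltn_leqif (dimv_leqif_sup (addvSl _ _))) subv_add subvv /= -memvE.
Qed.

End Windows.

(** * Flags in windows *)

Section Placements.
Context (F : fieldType).
Local Notation L := (laurent F).

Lemma window_incl (V V' : set L) (lo : int) (m : nat) :
  subspace V -> tspan lo `<=` V -> V `<=` tspan (lo + m%:Z) ->
  subspace V' -> tspan lo `<=` V' ->
  (forall u : 'rV[F]_m, V (winj lo u) -> V' (winj lo u)) -> V `<=` V'.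
Proof.
move=> sV bV Vt sV' bV' H x Vx; have d := wcof_decomp (Vt _ Vx).
apply: (iffRL (subspace_modP sV' bV' d)); apply: H.
exact: (iffLR (subspace_modP sV bV d)).
Qed.

Lemma winj_place (m M : nat) (e : 'I_m -> 'I_M) (lo : int) (u : 'rV[F]_m) :
  winj lo (u *m ext_place F e) = \sum_r u 0 r *: tpow F ((e r).+1%:Z + lo).
Proof.
rewrite /winj; under eq_bigr => c _ do rewrite mxE scaler_suml.
rewrite exchange_big /=; apply: eq_bigr => r _.
rewrite (bigD1 (e r)) //= mxE eqxx mulr1 big1 ?addr0 // => c ce.
by rewrite mxE (negPf ce) mulr0 scale0r.
Qed.

Lemma shift_ord_subproof (a m M : nat) (h : (a + m <= M)%N) (r : 'I_m) : (a + r < M)%N.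
Proof. by apply: leq_trans h; rewrite ltn_add2l. Qed.

Definition shift_ord (a m M : nat) (h : (a + m <= M)%N) (r : 'I_m) : 'I_M :=
  Ordinal (shift_ord_subproof h r).

Lemma window_enlarge (V : set L) (N N' d : nat) (hN : (N' - N + (N + N) <= N' + N')%N)
    (B : 'M[F]_(d, N + N)) :
  (N <= N')%N -> subspace V -> tspan (- N%:Z) `<=` V -> V `<=` tspan N%:Z ->
  set_basis B [set u | V (winj (- N%:Z) u)] ->
  set_basis (ext_mx (N' - N) (shift_ord hN) B) [set u | V (winj (- N'%:Z) u)].
Proof.
move=> NN sV bV Vt HB; apply: ext_mx_basis => //.
- by move=> r r' [/addnI/val_inj].
- by move=> r; rewrite leq_addr.
- by move=> r; rewrite ltn_add2l.
- move=> c /andP[c1 c2]; have h : (c - (N' - N) < N + N)%N by rewrite ltn_subLR.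
  by exists (Ordinal h); apply: val_inj; rewrite /= subnKC.
- lia.
- by apply: subset_trans bV => x; apply: tspan_le; lia.
- by apply: subset_trans Vt _ => x; apply: tspan_le; lia.
case: HB => fB WB; split=> // u; rewrite -WB /= winj_place /winj.
suff -> : \sum_r u 0 r *: tpow F ((shift_ord hN r).+1%:Z - N'%:Z) =
  \sum_c u 0 c *: tpow F (c.+1%:Z - N%:Z) by [].
by apply: eq_bigr => r _ /=; congr (_ *: tpow F _); lia.
Qed.

Lemma window_enlarge_size (N N' : nat) : (N <= N')%N -> (N' - N + (N + N) <= N' + N')%N.
Proof. lia. Qed.

(** The number N0 in the definition of the Sato Grassmannian is not under control; the
    dimensions are compared in a window that contains those of N and N0. *)
Lemma sato_basis (i : int) (V : set L) (N d : nat) : sato i V ->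
  tspan (- N%:Z) `<=` V -> V `<=` tspan N%:Z -> d%:Z = i + N%:Z ->
  exists B : 'M[F]_(d, N + N), set_basis B [set u | V (winj (- N%:Z) u)].
Proof.
move=> [sV [N0 [bV0 Vt0 [d0 Ed0 qd0]]]] bV Vt Ed.
have [B0 HB0] := set_basis_of_quot_dim sV bV0 Vt0 qd0.
have [||U HU] := @vspace_of_set F (N + N) [set u | V (winj (- N%:Z) u)].
- by rewrite /= linear0; case: sV.
- by move=> a u v /= Vu Vv; rewrite linearP; apply: sV.2.
have [B [fB WB]] := basis_mx_exists (erefl (\dim U)).
have HB : set_basis B [set u | V (winj (- N%:Z) u)].
  by split=> // u; rewrite -WB; apply: iff_sym; exact: HU.
pose N' := maxn N N0.
have h : (N <= N')%N by rewrite leq_maxl.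
have h0 : (N0 <= N')%N by rewrite leq_maxr.
have H1 := window_enlarge (window_enlarge_size h) h sV bV Vt HB.
have H0 := window_enlarge (window_enlarge_size h0) h0 sV bV0 Vt0 HB0.
have E := set_basis_size H1 H0.
have dE : \dim U = d by lia.
by exists (castmx (dE, erefl) B); apply: set_basis_cast.
Qed.

End Placements.

Section AffineSide.
Context (F : numFieldType) (n k w : nat).
Local Notation nw := (n * w)%N.
Local Notation L := (laurent F).
Local Notation V := 'rV[F]_(n * w).
Local Notation X := (quiver_grassmannian F n w k).
Local Notation SX := (quiver_grassmannian_atlas F n w k).
Local Notation AF := (affine_flag F n).
Local Notation SAF := (affine_flag_atlas F n).
Local Notation top i := (i - (k * w)%:Z + (n * w)%:Z).
Local Notation bot i := (i - (k * w)%:Z).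
Local Notation Ps := (Psi F n k w).
Implicit Types (i : int) (S : set L) (U : 'Z_n -> {vspace V}) (Vf : int -> set L).

(** psi^(i) lists the exponents in decreasing order and windows in increasing order,
    whence the reversal. *)
Lemma psi_window (S : set L) i (N a d : nat) (h : (a + nw <= N + N)%N) (B : 'M[F]_(d, nw)) :
  a%:Z = bot i + N%:Z -> subspace S -> tspan (bot i) `<=` S -> S `<=` tspan (top i) ->
  set_basis B [set u | S (psi k i u)] ->
  set_basis (ext_mx a (shift_ord h \o @rev_ord nw) B) [set u | S (winj (- N%:Z) u)].
Proof.
move=> Ea sS bS St HB; apply: ext_mx_basis => //.
- by move=> r r' [/addnI E]; apply: rev_ord_inj; apply: val_inj.
- by move=> r; rewrite leq_addr.
- by move=> r; rewrite ltn_add2l ltn_ord.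
- move=> c /andP[c1 c2]; have hc : (c - a < nw)%N by rewrite ltn_subLR.
  by exists (rev_ord (Ordinal hc)); apply: val_inj => /=; move: hc c1; lia.
- by apply: leq_trans h; rewrite leq_addr.
- by apply: subset_trans bS => x; apply: tspan_le; lia.
- by apply: subset_trans St _ => x; apply: tspan_le; lia.
case: HB => fB WB; split=> // u; rewrite -WB /= winj_place /psi.
suff -> : \sum_r u 0 r *: tpow F (((shift_ord h \o @rev_ord nw) r).+1%:Z - N%:Z) =
  \sum_a u 0 a *: tpow F (i - (k * w)%:Z + (nw%:Z - a%:Z)) by [].
apply: eq_bigr => r _ /=; congr (_ *: tpow F _); have := ltn_ord r.
set q := (nw - r.+1)%N; have : (q + r.+1 = nw)%N by rewrite subnK.
by lia.
Qed.

Lemma Psi_subspace U i : subspace (Ps U i).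
Proof.
split=> [|a x y /PsiP[xt xU] /PsiP[yt yU]]; apply/PsiP.
  by rewrite linear0 mem0v; split=> //; apply: (tspan_subspace _ _).1.
split; first by apply: tspanD => //; apply: tspanZ.
by rewrite linearP memvD // memvZ.
Qed.

Lemma Psi_bot U i : tspan (bot i) `<=` Ps U i.
Proof.
move=> x xb; apply/PsiP; rewrite trunc_eq0 // mem0v; split=> //.
by apply: tspan_le xb; lia.
Qed.

Lemma Psi_top U i : Ps U i `<=` tspan (top i).
Proof. by move=> x /PsiP[]. Qed.

Lemma Psi_psi U i u : Ps U i (psi k i u) <-> u \in U i%:~R.
Proof. by rewrite PsiP psiK; split=> [[]|uU] //; split=> //; apply: psi_top. Qed.

Lemma Psi_affine_flag U : (1 < n)%N -> X U -> AF (Ps U).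
Proof.
move=> n_gt1 [sU dU]; split=> [i|i|i].
- split; first exact: Psi_subspace.
  (* any N with -N <= i - kw and i - kw + nw <= N will do *)
  pose N := (`|i| + k * w + n * w)%N; pose a := absz (bot i + N%:Z).
  have Ea : a%:Z = bot i + N%:Z by rewrite /a /N; lia.
  have h : (a + nw <= N + N)%N by rewrite /N in Ea *; lia.
  have b1 : tspan (- N%:Z) `<=` Ps U i.
    by apply: subset_trans (@Psi_bot U i) => x; apply: tspan_le; lia.
  have t1 : Ps U i `<=` tspan N%:Z.
    by apply: subset_trans (@Psi_top U i) _ => x; apply: tspan_le; lia.
  exists N; split=> //.
  have [B [fB WB]] := basis_mx_exists (dU i%:~R).
  have HB : set_basis B [set u | Ps U i (psi k i u)].
    by split=> // u; rewrite -WB; exact: Psi_psi.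
  have HC := psi_window h Ea (Psi_subspace U i) (@Psi_bot U i) (@Psi_top U i) HB.
  exists (a + k * w)%N; first by lia.
  exact: quot_dim_of_set_basis (Psi_subspace U i) b1 t1 HC.
- move=> x /PsiP[xt xU]; apply/PsiP; split; first by apply: tspan_le xt; lia.
  by rewrite -arrow_trunc // intrD; apply/(subvP (sU _))/memv_img.
apply/seteqP; split=> x.
  case/PsiP => xt xU; exists (tmul (- n%:Z) x); last by rewrite tmul_tmul subrr tmul0.
  apply/PsiP; split.
    have := tspan_tmul (a := - n%:Z) xt; apply: tspan_le; lia.
  by rewrite -trunc_shift tmul_tmul subrr tmul0 -(Zn_intrDn i n_gt1).
case=> y /PsiP[yt yU] <-; apply/PsiP; split.
  have := tspan_tmul (a := n%:Z) yt; apply: tspan_le; lia.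
by rewrite trunc_shift Zn_intrDn.
Qed.

Lemma flag_shift Vf i (q : int) x : AF Vf -> Vf (i + n%:Z * q) x <-> Vf i (tmul (- (n%:Z * q)) x).
Proof.
case=> _ _ per.
have H (m : nat) j y : Vf (j + n%:Z * m%:Z) y <-> Vf j (tmul (- (n%:Z * m%:Z)) y).
  elim: m y => [|m IH] y; first by rewrite mulr0 addr0 oppr0 tmul0.
  have -> : j + n%:Z * m.+1%:Z = j + n%:Z * m%:Z + n%:Z by lia.
  rewrite per; have E : tmul (- (n%:Z * m.+1%:Z)) y = tmul (- (n%:Z * m%:Z)) (tmul (- n%:Z) y).
    by rewrite tmul_tmul; congr tmul; lia.
  rewrite E -IH; split=> [[z Vz <-]|Vy].
    by rewrite tmul_tmul addNr tmul0.
  by exists (tmul (- n%:Z) y) => //; rewrite tmul_tmul subrr tmul0.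
case: q => q; first exact: H.
rewrite NegzE mulrN opprK; have := H q.+1 (i - n%:Z * q.+1%:Z) (tmul (n%:Z * q.+1%:Z) x).
by rewrite subrK tmul_tmul addNr tmul0 => ->.
Qed.

Lemma int_decomp1 i : (1 < n)%N -> exists r : 'I_n, exists q : int, i = r.+1%:Z + n%:Z * q.
Proof.
move=> n_gt1; have [q E] := Zn_int_repr (i - 1) n_gt1.
have h : (val ((i - 1)%:~R : 'Z_n) < n)%N.
  by rewrite -[X in (_ < X)%N](Zp_cast n_gt1) ltn_ord.
move: (val _) h E => v h E.
by exists (Ordinal h), q => /=; lia.
Qed.

(** Coordinates on a piece only see the spaces V_1, ..., V_n, but these determine the
    others by periodicity. *)
Lemma flag_separated : (1 < n)%N -> separated_by_coords SAF AF.
Proof.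
move=> n_gt1 N y Vf Vf' aV aV' yV yV'.
have E (r : 'I_n) : Vf r.+1%:Z = Vf' r.+1%:Z.
  have [bV Vt pV] := yV r; have [bV' Vt' pV'] := yV' r.
  have [[sV _] [sV' _]] : sato r.+1%:Z (Vf r.+1%:Z) /\ sato r.+1%:Z (Vf' r.+1%:Z).
    by split; [case: aV | case: aV'].
  have W := plucker_coords_inj pV pV'.
  have NN : - N%:Z + (N + N)%N%:Z = N%:Z by lia.
  have W' (u : 'rV[F]_(N + N)) : Vf r.+1%:Z (winj (- N%:Z) u) <-> Vf' r.+1%:Z (winj (- N%:Z) u).
    by have /seteqP[s1 s2] := W; split=> [/s1|/s2].
  rewrite -NN in Vt Vt'; apply/seteqP; split.
    by apply: (window_incl sV bV Vt sV' bV') => u; apply: (iffLR (W' u)).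
  by apply: (window_incl sV' bV' Vt' sV bV) => u; apply: (iffRL (W' u)).
apply: boolp.funext => i; have [r [q ->]] := int_decomp1 i n_gt1.
by apply/seteqP; split=> x; rewrite !flag_shift // E.
Qed.

End AffineSide.

(** * The quiver Grassmannian as a set of bounded flags *)

Section Sandwich.
Context (F : numFieldType) (n k w : nat) (n_gt1 : (1 < n)%N).
Local Notation nw := (n * w)%N.
Local Notation L := (laurent F).
Local Notation V := 'rV[F]_(n * w).
Local Notation X := (quiver_grassmannian F n w k).
Local Notation SX := (quiver_grassmannian_atlas F n w k).
Local Notation AF := (affine_flag F n).
Local Notation SAF := (affine_flag_atlas F n).
Local Notation top i := (i - (k * w)%:Z + (n * w)%:Z).
Local Notation bot i := (i - (k * w)%:Z).
Local Notation Ps := (Psi F n k w).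
Implicit Types (i : int) (U : 'Z_n -> {vspace V}) (Vf : int -> set L).

Definition bounded_flags : set (int -> set L) :=
  [set Vf | AF Vf /\ forall r : 'I_n,
     tspan (bot r.+1%:Z) `<=` Vf r.+1%:Z /\ Vf r.+1%:Z `<=` tspan (top r.+1%:Z)].
Local Notation Q := bounded_flags.

Lemma bounded_flagP Vf i : Q Vf -> tspan (bot i) `<=` Vf i /\ Vf i `<=` tspan (top i).
Proof.
move=> [aV H]; have [r [q ->]] := int_decomp1 i n_gt1; have [H1 H2] := H r.
split=> x.
  move=> xb; apply/flag_shift => //; apply: H1.
  have := tspan_tmul (a := - (n%:Z * q)) xb; apply: tspan_le; lia.
move/flag_shift => /(_ aV) /H2 xt.
have := tspan_tmul (a := n%:Z * q) xt; rewrite tmul_tmul subrr tmul0.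
by apply: tspan_le; lia.
Qed.

Lemma flag_subspace Vf i : AF Vf -> subspace (Vf i).
Proof. by case=> H _ _; case: (H i). Qed.

Lemma Psi_bounded U : X U -> Q (Ps U).
Proof.
move=> XU; split; first exact: Psi_affine_flag.
by move=> r; split; [exact: Psi_bot | exact: Psi_top].
Qed.

(** The preimage of V_i under psi^(i), at the representative of the vertex in
    0, ..., n-1; any representative gives the same, by [Psi_inv_int]. *)
Definition Psi_inv Vf : 'Z_n -> {vspace V} := fun j =>
  xget 0%VS [set W : {vspace V} | forall u, u \in W <-> Vf (j : nat)%:Z (psi k (j : nat)%:Z u)].

Lemma Psi_invE Vf (j : 'Z_n) u : AF Vf ->
  u \in Psi_inv Vf j <-> Vf (j : nat)%:Z (psi k (j : nat)%:Z u).
Proof.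
move=> aV; have sV := flag_subspace (j : nat)%:Z aV.
have [||W HW] := @vspace_of_set F nw [set u | Vf (j : nat)%:Z (psi k (j : nat)%:Z u)].
- by rewrite /= linear0; case: sV.
- by move=> a x y /= Vx Vy; rewrite linearP; apply: sV.2.
by have /= := @xgetPex _ 0%VS [set W : {vspace V} | forall u, u \in W <-> Vf (j : nat)%:Z (psi k (j : nat)%:Z u)] (ex_intro _ W HW); apply.
Qed.

Lemma Psi_inv_int Vf i u : AF Vf -> u \in Psi_inv Vf i%:~R <-> Vf i (psi k i u).
Proof.
move=> aV; rewrite Psi_invE //; have [q E] := Zn_int_repr i n_gt1.
rewrite {3 4}E psi_shift flag_shift // tmul_tmul addNr tmul0 //.
Qed.

Lemma Psi_invK U : X U -> Psi_inv (Ps U) = U.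
Proof.
move=> XU; have aP := Psi_affine_flag n_gt1 XU; apply: boolp.funext => j.
apply/vspaceP => u; apply/idP/idP.
  by move/(Psi_invE j u aP)/Psi_psi; rewrite -pmulrn natr_Zp.
by move=> uU; apply/(Psi_invE j u aP)/Psi_psi; rewrite -pmulrn natr_Zp.
Qed.

Lemma Psi_inv_basis Vf (r : 'I_n) (N d : nat) (h : (absz (bot r.+1%:Z + N%:Z)%R + nw <= N + N)%N)
    (B : 'M[F]_(d, nw)) : Q Vf -> (k * w <= N)%N -> basis_mx B (Psi_inv Vf r.+1%:Z%:~R) ->
  set_basis (ext_mx (absz (bot r.+1%:Z + N%:Z)%R) (shift_ord h \o @rev_ord nw) B)
    [set u | Vf r.+1%:Z (winj (- N%:Z) u)].
Proof.
move=> QV hN [fB WB]; have [aV _] := QV; have [bV Vt] := bounded_flagP r.+1%:Z QV.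
apply: (@psi_window F n k w _ r.+1%:Z) => //; [by lia | exact: flag_subspace | split=> // u].
by rewrite -WB; apply: iff_sym; apply: Psi_inv_int.
Qed.

(** The dimension is found by adding the powers of t up to t^(i-kw) to a basis of the
    preimage and comparing with the dimension that the Sato Grassmannian prescribes. *)
Lemma Psi_inv_qg Vf : Q Vf -> X (Psi_inv Vf).
Proof.
move=> QV; have [aV _] := QV; split=> j.
  apply/subvP => _ /memv_imgP [u /(Psi_invE j u aV) uU ->].
  have -> : j + 1 = ((j : nat)%:Z + 1)%:~R :> 'Z_n by rewrite intrD -pmulrn natr_Zp.
  apply/Psi_inv_int => //.
  have sV := flag_subspace ((j : nat)%:Z + 1) aV.
  have [bV _] := bounded_flagP ((j : nat)%:Z + 1) QV.
  apply: (iffLR (subspace_modP sV bV (psi_arrow (k := k) (i := (j : nat)%:Z) u))).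
  by case: aV => _ mono _; apply: mono.
have [r [q E]] := int_decomp1 (j : nat)%:Z n_gt1.
have Ej : j = r.+1%:Z%:~R.
  have -> : j = ((j : nat)%:Z)%:~R by rewrite -pmulrn natr_Zp.
  by rewrite E intrD intrM -[n%:Z%:~R]pmulrn (pchar_Zp n_gt1) mul0r addr0.
pose N := (n + k * w + n * w)%N; have lr := ltn_ord r.
have h : (absz (bot r.+1%:Z + N%:Z)%R + nw <= N + N)%N by rewrite /N; lia.
have [B HB] := basis_mx_exists (erefl (\dim (Psi_inv Vf r.+1%:Z%:~R))).
have kN : (k * w <= N)%N by rewrite /N; lia.
have HC := Psi_inv_basis h QV kN HB.
have [bV Vt] := bounded_flagP r.+1%:Z QV.
have [C HC'] : exists C : 'M[F]_(r.+1 + N, N + N), set_basis C [set u | Vf r.+1%:Z (winj (- N%:Z) u)].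
  apply: (@sato_basis F r.+1%:Z); first by case: aV.
  - by apply: subset_trans bV => x; apply: tspan_le; rewrite /N; lia.
  - by apply: subset_trans Vt _ => x; apply: tspan_le; rewrite /N; lia.
  - by rewrite PoszD.
by have := set_basis_size HC HC'; rewrite -Ej /N; move: (\dim _) => d; lia.
Qed.

Lemma Psi_invKV Vf : Q Vf -> Ps (Psi_inv Vf) = Vf.
Proof.
move=> QV; have [aV _] := QV; apply: boolp.funext => i.
have sV := flag_subspace i aV; have [bV Vt] := bounded_flagP i QV.
apply/seteqP; split=> x.
  case/PsiP => xt /(Psi_inv_int i _ aV) Vx.
  exact: (iffRL (subspace_modP sV bV (trunc_decomp xt)) Vx).
move=> Vx; have xt := Vt _ Vx; apply/PsiP; split=> //; apply/Psi_inv_int => //.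
exact: (iffLR (subspace_modP sV bV (trunc_decomp xt)) Vx).
Qed.

(** Coordinates are indexed by pairs of a vertex and a choice of columns; the linear
    forms below involve only one vertex. *)
Lemma linear_form_extend (I J : finType) (h : I -> J) (l : I -> F) :
  exists A : J -> F, forall y : J -> F, \sum_z A z * y z = \sum_g l g * y (h g).
Proof.
exists (fun z => \sum_g l g * (z == h g)%:R) => y.
under eq_bigr do rewrite mulr_suml; rewrite exchange_big /=; apply: eq_bigr => g _.
rewrite (bigD1 (h g)) //= eqxx mulr1 big1 ?addr0 // => z /negPf ->.
by rewrite mulr0 mul0r.
Qed.

(** One piece of the affine flag variety is large enough for the whole image. *)
Lemma Psi_linear : linear_in_coords SX X SAF Ps.
Proof.
move=> []; pose N := (n + k * w + n * w)%N; exists N.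
have h (r : 'I_n) : (absz (bot r.+1%:Z + N%:Z)%R + nw <= N + N)%N.
  by have := ltn_ord r; rewrite /N; lia.
have e (r : 'I_n) : (absz (bot r.+1%:Z + N%:Z)%R + k * w = r.+1 + N)%N by rewrite /N; lia.
pose C (r : 'I_n) (B : 'M[F]_(k * w, nw)) : 'M[F]_(r.+1 + N, N + N) := castmx (e r, erefl)
  (ext_mx (absz (bot r.+1%:Z + N%:Z)%R) (shift_ord (h r) \o @rev_ord nw) B).
have /choice [A HA] : forall z : {r : 'I_n & {ffun 'I_(r.+1 + N) -> 'I_(N + N)}},
    exists A : 'Z_n * {ffun 'I_(k * w) -> 'I_nw} -> F,
    forall y (B : 'M[F]_(k * w, nw)),
      (forall g : {ffun 'I_(k * w) -> 'I_nw}, y ((projT1 z).+1%:Z%:~R, g) = \det (colsub g B)) ->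
      \sum_t A t * y t = \det (colsub (projT2 z) (C (projT1 z) B)).
  move=> [r f] /=.
  have [l Hl] := minors_of_extension (e r) (ext_top F _ _)
    (ext_place F (shift_ord (h r) \o @rev_ord nw)) f.
  have [A HA] := linear_form_extend (fun g : {ffun 'I_(k * w) -> 'I_nw} => ((r.+1%:Z%:~R : 'Z_n), g)) l.
  exists A => y B Hy; rewrite HA [RHS]Hl; apply: eq_bigr => g _; by rewrite Hy.
exists A => x U XU xU r /=; have lr := ltn_ord r.
split.
- by apply: subset_trans (@Psi_bot _ n k w U _) => y; apply: tspan_le; rewrite /N; lia.
- by apply: subset_trans (@Psi_top _ n k w U _) _ => y; apply: tspan_le; rewrite /N; lia.
have [B [fB WB xB]] := xU r.+1%:Z%:~R.
have HB : set_basis B [set u | Ps U r.+1%:Z (psi k r.+1%:Z u)].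
  by split=> // u; rewrite -WB; exact: Psi_psi.
have Ea : (absz (bot r.+1%:Z + N%:Z)%R)%:Z = bot r.+1%:Z + N%:Z by rewrite /N; lia.
have HC := set_basis_cast (e r) (psi_window (h r) Ea (@Psi_subspace _ n k w U _)
  (@Psi_bot _ n k w U _) (@Psi_top _ n k w U _) HB).
have := set_basis_plucker HC; congr plucker_coords.
by apply: boolp.funext => f; rewrite (HA (existT _ r f) x B).
Qed.

Lemma ext_cast_select (a m M d d' : nat) (e : 'I_m -> 'I_M) (ed : (a + d)%N = d')
    (f : {ffun 'I_d -> 'I_m}) : injective e -> (forall r, (a <= e r)%N) -> (a <= M)%N ->
  exists f' : {ffun 'I_d' -> 'I_M}, forall B : 'M[F]_(d, m),
    \det (colsub f' (castmx (ed, erefl) (ext_mx a e B))) = \det (colsub f B).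
Proof.
move=> e1 e2 e3; subst d'; have [f' Hf'] := @ext_mx_select F a m M e e1 e2 e3 d f.
by exists f' => B; rewrite castmx_id.
Qed.

(** Rescales the Pluecker coordinates of a single space. *)
Lemma det_surj (d : nat) (c : F) : (0 < d)%N -> c != 0 ->
  exists2 D : 'M[F]_d, D \in unitmx & \det D = c.
Proof.
move=> d0 c0; pose D : 'M[F]_d := diag_mx (\row_i if i == Ordinal d0 then c else 1).
have dD : \det D = c.
  rewrite det_diag (bigD1 (Ordinal d0)) //= mxE eqxx big1 ?mulr1 // => i /negPf id0.
  by rewrite mxE id0.
by exists D => //; rewrite unitmxE dD unitfE.
Qed.

(** A flag on a small piece is first moved to a large one, in which its coordinates are
    linear forms in the old ones; some of the new coordinates are the minors for the
    quiver Grassmannian, up to a common factor that comes from a change of basis. *)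
Lemma Psi_inv_linear : (0 < k * w)%N -> linear_in_coords SAF Q SX Psi_inv.
Proof.
move=> kw0 N; exists tt; pose N' := (N + n + k * w + n * w)%N.
have h (r : 'I_n) : (absz (bot r.+1%:Z + N'%:Z)%R + nw <= N' + N')%N.
  by have := ltn_ord r; rewrite /N'; lia.
have e (r : 'I_n) : (absz (bot r.+1%:Z + N'%:Z)%R + k * w = r.+1 + N')%N by rewrite /N'; lia.
have NN : (N <= N')%N by rewrite /N'; lia.
have e' (r : 'I_n) : (N' - N + (r.+1 + N) = r.+1 + N')%N by lia.
pose C (r : 'I_n) (B : 'M[F]_(k * w, nw)) : 'M[F]_(r.+1 + N', N' + N') := castmx (e r, erefl)
  (ext_mx (absz (bot r.+1%:Z + N'%:Z)%R) (shift_ord (h r) \o @rev_ord nw) B).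
pose D (r : 'I_n) (B : 'M[F]_(r.+1 + N, N + N)) : 'M[F]_(r.+1 + N', N' + N') := castmx (e' r, erefl)
  (ext_mx (N' - N) (shift_ord (window_enlarge_size NN)) B).
have /choice [rep Hrep] : forall j : 'Z_n, exists r : 'I_n, r.+1%:Z%:~R = j.
  move=> j; have [r [q E]] := int_decomp1 (j : nat)%:Z n_gt1; exists r.
  have -> : j = ((j : nat)%:Z)%:~R by rewrite -pmulrn natr_Zp.
  by rewrite E intrD intrM -[n%:Z%:~R]pmulrn (pchar_Zp n_gt1) mul0r addr0.
have /choice [A HA] : forall t : 'Z_n * {ffun 'I_(k * w) -> 'I_nw},
    exists A : {r : 'I_n & {ffun 'I_(r.+1 + N) -> 'I_(N + N)}} -> F,
    forall y (B1 : 'M[F]_(k * w, nw)) (B2 : 'M[F]_((rep t.1).+1 + N, N + N)) P,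
      (forall g : {ffun 'I_((rep t.1).+1 + N) -> 'I_(N + N)}, y (existT _ (rep t.1) g) = \det (colsub g B2)) ->
      D (rep t.1) B2 = P *m C (rep t.1) B1 ->
      \sum_z A z * y z = \det P * \det (colsub t.2 B1).
  move=> [j f] /=; set r := rep j.
  have [|||f'' Hf''] := @ext_cast_select _ _ _ _ _ (shift_ord (h r) \o @rev_ord nw) (e r) f.
  - by move=> x y [/addnI E]; apply: rev_ord_inj; apply: val_inj.
  - by move=> x; rewrite leq_addr.
  - by apply: leq_trans (h r); rewrite leq_addr.
  have [l Hl] := minors_of_extension (e' r) (ext_top F _ _)
    (ext_place F (shift_ord (window_enlarge_size NN))) f''.
  have [A HA] := linear_form_extend (fun g : {ffun 'I_(r.+1 + N) -> 'I_(N + N)} => existT (fun r : 'I_n => {ffun 'I_(r.+1 + N) -> 'I_(N + N)}) r g) l.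
  exists A => y B1 B2 P Hy EP; rewrite HA -(Hf'' B1) -/(C r B1) -det_mulmx mulmx_colsub -EP.
  by rewrite [RHS]Hl; apply: eq_bigr => g _; rewrite Hy.
exists A => y Vf QV yV j; set r := rep j.
have [bV Vt [B2 [fB2 WB2 yB2]]] := yV r.
have [aV _] := QV.
have [_ dU] := Psi_inv_qg QV.
have [B1 HB1] := basis_mx_exists (dU r.+1%:Z%:~R).
have kN : (k * w <= N')%N by rewrite /N'; lia.
have HC := set_basis_cast (e r) (Psi_inv_basis (h r) QV kN HB1).
have HB2 : set_basis B2 [set u | Vf r.+1%:Z (winj (- N%:Z) u)] by [].
have HD := set_basis_cast (e' r)
  (window_enlarge (window_enlarge_size NN) NN (flag_subspace _ aV) bV Vt HB2).
(* two bases of the same space: det P is the common factor of the minors *)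
have [|P uP EP] := @basis_change F _ _ (C r B1) (D r B2) HC.1 HD.1.
  by move=> u; rewrite -HC.2 -HD.2.
have P0 : \det P != 0 by rewrite -unitfE -unitmxE.
have [P' uP' dP'] := det_surj kw0 P0.
have := plucker_coords_scale uP' (basis_plucker HB1).
rewrite Hrep; congr plucker_coords; apply: boolp.funext => f.
by rewrite (HA (j, f) y B1 B2 P) // dP'.
Qed.

End Sandwich.

(** * Closed conditions on flags, and the points of the extremal translations *)

Section ClosedConditions.
Context (F : numFieldType) (n : nat).
Local Notation AF := (affine_flag F n).
Local Notation SAF := (affine_flag_atlas F n).

Definition coord_poly (J : finType) (z : J) : mpoly.mpoly #|J| F :=
  mpoly.mpolyX F (mpoly.mnm1 (enum_rank z)).

Lemma polyval_coord_poly (J : finType) (z : J) (x : J -> F) :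
  polyval (coord_poly z) x = x z.
Proof. by rewrite /polyval mpoly.mevalXU /= enum_rankK. Qed.

Lemma polyvalB (J : finType) (P Q : mpoly.mpoly #|J| F) (x : J -> F) :
  polyval (P - Q) x = polyval P x - polyval Q x.
Proof. exact: raddfB. Qed.

Lemma polyvalZ (J : finType) c (P : mpoly.mpoly #|J| F) (x : J -> F) :
  polyval (c *: P) x = c * polyval P x.
Proof. exact: mpoly.mevalZ. Qed.

Lemma polyval_sum (J : finType) (K : Type) (s : seq K) (Q : pred K)
    (P : K -> mpoly.mpoly #|J| F) (x : J -> F) :
  polyval (\sum_(i <- s | Q i) P i) x = \sum_(i <- s | Q i) polyval (P i) x.
Proof. exact: raddf_sum. Qed.

(** By [row_sub_minorP] the condition is that all Pluecker coordinates that involve an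
    exponent greater than m vanish. *)
Lemma flag_le_closed (r : 'I_n) (m : int) : 0 <= m ->
  coord_closed_cond SAF AF [set Vf | Vf r.+1%:Z `<=` tspan m].
Proof.
move=> m0 N.
exists [set P | exists2 f : {ffun 'I_(r.+1 + N) -> 'I_(N + N)},
  (exists k, m < (f k).+1%:Z - N%:Z) & P = coord_poly (existT _ r f)].
move=> x Vf aV xV; have [bV Vt [B [fB WB xB]]] := xV r.
have sV : subspace (Vf r.+1%:Z) by case: aV => H _ _; case: (H r.+1%:Z).
have NN : - N%:Z + (N + N)%N%:Z = N%:Z by lia.
split=> [Vm P [f [k fk] ->]|H].
  rewrite polyval_coord_poly xB; apply: (iffLR (row_sub_minorP (f k) fB)) (erefl _) => u /WB /Vm.
  move/tspanP => /(_ _ fk) <-.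
  have -> : mcoeff ((f k).+1%:Z - N%:Z) (winj (- N%:Z) u) = wcof (- N%:Z) (N + N) (winj (- N%:Z) u) 0 (f k).
    by rewrite mxE.
  by rewrite winjK.
move=> y Vy; apply/tspanP => l ml.
have [Nl|lN] := ltP N%:Z l; first exact: (iffLR (tspanP _ _) (Vt _ Vy)).
have hc : (absz (l + N%:Z - 1)%R < N + N)%N by lia.
have yt : tspan (- N%:Z + (N + N)%N%:Z) y by rewrite NN; apply: Vt.
have Wy : (wcof (- N%:Z) (N + N) y <= B)%MS.
  by apply/WB; apply: (iffLR (subspace_modP sV bV (wcof_decomp yt)) Vy).
have := iffRL (row_sub_minorP (Ordinal hc) fB) _ _ Wy.
rewrite mxE /= => <-; first by congr mcoeff; lia.
move=> f k fk; rewrite -xB -polyval_coord_poly; apply: H; exists f => //; exists k.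
by rewrite fk /=; lia.
Qed.

(** Outside of the window of a piece the condition holds everywhere or nowhere; the
    second case is expressed by the equation 1 = 0. *)
Lemma flag_tpow_closed (r : 'I_n) (j : int) :
  coord_closed_cond SAF AF [set Vf | Vf r.+1%:Z (tpow F j)].
Proof.
move=> N; have [jN|Nj] := leP j (- N%:Z).
  exists set0 => x Vf aV xV; have [bV Vt _] := xV r.
  by split=> // _; apply: bV; apply/tspan_tpow.
have [Nj'|jN] := ltP N%:Z j.
  exists [set 1] => x Vf aV xV; have [bV Vt _] := xV r; split.
    by move=> /Vt /tspan_tpow; lia.
  by move=> /(_ 1 erefl) /eqP; rewrite /polyval rmorph1 oner_eq0.
have hc : (absz (j + N%:Z - 1)%R < N + N)%N by lia.
pose u : 'rV[F]_(N + N) := delta_mx 0 (Ordinal hc).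
have Eu : winj (- N%:Z) u = tpow F j.
  rewrite /winj (bigD1 (Ordinal hc)) //= big1 ?addr0.
    by rewrite mxE !eqxx scale1r; congr tpow => /=; lia.
  by move=> c cj; rewrite mxE (negPf cj) andbF scale0r.
exists [set P | exists f : {ffun 'I_(r.+1 + N) -> 'I_(N + N)}, exists c,
  P = u 0 c *: coord_poly (existT _ r f) -
      \sum_k u 0 (f k) *: coord_poly (existT _ r (ffun_upd f k c))].
move=> x Vf aV xV; have [bV Vt [B [fB WB xB]]] := xV r.
rewrite /= -Eu.
have E (f : {ffun 'I_(r.+1 + N) -> 'I_(N + N)}) c :
    polyval (u 0 c *: coord_poly (existT _ r f) -
      \sum_k u 0 (f k) *: coord_poly (existT _ r (ffun_upd f k c))) x =
    \det (colsub f B) * u 0 c - \sum_k u 0 (f k) * \det (colsub (ffun_upd f k c) B).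
  rewrite polyvalB polyvalZ polyval_coord_poly xB mulrC polyval_sum; congr (_ - _).
  by apply: eq_bigr => k _; rewrite polyvalZ polyval_coord_poly xB.
have W : Vf r.+1%:Z (winj (- N%:Z) u) <-> (u <= B)%MS by exact: WB.
rewrite W (sub_minorP u fB); split=> [H P [f [c ->]]|H f c].
  by rewrite E H subrr.
by apply/eqP; rewrite -subr_eq0 -E; apply/eqP; apply: H; exists f, c.
Qed.

End ClosedConditions.

Section BoundedFlagsClosed.
Context (F : numFieldType) (n k w : nat) (n_gt1 : (1 < n)%N) (kn : (k <= n)%N).
Local Notation AF := (affine_flag F n).
Local Notation SAF := (affine_flag_atlas F n).
Local Notation top i := (i - (k * w)%:Z + (n * w)%:Z).
Local Notation bot i := (i - (k * w)%:Z).

Lemma bounded_flags_closed : closed_in SAF AF (@bounded_flags F n k w).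
Proof.
pose D : set ('I_n * option int) :=
  [set z : 'I_n * option int | if z.2 is Some j then j <= bot z.1.+1%:Z else True].
pose C (z : 'I_n * option int) : set (int -> set (laurent F)) :=
  if z.2 is Some j then [set Vf | Vf z.1.+1%:Z (tpow F j)]
  else [set Vf | Vf z.1.+1%:Z `<=` tspan (top z.1.+1%:Z)].
have kw : (k * w <= n * w)%N by rewrite leq_mul2r kn orbT.
suff -> : @bounded_flags F n k w = AF `&` \bigcap_(z in D) C z.
  apply: coord_closed; apply: coord_closed_condI => -[r [j|]] _ /=.
    exact: flag_tpow_closed.
  by apply: flag_le_closed; lia.
apply/seteqP; split=> Vf [aV H]; split=> //.
  move=> [r [j|]] /= Dj; rewrite /C /=; last by case: (H r).
  by case: (H r) => bV _; apply: bV; apply/tspan_tpow.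
move=> r; split; last exact: (H (r, None)).
move=> x xb; apply: xb; split; first exact: (flag_subspace _ aV).
by move=> _ [j jb <-]; apply: (H (r, Some j)).
Qed.

End BoundedFlagsClosed.

Section AffineWeyl.
Context (n : nat).

Lemma affine_weyl_shift (v : int -> int) (i q : int) : affine_weyl n v ->
  v (i + n%:Z * q) = v i + n%:Z * q.
Proof.
case=> _ per _.
have H (m : nat) j : v (j + n%:Z * m%:Z) = v j + n%:Z * m%:Z.
  elim: m => [|m IH]; first by rewrite mulr0 !addr0.
  have -> : n%:Z * m.+1%:Z = n%:Z * m%:Z + n%:Z by lia.
  by rewrite !addrA per IH.
case: q => q; first exact: H.
rewrite NegzE mulrN; have := H q.+1 (i - n%:Z * q.+1%:Z); rewrite subrK => ->.
by rewrite addrK.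
Qed.

Lemma affine_weyl_ext (n_gt1 : (1 < n)%N) (v v' : int -> int) : affine_weyl n v -> affine_weyl n v' ->
  (forall a : 'I_n, v a.+1%:Z = v' a.+1%:Z) -> v = v'.
Proof.
move=> av av' E; apply: boolp.funext => i; have [r [q ->]] := int_decomp1 i n_gt1.
by rewrite !affine_weyl_shift // E.
Qed.

End AffineWeyl.

Section WeylPoints.
Context (F : numFieldType) (n k w : nat) (n_gt1 : (1 < n)%N).
Local Notation nw := (n * w)%N.
Local Notation top i := (i - (k * w)%:Z + (n * w)%:Z).
Local Notation bot i := (i - (k * w)%:Z).
Local Notation Ps := (Psi F n k w).
Local Notation class_mem I i := [exists a in I, (i == a.+1%:Z %[mod n%:Z])%Z].
Implicit Types (I J : {set 'I_n}) (i : int).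

Lemma Zn_natK (j : 'Z_n) : (j : nat)%:Z%:~R = j.
Proof. by rewrite -pmulrn natr_Zp. Qed.

Lemma Zn_eq_mod (i j : int) : (i == j %[mod n%:Z])%Z = (i%:~R == j%:~R :> 'Z_n).
Proof.
rewrite eqz_mod_dvd; apply/dvdzP/eqP => [[q E]|E].
  apply/eqP; rewrite -subr_eq0 -intrB E intrM -[n%:Z%:~R]pmulrn (pchar_Zp n_gt1).
  by rewrite mulr0.
have [q Eq] := Zn_int_repr i n_gt1; have [q' Eq'] := Zn_int_repr j n_gt1.
exists (q - q'); rewrite {1}Eq {1}Eq' E; ring.
Qed.

Lemma mem_class_mod I i i' : (i%:~R == i'%:~R :> 'Z_n) -> (class_mem I i) = (class_mem I i').
Proof.
by move/eqP=> E; apply: eq_existsb => a; rewrite !Zn_eq_mod E.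
Qed.

Lemma natr_nw_int : (nw%:Z%:~R : 'Z_n) = 0.
Proof. by rewrite -pmulrn natr_nw. Qed.

Lemma ord_class_inj (a b : 'I_n) : a.+1%:Z%:~R = b.+1%:Z%:~R :> 'Z_n -> a = b.
Proof.
rewrite -!pmulrn -!natr1 => /addIr E; apply: val_inj.
by apply: Zn_natr_inj E => //.
Qed.

Lemma mem_class I (a : 'I_n) : (class_mem I a.+1%:Z) = (a \in I).
Proof.
apply/exists_inP/idP => [[b bI]|aI]; last by exists a.
by rewrite Zn_eq_mod => /eqP /ord_class_inj ->.
Qed.

(** Each chain is included completely or not at all, as the generators e_0 are those at
    the vertices in I. *)
Definition disp_of_set I (j : 'Z_n) : nat := if class_mem I (j : nat)%:Z then 0%N else nw.

Lemma disp_of_setE I i : disp_of_set I i%:~R = if class_mem I i then 0%N else nw.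
Proof.
rewrite /disp_of_set; congr (if _ then _ else _); apply: mem_class_mod.
by rewrite Zn_natK.
Qed.

Lemma disp_of_set_extremal I j : disp_of_set I j = 0%N \/ disp_of_set I j = nw.
Proof. by rewrite /disp_of_set; case: ifP; [left|right]. Qed.

Lemma extremal_disp_of_set (be : 'Z_n -> nat) : (forall j, be j = 0%N \/ be j = nw) ->
  exists I, be = disp_of_set I.
Proof.
move=> nsb; exists [set a : 'I_n | be (a.+1%:Z%:~R) == 0%N]%SET.
apply: boolp.funext => j; rewrite /disp_of_set; case: ifP => [/exists_inP[a]|nI].
  by rewrite inE Zn_eq_mod Zn_natK => /eqP ba /eqP ->.
have [b0|//] := nsb j; move: nI => /negbT/negP; case.
have [r [q E]] := int_decomp1 (j : nat)%:Z n_gt1.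
have Ej : r.+1%:Z%:~R = j.
  have -> : j = ((j : nat)%:Z)%:~R by rewrite -pmulrn natr_Zp.
  by rewrite E intrD intrM -[n%:Z%:~R]pmulrn (pchar_Zp n_gt1) mul0r addr0.
apply/exists_inP; exists r; first by rewrite inE Ej b0.
by rewrite Zn_eq_mod Zn_natK Ej.
Qed.

Lemma weyl_of_set_value I (a : 'I_n) : weyl_of_set k w I a.+1%:Z =
  if a \in I then a.+1%:Z - (k * w)%:Z + nw%:Z else a.+1%:Z - (k * w)%:Z.
Proof. by rewrite /weyl_of_set mem_class; case: ifP => // _; rewrite addr0. Qed.

Lemma weyl_of_set_affine I : #|I| = k -> affine_weyl n (weyl_of_set k w I).
Proof.
move=> cI; split.
- exists (fun l => if class_mem I (l + (k * w)%:Z) then l + (k * w)%:Z - nw%:Z else l + (k * w)%:Z).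
    move=> i /=; rewrite (@mem_class_mod _ _ (i)).
      by rewrite /weyl_of_set; case: ifP => c1; rewrite ?c1; lia.
    rewrite /weyl_of_set; case: ifP => _; rewrite ?addr0 ?subrK //.
    by rewrite addrAC subrK intrD natr_nw_int addr0.
  move=> l; case: ifP => lI; rewrite /weyl_of_set.
    rewrite (@mem_class_mod _ _ (l + (k * w)%:Z)) ?lI; first by lia.
    by rewrite intrB natr_nw_int subr0.
  by rewrite lI; lia.
- move=> i; rewrite /weyl_of_set (@mem_class_mod _ _ (i)); first by lia.
  by rewrite Zn_intrDn.
rewrite big_add1 /= big_mkord.
under eq_bigr => a _.
  rewrite weyl_of_set_value; have -> : forall b : bool,
    (if b then a.+1%:Z - (k * w)%:Z + nw%:Z else a.+1%:Z - (k * w)%:Z) - a.+1%:Z =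
    (if b then nw%:Z else 0) - (k * w)%:Z by case; lia.
  over.
have mn (x : int) (m : nat) : x *+ m = x * m%:Z by rewrite -mulr_natr natz.
by rewrite sumrB -big_mkcond /= !sumr_const cI card_ord mn mn !PoszM; ring.
Qed.

Lemma weyl_point_mem (v : int -> int) i (x : laurent F) :
  @weyl_point F v i x <-> forall l, mcoeff l x != 0 -> exists2 j, j <= i & v j = l.
Proof.
rewrite /weyl_point -(image_comp v (tpow F)) lspan_tpowP.
by split=> H l /H [j ji <-]; exists j.
Qed.

Context (w_gt0 : (0 < w)%N).

Lemma nw_gt0 : (0 < nw)%N.
Proof. by rewrite muln_gt0 (ltnW n_gt1). Qed.

Lemma disp_of_set_card I : #|[pred j | disp_of_set I j == 0%N]| = #|I|.
Proof.
pose f (a : 'I_n) : 'Z_n := a.+1%:Z%:~R.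
have f_inj : injective f by move=> a b; exact: ord_class_inj.
rewrite -(card_image f_inj); apply: eq_card => j.
apply/idP/fintype.imageP => [|[a aI ->]]; rewrite inE /disp_of_set.
  case: ifP => [/exists_inP [a aI]|_]; last by rewrite gtn_eqF // nw_gt0.
  by rewrite Zn_eq_mod Zn_natK => /eqP E _; exists a.
have -> : [exists b in I, ((f a : nat)%:Z == b.+1%:Z %[mod n%:Z])%Z] = true; last by [].
by apply/exists_inP; exists a => //; rewrite Zn_eq_mod Zn_natK.
Qed.

(** The values of w(I) at the integers up to i are all exponents up to i - kw, and the
    exponents j - kw + nw with j in I and i - nw < j <= i. *)
Lemma weyl_point_Psi I : @weyl_point F (weyl_of_set k w I) = Ps (subrep F w (disp_of_set I)).
Proof.
apply: boolp.funext => i; apply/seteqP; split=> x.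
  move/weyl_point_mem => H; apply/PsiP; split.
    apply/tspanP => l tl; apply/eqP/negPn/negP => /H [j ji]; rewrite /weyl_of_set.
    by case: ifP; lia.
  apply/coord_subP => a; rewrite mxE => /H [j ji]; rewrite /weyl_of_set.
  have := ltn_ord a => la; case: ifP => [jI|_]; last by lia.
  move=> E; have Ej : j = i - (a : nat)%:Z by lia.
  have -> : i%:~R - (a : nat)%:R = j%:~R :> 'Z_n by rewrite Ej intrB -pmulrn.
  by rewrite disp_of_setE jI.
case/PsiP => /tspanP xt /coord_subP xS; apply/weyl_point_mem => l xl.
have lt : l <= top i by rewrite leNgt; apply: contraNN xl => /xt ->.
have [la|la] := ltP (bot i) l.
  have ha : (absz (top i - l)%R < nw)%N by lia.
  pose a := Ordinal ha; pose j := i - (a : nat)%:Z.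
  have := xS a; rewrite mxE (_ : _ + _ = l); last by rewrite /a /=; lia.
  move=> /(_ xl); have -> : i%:~R - (a : nat)%:R = j%:~R :> 'Z_n by rewrite /j intrB -pmulrn.
  rewrite disp_of_setE; case: ifP => [jI _|_]; last by rewrite leqNgt ltn_ord.
  exists j; first by rewrite /j; lia.
  by rewrite /weyl_of_set jI /j /a /=; lia.
have [lI|lI] := boolP (class_mem I (l + (k * w)%:Z)); last first.
  by exists (l + (k * w)%:Z); [lia | rewrite /weyl_of_set (negPf lI); lia].
exists (l + (k * w)%:Z - nw%:Z); first by lia.
rewrite /weyl_of_set (@mem_class_mod _ _ (l + (k * w)%:Z)) ?lI; first by lia.
by rewrite intrB natr_nw_int subr0.
Qed.

End WeylPoints.

(** * Schubert varieties *)

Section Schubert.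
Context (F : numFieldType) (n k w : nat) (n_gt1 : (1 < n)%N) (w_gt0 : (0 < w)%N).
Local Notation nw := (n * w)%N.
Local Notation V := 'rV[F]_(n * w).
Local Notation X := (quiver_grassmannian F n w k).
Local Notation SX := (quiver_grassmannian_atlas F n w k).
Local Notation AF := (affine_flag F n).
Local Notation SAF := (affine_flag_atlas F n).
Local Notation top i := (i - (k * w)%:Z + (n * w)%:Z).
Local Notation bot i := (i - (k * w)%:Z).
Local Notation Ps := (Psi F n k w).
Local Notation Q := (@bounded_flags F n k w).
Local Notation be := (@basis_exp n k w).
Local Notation wI I := (weyl_of_set k w I).
Local Notation sch I := (schubert F n k w (weyl_of_set k w I)).
Implicit Types (I J : {set 'I_n}) (i : int).

Let n_gt0 : (0 < n)%N := ltnW n_gt1.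

Lemma psi_evec i (a : nat) : (a < nw)%N ->
  psi k i (evec F n w a) = tpow F (i - (k * w)%:Z + (nw%:Z - a%:Z)).
Proof.
move=> an; rewrite /psi (bigD1 (Ordinal an)) //= big1 => [|b ba].
  by rewrite mxE eqxx scale1r addr0.
rewrite mxE; have [E|_] := eqVneq (b : nat) a; last by rewrite scale0r.
by case/eqP: ba; apply: val_inj.
Qed.

(** The torus multiplies each power of t by a constant, so it fixes the coordinate
    flags. *)
Lemma flag_act_torus (c : F) (al : 'Z_n -> nat) : c != 0 ->
  let D : 'M[{poly F}]_n := diag_mx (\row_s if s == Ordinal n_gt0 then c%:P else 1) in
  [/\ iwahori F n D, \det D = c%:P &
      flag_act k w D (Ps (subrep F w al)) = Ps (subrep F w al)].
Proof.
move=> c0 D.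
have dD : \det D = c%:P.
  rewrite det_diag (bigD1 (Ordinal n_gt0)) //= mxE eqxx big1 ?mulr1 // => i /negPf id0.
  by rewrite mxE id0.
have iD : iwahori F n D.
  split; first by rewrite unitmxE dD poly_unitE size_polyC c0 coefC /= unitfE.
  apply/is_trig_mxP => r s rs; rewrite !mxE.
  by rewrite (_ : r == s = false) ?mulr0n ?horner0 //; apply: ltn_eqF.
have [_ tD] := iD.
split=> //; rewrite -Psi_gl_aut //; congr Psi; apply: boolp.funext => i.
have aD := gl_aut_is_aut k w n_gt1 iD.
apply/eqP; rewrite eqEdim (aut_act_dim _ _ aD) leqnn andbT.
apply: coord_sub_img => a ha; rewrite gl_aut_app psi_evec //.
set j := _ + _; have [s [m Ej]] := exp_decomp k w n_gt0 j.
suff [c' Ec'] : exists c', gl_act k w D (tpow F j) = c' *: tpow F j.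
  rewrite Ec' /j -psi_evec // linearZ /= psiK; apply: memvZ.
  exact: subrep_evec.
rewrite Ej gl_act_tpow /gl_col (bigD1 s) //= big1 ?addr0.
  rewrite !mxE eqxx mulr1n; case: ifP => _.
    by exists c; rewrite zmulC linearZ /= tmul_tpow.
  by exists 1; rewrite -polyC1 zmulC linearZ /= tmul_tpow.
by move=> r rs; rewrite !mxE (negPf rs) mulr0n zmul0.
Qed.

Lemma flag_actM (g h : 'M[{poly F}]_n) (Vf : int -> set (laurent F)) :
  flag_act k w (g *m h) Vf = flag_act k w g (flag_act k w h Vf).
Proof.
apply: boolp.funext => i; apply/seteqP; split=> x.
  case=> y Vy <-.
  exists (gl_act k w h y); first by exists y.
  exact: esym (gl_actM k w n_gt0 g h y).
case=> _ [y Vy <-] <-.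
exists y; first exact: Vy.
exact: gl_actM k w n_gt0 g h y.
Qed.

Lemma flag_act1 (Vf : int -> set (laurent F)) :
  flag_act k w (1%:M : 'M[{poly F}]_n) Vf = Vf.
Proof.
apply: boolp.funext => i; apply/seteqP; split=> x.
  by case=> y Vy <-; rewrite gl_act1.
by move=> Vx; exists x => //; rewrite gl_act1.
Qed.

(** Orbits of the two Iwahori groups through a coordinate flag are equal: a determinant
    in F[z] that is a unit is constant, and the torus can absorb it. *)
Lemma iwahori_to_sl (g : 'M[{poly F}]_n) (al : 'Z_n -> nat) : iwahori F n g ->
  exists2 g', @iwahori_sl F n g' &
    flag_act k w g (Ps (subrep F w al)) = flag_act k w g' (Ps (subrep F w al)).
Proof.
move=> [ug tg]; have : \det g \is a GRing.unit by rewrite -unitmxE.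
rewrite poly_unitE => /andP[/size_poly1P [c c0 Ec] _].
have [[uD tD] dD fD] := flag_act_torus al (invr_neq0 c0).
exists (g *m diag_mx (\row_s if s == Ordinal n_gt0 then (c^-1)%:P else 1)).
  split; last by rewrite det_mulmx dD Ec -polyCM mulfV.
  by split; [rewrite unitmx_mul ug uD | apply: trig_at0M].
by rewrite flag_actM fD.
Qed.

Lemma iwahori_sl1 : @iwahori_sl F n 1%:M.
Proof.
split; last exact: det1; split; first exact: unitmx1.
apply/is_trig_mxP => r s rs; rewrite !mxE (_ : r == s = false) ?horner0 //.
by apply: ltn_eqF.
Qed.

Lemma subrep_disp_qg I : #|I| = k -> X (subrep F w (disp_of_set w I)).
Proof.
move=> cI; apply/qg_subrep; apply: nonstrict_nb => //.
  exact: disp_of_set_extremal.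
by rewrite disp_of_set_card.
Qed.

Lemma iwahori_orbit_bounded I (g : 'M[{poly F}]_n) : #|I| = k -> iwahori F n g ->
  Q (flag_act k w g (weyl_point (wI I))).
Proof.
move=> cI ig; rewrite weyl_point_Psi // -Psi_gl_aut //; apply: Psi_bounded => //.
by apply: qg_aut_act; [exact: gl_aut_is_aut | exact: subrep_disp_qg].
Qed.

Lemma schubert_min I (M : set (int -> set (laurent F))) : closed_in SAF AF M ->
  (forall g, @iwahori_sl F n g -> M (flag_act k w g (weyl_point (wI I)))) ->
  sch I `<=` M.
Proof.
by move=> cM HM Vf; apply; split=> // _ [g ig <-]; apply: HM.
Qed.

Lemma schubert_point I : sch I (weyl_point (wI I)).
Proof.
by move=> M [_ HM]; apply: HM; exists 1%:M; [exact: iwahori_sl1 | exact: flag_act1].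
Qed.

(** Normal form, degeneration to an extremal coordinate subrepresentation, and
    translation of closed sets through Psi. *)
Lemma Psi_in_schubert U : X U -> exists2 I : {set 'I_n}, #|I| = k & sch I (Ps U).
Proof.
move=> XU; have [A [al [aA bal EU]]] := subrep_normal_form XU.1.
have Xal : X (subrep F w al).
  split=> [|i]; first exact: subrep_stable.
  by rewrite -(aut_act_dim _ i aA) -EU; case: XU.
have [bt [nsb Xbt lim]] := degenerate_to_extremal n_gt1 bal Xal.
have [I EI] := extremal_disp_of_set n_gt1 nsb.
have cI : #|I| = k.
  rewrite -(disp_of_set_card n_gt1 w_gt0) -EI; apply: (nb_nonstrict n_gt1 w_gt0) nsb _.
  by move/qg_subrep: Xbt.
exists I => // M [cM HM]; have mP : is_morphism SX X SAF AF Ps.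
  apply: linear_in_coords_morphism; first by move=> W XW; apply: Psi_affine_flag.
    exact: Psi_linear.
  exact: flag_separated.
have cZ := morphism_closed mP cM.
suff [_] : (X `&` Ps @^-1` M) U by [].
rewrite EU; apply: lim cZ _ _ aA => B aB; split; first exact: qg_aut_act.
have [g ig Hg] := aut_is_gl k n_gt1 w_gt0 aB.
rewrite /preimage /= Hg; last exact: subrep_stable.
have [g' ig' ->] := iwahori_to_sl bt ig.
by apply: HM; exists g' => //; rewrite weyl_point_Psi // EI.
Qed.

Lemma Psi_isomorphism : (0 < k)%N -> is_isomorphism SX X SAF Q Ps.
Proof.
move=> k_gt0.
have sQ : separated_by_coords SAF Q.
  move=> N y Vf Vf' [aV _] [aV' _]; exact: flag_separated aV aV'.
split.
  apply: linear_in_coords_morphism => //; last exact: Psi_linear.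
  by move=> U XU; apply: Psi_bounded.
exists (Psi_inv k w (n := n)); split.
- apply: linear_in_coords_morphism; first by move=> Vf; apply: Psi_inv_qg.
    by apply: Psi_inv_linear => //; rewrite muln_gt0 k_gt0.
  exact: qg_separated.
- by move=> U XU; apply: Psi_invK.
- by move=> Vf QV; apply: Psi_invKV.
Qed.

Context (k_lt : (k < n)%N).

Lemma schubert_bounded I : #|I| = k -> sch I `<=` Q.
Proof.
move=> cI; apply: schubert_min; first exact: bounded_flags_closed (ltnW k_lt).
by move=> g [ig _]; apply: iwahori_orbit_bounded.
Qed.


Lemma schubert_union : \bigcup_(I in [set I : {set 'I_n} | #|I| = k]) sch I = Q.
Proof.
apply/seteqP; split=> Vf.
  by case=> I cI; apply: schubert_bounded.
move=> QV; rewrite -(Psi_invKV n_gt1 QV).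
have [I cI sI] := Psi_in_schubert (Psi_inv_qg n_gt1 QV).
by exists I.
Qed.

(** For a vertex r in J but not in I, all of X_w(I) satisfies
    V_r <= t^(r-kw+nw-1) F[t^-1], because p_w(I) does and the Iwahori group preserves
    the right-hand side; p_w(J) contains t^(r-kw+nw) at r. *)
Lemma schubert_inj I J : #|I| = k -> #|J| = k -> sch I = sch J -> I = J.
Proof.
move=> cI cJ E; apply/eqP; rewrite eq_sym eqEcard cI cJ leqnn andbT.
apply/fintype.subsetP => r rJ; apply/negPn/negP => rI.
pose m := top r.+1%:Z - 1.
pose M := AF `&` [set Vf | Vf r.+1%:Z `<=` tspan m].
have cM : closed_in SAF AF M.
  apply: coord_closed; apply: flag_le_closed; rewrite /m.
  have : (k * w <= n * w)%N by rewrite leq_mul2r (ltnW k_lt) orbT.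
  by lia.
have sIM : sch I `<=` M.
  apply: (schubert_min cM) => g [ig _]; split.
    by have [] := iwahori_orbit_bounded cI ig.
  move=> _ [x xw <-]; apply: gl_act_tspan => //; first by case: ig.
  apply/tspanP => l ml; apply/eqP/negPn/negP.
  move/(iffLR (weyl_point_mem _ _ _) xw) => [j jr]; rewrite /weyl_of_set => Ej.
  have jr' : j = r.+1%:Z by move: Ej ml; rewrite /m; case: ifP => _; lia.
  move: Ej; rewrite jr' mem_class // (negPf rI); move: ml; rewrite /m; lia.
have [_] : M (weyl_point (wI J)) by apply: sIM; rewrite E; apply: schubert_point.
have wJ : @weyl_point F (wI J) r.+1%:Z (tpow F (top r.+1%:Z)).
  apply/weyl_point_mem => l; rewrite mcoeff_tpow.
  have [<- _|_] := eqVneq (top r.+1%:Z) l; last by rewrite eqxx.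
  by exists r.+1%:Z => //; rewrite weyl_of_set_value // rJ.
by move/(_ _ wJ)/tspan_tpow; rewrite /m; lia.
Qed.

End Schubert.

Theorem theorem3 (R : realType) (n k w : nat)
    (hk1 : (1 <= k)%N) (hkn : (k <= n - 1)%N)
    (hw : (1 <= w)%N) :
  let X := quiver_grassmannian R[i] n w k in
  let Y := \bigcup_(I in [set I : {set 'I_n} | #|I| = k])
             schubert R[i] n k w (weyl_of_set k w I) in
  [/\ forall I : {set 'I_n}, #|I| = k ->
        unique (fun v : int -> int => affine_weyl n v /\
                  forall a : 'I_n,
                    v a.+1%:Z = if a \in I
                                then a.+1%:Z - (k * w)%:Z + (n * w)%:Z
                                else a.+1%:Z - (k * w)%:Z)
               (weyl_of_set k w I),
      forall I J : {set 'I_n}, #|I| = k -> #|J| = k ->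
        schubert R[i] n k w (weyl_of_set k w I) =
        schubert R[i] n k w (weyl_of_set k w J) -> I = J,
      is_isomorphism (quiver_grassmannian_atlas R[i] n w k) X
                     (affine_flag_atlas R[i] n) Y (Psi R[i] n k w),
      forall A : 'Z_n -> 'End('rV[R[i]]_(n * w)), is_aut A ->
        exists2 g : 'M[{poly R[i]}]_n, iwahori R[i] n g &
          forall U, X U ->
            Psi R[i] n k w (aut_act A U) = flag_act k w g (Psi R[i] n k w U)
    & forall g : 'M[{poly R[i]}]_n, iwahori R[i] n g ->
        exists2 A : 'Z_n -> 'End('rV[R[i]]_(n * w)), is_aut A &
          forall U, X U ->
            Psi R[i] n k w (aut_act A U) = flag_act k w g (Psi R[i] n k w U)].
Proof.
have n_gt1 : (1 < n)%N by lia.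
have k_lt : (k < n)%N by lia.
move=> X Y; split.
- move=> I cI; split.
    split; first exact: weyl_of_set_affine.
    by move=> a; apply: weyl_of_set_value.
  move=> v [av Hv]; apply: (affine_weyl_ext n_gt1) => //; first exact: weyl_of_set_affine.
  by move=> a; rewrite weyl_of_set_value.
- by move=> I J cI cJ; apply: (schubert_inj (F := R[i]) n_gt1 hw k_lt cI cJ).
- by rewrite /Y (schubert_union R[i] n_gt1 hw k_lt); apply: (Psi_isomorphism R[i]).
- move=> A aA; have [g ig Hg] := aut_is_gl (F := R[i]) k n_gt1 hw aA.
  by exists g => // U [sU _]; apply: Hg.
- move=> g ig; exists (gl_aut k w g); first exact: gl_aut_is_aut.
  by move=> U _; apply: Psi_gl_aut.
Qed.
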